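(* There is a strongly polynomial-time algorithm that, given a finite digraph $D=(V,A)$ having at least one dicut and whose underlying undirected graph is chordal, together with an arc weight function $w:A\to\mathbb{Z}_{\ge 0}$, constructs a packing of $\tau$ dijoins in $(D,w)$, where $\tau$ is the minimum weight of a dicut of $D$. The packing is output in compact form: a family $\mathcal{J}$ of distinct dijoins of $D$ together with multiplicities $\lambda(J)\in\mathbb{Z}_{\ge 0}$ for $J\in\mathcal{J}$, such that $\sum_{J\in\mathcal{J}}\lambda(J)=\tau$ and $\sum_{J\in\mathcal{J}:\,e\in J}\lambda(J)\le w(e)$ for every $e\in A$.
   Context: For a nonempty proper subset $U\subsetneqq V$, let $\delta^+(U)$ and $\delta^-(U)$ denote the sets of arcs of $D$ leaving and entering $U$, respectively. A dicut of $D$ is a set of arcs of the form $\delta^+(U)$, where $\emptyset\ne U\subsetneqq V$ and $\delta^-(U)=\emptyset$. The weight of a dicut is the sum of $w(e)$ over its arcs $e$. A dijoin of $D$ is a set of arcs that intersects every dicut of $D$ at least once. A packing of $k$ dijoins in $(D,w)$ is a list of $k$ dijoins (not necessarily distinct) such that no arc $e$ is contained in more than $w(e)$ of them. An undirected graph is chordal if it has no chordless cycle of length more than $3$; the underlying undirected graph of $D$ is obtained by forgetting arc orientations. Strongly polynomial is meant in the usual sense: the number of elementary arithmetic operations and comparisons is bounded by a polynomial in $|V|$ and $|A|$, independently of the magnitudes of the weights. *)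

(* Defs.v *)
From mathcomp Require Import all_boot all_order all_algebra.

Set Implicit Arguments.
Unset Strict Implicit.
Unset Printing Implicit Defensive.

Import Order.TTheory GRing.Theory Num.Theory.

(* Parallel arcs and loops are allowed. *)
Record digraph (V A : finType) :=
  Digraph { arc_tail : A -> V; arc_head : A -> V }.

Section Digraphs.
Variables (V A : finType) (D : digraph V A).

Definition arcs_out (U : {set V}) : {set A} :=
  [set e | (arc_tail D e \in U) && (arc_head D e \notin U)].

Definition arcs_in (U : {set V}) : {set A} :=
  [set e | (arc_tail D e \notin U) && (arc_head D e \in U)].

Definition dicuts : {set {set A}} :=
  [set arcs_out U | U : {set V}
     & [&& U != set0, U != [set: V] & arcs_in U == set0]].

Definition dijoin (J : {set A}) : bool :=
  [forall C in dicuts, J :&: C != set0].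

Definition weight (w : A -> nat) (C : {set A}) : nat := (\sum_(e in C) w e)%N.

Definition min_dicut_weight (w : A -> nat) (tau : nat) : Prop :=
  (exists2 C, C \in dicuts & weight w C = tau) /\
  (forall C, C \in dicuts -> (tau <= weight w C)%N).

(* Loops and multiplicities play no role in chordality, so the underlying
   undirected graph is represented by its irreflexive adjacency relation. *)
Definition underlying : rel V := fun x y =>
  (x != y) && [exists e, ((arc_tail D e == x) && (arc_head D e == y)) ||
                         ((arc_tail D e == y) && (arc_head D e == x))].

(* N distinct dijoins J i, where J i is taken lambda i times. *)
Definition compact_packing (w : A -> nat) (k N : nat)
    (J : 'I_N -> {set A}) (lambda : 'I_N -> nat) : Prop :=
  [/\ injective J,
      forall i, dijoin (J i),
      (\sum_i lambda i = k)%N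
    & forall e, (\sum_(i | e \in J i) lambda i <= w e)%N].

End Digraphs.

(* The two inequalities say that the edge xy is not an edge of the cycle c. *)
Definition chord (V : eqType) (adj : rel V) (c : seq V) (x y : V) : Prop :=
  [/\ x \in c, y \in c, adj x y, y != next c x & x != next c y].

Definition chordal (V : eqType) (adj : rel V) : Prop :=
  forall c : seq V, ucycle adj c -> (3 < size c)%N ->
    exists x y, chord adj c x y.

(* The machine model: a random access machine over the integers, presented as
   a structured imperative language.  The memory consists of arrays named by
   natural numbers and indexed by integers; a scalar is cell 0 of an array.
   Each constant, memory access, arithmetic operation, comparison, Boolean
   connective, assignment and branching counts as one step, whatever the size
   of the operands.

   The arithmetic operations are addition and subtraction only.  Hence a run
   of t steps on integers of at most b bits involves only integers of O(b + t)
   bits, so that unit-cost arithmetic cannot hide any additional work, and a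
   bound on the number of steps also bounds the space in the way usually
   required from strongly polynomial algorithms. *)

Inductive expr : Type :=
  | Const of int
  | Read of nat & expr
  | Plus of expr & expr
  | Minus of expr & expr.

Inductive test : Type :=
  | Leq of expr & expr
  | Not of test
  | And of test & test.

Inductive cmd : Type :=
  | Skip
  | Write of nat & expr & expr  (* Write a i e is the assignment a[i] := e *)
  | Seq of cmd & cmd
  | If of test & cmd & cmd
  | While of test & cmd.

Definition memory : Type := nat -> int -> int.

Definition update (s : memory) (a : nat) (i v : int) : memory :=
  fun b j => if (b == a) && (j == i) then v else s b j.

Fixpoint eval (s : memory) (e : expr) : int :=
  match e with
  | Const z => z
  | Read a i => s a (eval s i)
  | Plus e1 e2 => (eval s e1 + eval s e2)%R
  | Minus e1 e2 => (eval s e1 - eval s e2)%R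
  end.

Fixpoint expr_cost (e : expr) : nat :=
  match e with
  | Const _ => 1
  | Read _ i => (expr_cost i).+1
  | Plus e1 e2 | Minus e1 e2 => (expr_cost e1 + expr_cost e2).+1
  end.

Fixpoint holds (s : memory) (b : test) : bool :=
  match b with
  | Leq e1 e2 => (eval s e1 <= eval s e2)%R
  | Not b1 => ~~ holds s b1
  | And b1 b2 => holds s b1 && holds s b2
  end.

Fixpoint test_cost (b : test) : nat :=
  match b with
  | Leq e1 e2 => (expr_cost e1 + expr_cost e2).+1
  | Not b1 => (test_cost b1).+1
  | And b1 b2 => (test_cost b1 + test_cost b2).+1
  end.

(* exec c s t s': started in memory s, the command c halts in memory s' after
   exactly t steps. *)
Inductive exec : cmd -> memory -> nat -> memory -> Prop :=
  | ExecSkip s : exec Skip s 1 s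
  | ExecWrite s a i e :
      exec (Write a i e) s (expr_cost i + expr_cost e).+1
           (update s a (eval s i) (eval s e))
  | ExecSeq c1 c2 s1 s2 s3 t1 t2 :
      exec c1 s1 t1 s2 -> exec c2 s2 t2 s3 ->
      exec (Seq c1 c2) s1 (t1 + t2) s3
  | ExecIfTrue b c1 c2 s s' t :
      holds s b -> exec c1 s t s' ->
      exec (If b c1 c2) s (test_cost b + t).+1 s'
  | ExecIfFalse b c1 c2 s s' t :
      ~~ holds s b -> exec c2 s t s' ->
      exec (If b c1 c2) s (test_cost b + t).+1 s'
  | ExecWhileDone b c s :
      ~~ holds s b -> exec (While b c) s (test_cost b).+1 s
  | ExecWhileLoop b c s1 s2 s3 t1 t2 :
      holds s1 b -> exec c s1 t1 s2 -> exec (While b c) s2 t2 s3 ->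
      exec (While b c) s1 (test_cost b + t1 + t2).+1 s3.

Lemma exec_det c s t1 s1 t2 s2 :
  exec c s t1 s1 -> exec c s t2 s2 -> t1 = t2 /\ s1 = s2.
Proof.
move=> H; elim: H t2 s2 => {c s t1 s1}
  [s|s a i e|c1 c2 s1 s2 s3 t1 t2 _ IH1 _ IH2|b c1 c2 s s' t hb _ IH
  |b c1 c2 s s' t hb _ IH|b c s hb|b c s1 s2 s3 t1 t2 hb _ IH1 _ IH2] t' s0 H;
  inversion H; subst; try done;
  repeat match goal with
  | h : is_true (holds ?s ?b), h' : is_true (~~ holds ?s ?b) |- _ =>
      by rewrite h in h'
  | IH : forall t s, exec ?c ?s1 t s -> _, h : exec ?c ?s1 _ _ |- _ =>
      case: (IH _ _ h) => ? ?; subst; clear h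
  end; done.
Qed.

Definition single (x : nat) : int -> int :=
  fun i => if i == 0%R then Posz x else 0%R.

Definition array (m : nat) (f : 'I_m -> nat) : int -> int :=
  fun i => if i is Posz j then
             if (insub j : option 'I_m) is Some e then Posz (f e) else 0%R
           else 0%R.

(* Arrays 0 and 1 hold |V| and |A|, arrays 2, 3 and 4 the tails, the heads and
   the weights of the arcs; all other cells are initially 0. *)
Definition input (n m : nat) (D : digraph 'I_n 'I_m) (w : 'I_m -> nat) :
    memory :=
  fun a => match a with
           | 0 => single n
           | 1 => single m
           | 2 => array (fun e => nat_of_ord (arc_tail D e))
           | 3 => array (fun e => nat_of_ord (arc_head D e))
           | 4 => array w
           | _ => fun=> 0%R
           end.

(* Array 5 holds the number of dijoins in the family, array 6 their
   multiplicities, and array 7 the rows, of length m each, of the incidence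
   matrix of dijoins and arcs. *)
Definition output (m : nat) (s : memory) (N : nat) (J : 'I_N -> {set 'I_m})
    (lambda : 'I_N -> nat) : Prop :=
  [/\ s 5 0%R = Posz N,
      forall i : 'I_N, s 6 (Posz i) = Posz (lambda i)
    & forall (i : 'I_N) (e : 'I_m),
        s 7 (Posz (i * m + e)) = Posz (e \in J i)].

(* Main.v *)
Require Import Defs.
From mathcomp Require Import all_boot all_order all_algebra.
From mathcomp Require Import zify.

(* A chordal graph is dismantled by deleting simplicial vertices one at a time.
   Let S be the set of remaining vertices, R reachability in D (not in D[S]:
   nothing is contracted), and call a nonempty proper subset of S closed under
   R-predecessors a dicut of S, weighted by all arcs it splits; parallel arcs
   have been merged beforehand.  Before a vertex v is deleted, its arcs are
   emptied by exchanges, each of which takes c units of weight from the arcs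
   e, f and gives c units to g.  First, for a R v R b, the arcs av and vb give
   min(W av, W vb) to ab; this changes no dicut weight.  Then the out-neighbours
   b1, b2, ... of v, listed along R, pass what is left on v bi to b1 bi (what is
   left on v b1 is dropped), and symmetrically for the in-neighbours.  Every
   dicut of S - v then extends to a dicut of S which is no heavier.

   A packing for S - v is turned into a packing for S by undoing the exchanges
   in the reverse order: g is replaced by e and f in c copies of the sets, first
   in copies containing g.  Marks on the copies that have received an arc force
   the arcs at v to go to distinct copies, so that, if {v} is a dicut of S, all
   copies meet it as soon as their number is at most the total c of the
   exchanges at v; the bound tau on this number is lowered accordingly, and it
   remains at least the weight of some dicut of D.  Each undone exchange splits
   at most one block of equal copies, so their number stays polynomial. *)

Set Implicit Arguments.
Unset Strict Implicit.
Unset Printing Implicit Defensive.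

Import Order.TTheory GRing.Theory Num.Theory.

(** * Bounded loop programs *)

(* In [PFor x a p] the scalar [x] runs from 0 to the value of cell 0 of the
   array [a], which [p] may not write to; [B a] below stands for that value. *)
Inductive prog : Type :=
  | PSkip
  | PWrite of nat & expr & expr
  | PSeq of prog & prog
  | PIf of test & prog & prog
  | PFor of nat & nat & prog.

Definition cell (x : nat) : expr := Read x (Const 0).
Definition Lt (e1 e2 : expr) : test := Not (Leq e2 e1).
Definition Eq (e1 e2 : expr) : test := And (Leq e1 e2) (Leq e2 e1).

Fixpoint compile (p : prog) : cmd :=
  match p with
  | PSkip => Skip
  | PWrite a i e => Write a i e
  | PSeq p q => Seq (compile p) (compile q)
  | PIf b p q => If b (compile p) (compile q)
  | PFor x a p =>
      Seq (Write x (Const 0) (Const 0))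
          (While (Lt (cell x) (cell a))
             (Seq (compile p) (Write x (Const 0) (Plus (cell x) (Const 1)))))
  end.

Section Run.
Variable B : nat -> nat.

Fixpoint run (p : prog) (s : memory) : memory :=
  match p with
  | PSkip => s
  | PWrite a i e => update s a (eval s i) (eval s e)
  | PSeq p q => run q (run p s)
  | PIf b p q => if holds s b then run p s else run q s
  | PFor x a p =>
      iteri (B a) (fun k s => update (run p s) x 0%R (Posz k.+1))
            (update s x 0%R 0%R)
  end.

Fixpoint time (p : prog) : nat :=
  match p with
  | PSkip => 1
  | PWrite _ i e => (expr_cost i + expr_cost e).+1
  | PSeq p q => time p + time q
  | PIf b p q => (test_cost b + (time p + time q)).+1
  | PFor _ a p => B a * (time p + 20) + 20
  end.

End Run.

Fixpoint writes (p : prog) : seq nat :=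
  match p with
  | PSkip => [::]
  | PWrite a _ _ => [:: a]
  | PSeq p q => writes p ++ writes q
  | PIf _ p q => writes p ++ writes q
  | PFor x _ p => x :: writes p
  end.

Fixpoint bounded (bnd : seq nat) (p : prog) : bool :=
  match p with
  | PSkip => true
  | PWrite a _ _ => a \notin bnd
  | PSeq p q => bounded bnd p && bounded bnd q
  | PIf _ p q => bounded bnd p && bounded bnd q
  | PFor x a p =>
      [&& a \in bnd, x \notin bnd, x \notin writes p & bounded bnd p]
  end.

Lemma updateE (s : memory) a i v b j :
  update s a i v b j = if (b == a) && (j == i) then v else s b j.
Proof. by []. Qed.

Lemma update_neq (s : memory) a i v b : b != a -> update s a i v b = s b.
Proof. by rewrite /update => /negbTE ->. Qed.

Lemma run_frame B p s a : a \notin writes p -> run B p s a = s a.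
Proof.
elim: p s => [|b i e|p IHp q IHq|b p IHp q IHq|x b p IH] s //=.
- by rewrite inE => /update_neq ->.
- by rewrite mem_cat negb_or => /andP[hp hq]; rewrite IHq // IHp.
- by rewrite mem_cat negb_or => /andP[hp hq]; case: ifP => _; rewrite ?IHp ?IHq.
rewrite inE negb_or => /andP[hx hp].
by elim: (B b) => [|k IHk] /=; rewrite update_neq // IH.
Qed.

Lemma writes_bounded bnd p a : bounded bnd p -> a \in bnd -> a \notin writes p.
Proof.
elim: p => [|b i e|p IHp q IHq|b p IHp q IHq|x b p IH] //=.
- by move=> hb ha; rewrite inE; apply: contra hb => /eqP <-.
- by case/andP=> hp hq ha; rewrite mem_cat negb_or IHp ?IHq.
- by case/andP=> hp hq ha; rewrite mem_cat negb_or IHp ?IHq.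
case/and4P=> _ hx _ hp ha; rewrite inE negb_or IH // andbT.
by apply: contra hx => /eqP <-.
Qed.

Lemma exec_run B bnd p s :
  bounded bnd p -> (forall a, a \in bnd -> s a 0%R = Posz (B a)) ->
  exists2 t, exec (compile p) s t (run B p s) & (t <= time B p)%N.
Proof.
elim: p s => [|a i e|p IHp q IHq|b p IHp q IHq|x a p IH] s /=.
- by move=> _ _; exists 1%N => //; constructor.
- by move=> _ _; exists (expr_cost i + expr_cost e).+1 => //; constructor.
- case/andP=> hp hq hs; have [t1 e1 l1] := IHp s hp hs.
  have [|t2 e2 l2] := IHq (run B p s) hq.
    by move=> a ha; rewrite run_frame ?hs // (writes_bounded hp).
  by exists (t1 + t2); [apply: ExecSeq e1 e2 | apply: leq_add].
- case/andP=> hp hq hs; case: ifPn => hb.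
    have [t e l] := IHp s hp hs.
    by exists (test_cost b + t).+1; [apply: ExecIfTrue | lia].
  have [t e l] := IHq s hq hs.
  by exists (test_cost b + t).+1; [apply: ExecIfFalse | lia].
case/and4P=> ha hx hxp hp hs.
set f := fun (k : nat) (s : memory) => update (run B p s) x 0%R (Posz k.+1); set s0 := update s x 0%R 0%R.
have hxa : a != x by apply: contraNneq hx => <-.
have inv k : iteri k f s0 x 0%R = Posz k /\
    forall b, b \in bnd -> iteri k f s0 b 0%R = Posz (B b).
  have hbx b : b \in bnd -> (b == x) = false.
    by move=> hb; apply: contraNF hx => /eqP <-.
  elim: k => [|k [IHx IHb]]; first by split=> [|b hb]; rewrite /= /s0 updateE
    ?eqxx // hbx //= hs.
  split=> [|b hb]; rewrite iteriS {1}/f updateE ?eqxx // hbx //=.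
  by rewrite run_frame ?IHb // (writes_bounded hp).
have loop j k : (k + j = B a)%N -> exists2 t,
   exec (While (Lt (cell x) (cell a))
             (Seq (compile p) (Write x (Const 0) (Plus (cell x) (Const 1)))))
        (iteri k f s0) t (iteri (B a) f s0) & (t <= j * (time B p + 20) + 7)%N.
  elim: j k => [|j IHj] k hk.
    rewrite addn0 in hk; rewrite -hk.
    exists (test_cost (Lt (cell x) (cell a))).+1 => //.
    apply: ExecWhileDone => /=; have [-> hb] := inv k.
    by rewrite hb // -hk negbK lexx.
  have [hkx hkb] := inv k.
  have [t1 e1 l1] := IH _ hp hkb.
  have [|t2 e2 l2] := IHj k.+1; first by rewrite addSnnS.
  exists (test_cost (Lt (cell x) (cell a)) +
          (t1 + (1 + expr_cost (Plus (cell x) (Const 1))).+1) + t2).+1;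
    last by rewrite /= mulSn; lia.
  apply: (ExecWhileLoop _ _ e2).
    rewrite /= hkx hkb // -ltNge ltz_nat; lia.
  apply: (ExecSeq e1).
  rewrite [X in exec _ _ _ X]iteriS {2}/f.
  have -> : Posz k.+1 = eval (run B p (iteri k f s0)) (Plus (cell x) (Const 1)).
    by rewrite /= run_frame // hkx; lia.
  exact: (ExecWrite _ x (Const 0) (Plus (cell x) (Const 1))).
have [t e l] := loop (B a) 0%N (add0n _).
exists (3 + t)%N; last by lia.
by apply: ExecSeq e; apply: (ExecWrite s x (Const 0) (Const 0)).
Qed.

Definition polynomially_bounded (f : nat -> nat) :=
  exists k, forall M, (f M <= k * M.+1 ^ k)%N.

Lemma poly_bound_const c : polynomially_bounded (fun=> c).
Proof. by exists c => M; rewrite leq_pmulr // expn_gt0. Qed.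

Lemma poly_bound_id : polynomially_bounded id.
Proof. by exists 1%N => M; rewrite mul1n expn1. Qed.

Lemma poly_bound_add f g : polynomially_bounded f -> polynomially_bounded g ->
  polynomially_bounded (fun M => f M + g M)%N.
Proof.
move=> [k hk] [l hl]; exists (k + l)%N => M; rewrite mulnDl.
apply: leq_add.
  by apply: leq_trans (hk M) _; rewrite leq_mul2l leq_pexp2l ?leq_addr ?orbT.
by apply: leq_trans (hl M) _; rewrite leq_mul2l leq_pexp2l ?leq_addl ?orbT.
Qed.

Lemma poly_bound_mul f g : polynomially_bounded f -> polynomially_bounded g ->
  polynomially_bounded (fun M => f M * g M)%N.
Proof.
move=> [k hk] [l hl]; exists (k * l + (k + l))%N => M.
apply: leq_trans (leq_mul (hk M) (hl M)) _.
rewrite mulnACA -expnD; apply: leq_mul; first exact: leq_addr.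
by rewrite leq_pexp2l // leq_addl.
Qed.

Lemma poly_bound_le f g : (forall M, f M <= g M)%N ->
  polynomially_bounded g -> polynomially_bounded f.
Proof. by move=> h [k hk]; exists k => M; apply: leq_trans (h M) (hk M). Qed.

Lemma poly_bound_time p : polynomially_bounded (fun M => time (fun=> M) p).
Proof.
elim: p => [|a i e|p IHp q IHq|b p IHp q IHq|x a p IH] /=;
  try exact: poly_bound_const.
- exact: poly_bound_add.
- apply: (@poly_bound_le _ (fun M => (test_cost b).+1 +
    (time (fun=> M) p + time (fun=> M) q))%N) => [M|]; first by lia.
  apply: poly_bound_add (poly_bound_const _) _; exact: poly_bound_add.
apply: poly_bound_add (poly_bound_const _).
apply: poly_bound_mul poly_bound_id _.
exact: poly_bound_add (poly_bound_const _).
Qed.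

Lemma time_mono B C p : (forall a, B a <= C a)%N -> (time B p <= time C p)%N.
Proof.
move=> h; elim: p => [|a i e|p IHp q IHq|b p IHp q IHq|x a p IH] //=.
- exact: leq_add.
- by rewrite ltnS leq_add2l leq_add.
by rewrite leq_add2r leq_mul ?leq_add2r.
Qed.

Lemma poly_bound_comp f d : polynomially_bounded f ->
  polynomially_bounded (fun M => f (M.+1 ^ d)%N).
Proof.
move=> [k hk]; exists (k * 2 ^ k + d * k)%N => M.
apply: leq_trans (hk _) _.
have h : ((M.+1 ^ d).+1 <= 2 * M.+1 ^ d)%N.
  have : (0 < M.+1 ^ d)%N by rewrite expn_gt0. lia.
apply: (@leq_trans (k * (2 * M.+1 ^ d) ^ k)%N).
  by case: k {hk} => // k; rewrite leq_mul2l leq_exp2r.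
rewrite expnMn -expnM mulnA; apply: leq_mul; first exact: leq_addr.
by rewrite leq_pexp2l // leq_addl.
Qed.

(** * Simplicial vertices of chordal graphs *)

Section Dirac.
Variables (V : finType) (adj : rel V).
Hypotheses (adjC : symmetric adj) (adjxx : irreflexive adj).
Hypothesis adj_chordal : chordal adj.

Definition simplicial (S : {set V}) (z : V) : Prop :=
  forall x y, x \in S -> y \in S -> adj z x -> adj z y -> x != y -> adj x y.

(* [u] closed up by a shortest [x]-[y] path is a cycle, whose chord would be
   a shortcut of the path. *)
Lemma no_induced_cycle (C : {set V}) u x y p :
  adj u x -> adj u y -> ~~ adj x y -> u != x -> u != y ->
  (forall z, z \in C -> ~~ adj u z /\ z != u) ->
  path adj x (rcons p y) -> uniq (x :: rcons p y) -> {subset p <= C} -> False.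
Proof.
move=> ux uy nxy nux nuy hC.
have [k] := ubnP (size p); elim: k p => // k IH p hk hp up sp.
have hq : uniq (u :: x :: rcons p y).
  rewrite cons_uniq up andbT inE mem_rcons inE (negbTE nux) (negbTE nuy) /=.
  by apply/negP => /sp /hC[_]; rewrite eqxx.
have hcyc : ucycle adj (u :: x :: rcons p y).
  by rewrite /ucycle hq andbT /= ux rcons_path hp last_rcons adjC uy.
have hsz : (3 < size (u :: x :: rcons p y))%N.
  case: p {IH hk up sp hq hcyc} hp => [|z p] //=; last by rewrite size_rcons.
  by rewrite (negbTE nxy).
set q := x :: rcons p y in hq hcyc hsz *.
have szq : size q = (size p).+2 by rewrite /= size_rcons.
have nextE k0 : (k0 <= size q)%N ->
    next (u :: q) (nth u (u :: q) k0) = nth u q k0.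
  move=> hk0; rewrite next_nth mem_nth // index_uniq //.
have chq i j : (i < j)%N -> (j < size q)%N -> adj (nth u q i) (nth u q j) ->
    nth u q j != next (u :: q) (nth u q i) -> False.
  move=> ij jq hij; rewrite (nextE i.+1) => [nij|]; last exact: ltn_trans jq.
  have {}ij : (i.+1 < j)%N.
    by rewrite ltn_neqAle ij andbT; apply: contraNneq nij => ->.
  case: j ij jq hij {nij} => // j; rewrite ltnS => ij jq hij.
  have jp : (j <= size p)%N by move: jq; rewrite szq !ltnS.
  have ip : (i <= size p)%N := leq_trans (ltnW ij) jp.
  have takeE : take i p = take i (rcons p y) by rewrite -cats1 takel_cat.
  apply: (IH (take i p ++ drop j p)); rewrite ?rcons_cat -?drop_rcons ?takeE //.
  - rewrite -takeE size_cat size_drop size_takel // -ltnS; apply: leq_trans hk.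
    by rewrite ltnS addnBA // ltn_subLR ?ltn_add2r // (leq_trans jp) ?leq_addl.
  - have hj : (j < size (rcons p y))%N by rewrite size_rcons.
    rewrite cat_path (drop_nth u hj) /=.
    move: (hp); rewrite -{1}(cat_take_drop i (rcons p y)) cat_path => /andP[-> _].
    move: (hp); rewrite -{1}(cat_take_drop j.+1 (rcons p y)) cat_path.
    rewrite (take_nth u hj) last_rcons => /andP[_ ->]; rewrite andbT /=.
    move: hij; rewrite /q /=; case: i {takeE} ij ip => [|i] ij ip /=.
      by rewrite take0.
    by rewrite (take_nth u) ?last_rcons // size_rcons ltnS ltnW.
  - apply: subseq_uniq up; rewrite /= eqxx.
    rewrite -[X in subseq _ X](cat_take_drop i (rcons p y)).
    apply: cat_subseq; first exact: subseq_refl.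
    by rewrite -(subnK (ltnW ij)) -drop_drop drop_subseq.
  - move=> z; rewrite -takeE mem_cat => /orP[/mem_take|/mem_drop] /sp //.
have chu b : b \in u :: q -> adj u b -> b != next (u :: q) u ->
    u != next (u :: q) b -> False.
  rewrite (nextE 0) // inE => /orP[/eqP ->|]; first by rewrite adjxx.
  rewrite inE => /orP[/eqP ->|]; first by rewrite eqxx.
  rewrite mem_rcons inE => /orP[/eqP -> _ _|/sp/hC[/negbTE->]] //.
  have ey : nth u (u :: q) (size q) = y by rewrite szq /= nth_rcons ltnn eqxx.
  by rewrite -ey nextE // nth_default ?eqxx.
have [a [b [ha hb hab n1 n2]]] := adj_chordal hcyc hsz.
move: (ha); rewrite inE => /orP[/eqP ea|qa].
  by rewrite ea in hab n1 n2; apply: (chu b).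
move: (hb); rewrite inE => /orP[/eqP eb|qb].
  by rewrite eb in hab n1 n2; apply: (chu a); rewrite // adjC.
have ia := nth_index u qa; have ib := nth_index u qb.
have la : (index a q < size q)%N by rewrite index_mem.
have lb : (index b q < size q)%N by rewrite index_mem.
case: (ltngtP (index a q) (index b q)) => h.
- by apply: (chq _ _ h lb); rewrite ia ib.
- by apply: (chq _ _ h la); rewrite ia ib // adjC.
by move: hab; rewrite -ia -ib h adjxx.
Qed.

Lemma simplicial_nonadjacent (S : {set V}) u w :
  u \in S -> w \in S -> w != u -> ~~ adj u w ->
  exists z, [/\ z \in S, z != u, ~~ adj u z & simplicial S z].
Proof.
have [k] := ubnP #|S|; elim: k S u w => // k IH S u w hk uS wS nwu nuw.
have any (S' : {set V}) (z0 : V) : (#|S'| < k)%N -> z0 \in S' ->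
    exists2 z, z \in S' & simplicial S' z.
  move=> hS' hz0.
  case: (pickP (fun pq : V * V => [&& pq.1 \in S', pq.2 \in S', pq.2 != pq.1
    & ~~ adj pq.1 pq.2])) => [[a b] /= /and4P[ha hb nab hab]|none].
    by have [z [zS _ _ hz]] := IH S' a b hS' ha hb nab hab; exists z.
  exists z0 => // x y hx hy _ _ nxy; move: (none (y, x)) => /=.
  by rewrite hx hy nxy /= adjC => /negbFE.
pose T := [set z in S | (z != u) && ~~ adj u z].
pose eT := [rel p q | [&& p \in T, q \in T & adj p q]].
have eTC : symmetric eT.
  by move=> p q /=; rewrite adjC; do 2?case: (_ \in T).
pose C := [set z | (z \in T) && connect eT w z].
have wT : w \in T by rewrite inE wS nwu.
have wC : w \in C by rewrite inE wT connect0.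
have CT z : z \in C -> [/\ z \in S, z != u & ~~ adj u z].
  by rewrite !inE -!andbA => /and4P[-> -> ->].
have stepC p q : p \in C -> q \in T -> adj p q -> q \in C.
  rewrite !(inE, in_set) => /andP[/= pT cp] qT pq.
  rewrite qT /=; apply: connect_trans cp (connect1 _) => /=.
  by rewrite pq !inE pT qT.
pose N := [set x in S | adj u x && [exists z in C, adj x z]].
have Nclique x y : x \in N -> y \in N -> x != y -> adj x y.
  rewrite !inE => /and3P[xS ux /exists_inP[a aC xa]].
  move=> /and3P[yS uy /exists_inP[b bC yb]] nxy; apply/negPn/negP => hxy.
  have cab : connect eT a b.
    have := sym_connect_sym eTC; move: aC bC; rewrite !inE.
    by move=> /andP[_ ca] /andP[_ cb] eTs; apply: connect_trans cb; rewrite eTs.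
  have nbrC (z : V) : z \in C -> ~~ adj u z /\ z != u by case/CT.
  have [p hp eb] := connectP cab.
  have [hp' sp] : path adj a p /\ {subset a :: p <= C}.
    elim: p a aC {xa cab eb} hp => [|c p IHp] a aC /=.
      by split=> // z; rewrite inE => /eqP ->.
    case/andP=> /and3P[_ cT ac] /(IHp _ (stepC _ _ aC cT ac))[-> sp]; rewrite ac.
    by split=> // z; rewrite inE => /orP[/eqP ->|/sp].
  have hq : path adj x (rcons (a :: p) y) by rewrite /= xa rcons_path hp' -eb adjC.
  have el : last x (rcons (a :: p) y) = y by rewrite last_rcons.
  case: (shortenP hq) el => q; case/lastP: q => [_ _ _ e|q c].
    by rewrite [x]e eqxx in nxy.
  rewrite last_rcons => hq' uq sq ec; rewrite {c}ec in hq' uq sq.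
  have nu (v : V) : adj u v -> u != v by apply: contraTneq => <-; rewrite adjxx.
  apply: (no_induced_cycle ux uy hxy (nu _ ux) (nu _ uy) nbrC hq' uq) => z zq.
  apply: sp; have := sq z; rewrite !mem_rcons !inE zq orbT => /(_ isT) /orP[/eqP ez|//].
  by move: uq; rewrite /= rcons_uniq -ez zq /= andbF.
have nuN z : z \in N -> z \in S by rewrite inE => /andP[].
have closedS z t : z \in C -> t \in S -> adj z t -> t \in C :|: N.
  move=> zC tS zt; rewrite in_setU; case: (boolP (adj u t)) => ut.
    by apply/orP; right; rewrite inE tS ut; apply/exists_inP; exists z; rewrite // adjC.
  rewrite (stepC z) // inE tS ut andbT /=.
  by apply: contraTneq zt => ->; rewrite adjC; case/CT: zC.
have lift z : z \in C -> simplicial (C :|: N) z ->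
    exists z, [/\ z \in S, z != u, ~~ adj u z & simplicial S z].
  move=> zC hz; have [zS zu uz] := CT _ zC; exists z; split=> // x y hx hy zx zy.
  by apply: hz => //; apply: (closedS z).
have ltk : (#|C :|: N| < k)%N.
  rewrite -ltnS; apply: leq_trans hk; rewrite ltnS; apply: proper_card.
  apply/properP; split.
    by apply/subsetP => z; rewrite in_setU => /orP[/CT[]|/nuN].
  exists u => //; rewrite in_setU negb_or; apply/andP; split.
    by apply/negP => /CT[_]; rewrite eqxx.
  by rewrite inE adjxx andbF.
case: (pickP (fun pq : V * V => [&& pq.1 \in N, pq.2 \in C :|: N,
    pq.2 != pq.1 & ~~ adj pq.1 pq.2])) => [[x y] /= /and4P[xN yS nyx nxy]|none].
  have xS : x \in C :|: N by rewrite in_setU xN orbT.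
  have [z [zS nzx nxz hz]] := IH _ x y ltk xS yS nyx nxy.
  apply: (lift z) => //; move: zS; rewrite in_setU => /orP[//|zN].
  by rewrite (Nclique x z) // eq_sym in nxz.
have univ x y : x \in N -> y \in C :|: N -> x != y -> adj x y.
  move=> xN yS nxy; move: (none (x, y)) => /=.
  by rewrite xN yS eq_sym nxy /= => /negbFE.
have [z zC hz] := any C w (leq_ltn_trans (subset_leq_card (subsetUl C N)) ltk) wC.
apply: (lift z) => // x y hx hy zx zy nxy.
move: (hx) (hy); rewrite !in_setU.
case/orP=> [xC|xN _]; last exact: univ.
case/orP=> [yC|yN]; first exact: hz.
by rewrite adjC univ // eq_sym.
Qed.

Lemma exists_simplicial (S : {set V}) x :
  x \in S -> exists2 z, z \in S & simplicial S z.
Proof.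
move=> xS; case: (pickP (fun pq : V * V => [&& pq.1 \in S, pq.2 \in S,
    pq.2 != pq.1 & ~~ adj pq.1 pq.2])) => [[a b] /= /and4P[ha hb nab hab]|none].
  by have [z [zS _ _ hz]] := simplicial_nonadjacent ha hb nab hab; exists z.
exists x => // a b ha hb _ _ nab; move: (none (a, b)) => /=.
by rewrite ha hb eq_sym nab => /negbFE.
Qed.

End Dirac.

(** * Exchange operations on weights and on families *)

Section Exchange.
Variable A : finType.

(* [Some (g, e, f)] moves weight from [e] and [f] to [g], or from [e] to [g] if
   [e = f], or discards the weight of [e] if [g = e = f]; [None] clears the
   marks.  A log entry also records the amount moved. *)
Definition op : Type := option (A * A * A).
Definition entry : Type := option (A * A * A * nat).

Definition wpush (W : A -> nat) (g e f : A) : A -> nat := fun x =>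
  (W x - (if (x == e) || (x == f) then minn (W e) (W f) else 0)
   + (if (x == g) && (x != e) then minn (W e) (W f) else 0))%N.

Fixpoint wfin (W : A -> nat) (ops : seq op) : A -> nat :=
  match ops with
  | [::] => W
  | None :: r => wfin W r
  | Some (g, e, f) :: r => wfin (wpush W g e f) r
  end.

Fixpoint ents (W : A -> nat) (ops : seq op) : seq entry :=
  match ops with
  | [::] => [::]
  | None :: r => None :: ents W r
  | Some (g, e, f) :: r =>
      Some (g, e, f, minn (W e) (W f)) :: ents (wpush W g e f) r
  end.

Definition csum (l : seq entry) : nat :=
  (\sum_(x <- l) if x is Some (_, _, _, c) then c else 0)%N.

Lemma wfin_cat W o1 o2 : wfin W (o1 ++ o2) = wfin (wfin W o1) o2.
Proof. by elim: o1 W => [|[[[g e] f]|] o1 IH] W //=. Qed.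

Lemma ents_cat W o1 o2 : ents W (o1 ++ o2) = ents W o1 ++ ents (wfin W o1) o2.
Proof. by elim: o1 W => [|[[[g e] f]|] o1 IH] W //=; rewrite IH. Qed.

Lemma size_ents W o : size (ents W o) = size o.
Proof. by elim: o W => [|[[[g e] f]|] o IH] W //=; rewrite IH. Qed.

Lemma csum_cat l1 l2 : csum (l1 ++ l2) = (csum l1 + csum l2)%N.
Proof. exact: big_cat. Qed.

Definition okop (g e f : A) : bool :=
  (g == e) && (g == f) || (g != e) && (g != f).

Lemma wpush_le W g e f x : x != g \/ g = e -> (wpush W g e f x <= W x)%N.
Proof.
rewrite /wpush => -[/negbTE -> | ->]; rewrite ?andbN /= addn0; exact: leq_subr.
Qed.

Lemma wfin_le (X : pred A) W ops :
  (forall g e f, Some (g, e, f) \in ops -> ~~ X g \/ g = e) ->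
  forall x, X x -> (wfin W ops x <= W x)%N.
Proof.
elim: ops W => [|o ops IH] W hX x Xx //=.
have {}IH W' := IH W' (fun g e f h => hX g e f (mem_behead (s := o :: ops) h)) x Xx.
case: o hX => [[[g e] f]|] hX //; apply: leq_trans (IH _) _; apply: wpush_le.
case: (hX g e f (mem_head _ _)) => [h|]; [left|by right].
by apply: contraNneq h => <-.
Qed.

(* A piece [(J, b, k)] stands for [k] copies of the arc set [J]; the mark [b]
   records that [J] has received an arc since the marks were last cleared. *)
Definition piece : Type := {set A} * bool * nat.
Implicit Types (u : piece) (l : seq piece).
Definition no_piece : piece := (set0, false, 0).

Definition exchange (g e f : A) (J : {set A}) := (J :\ g) :|: [set e; f].

Definition wsum (phi : {set A} -> bool -> nat) l : nat :=
  (\sum_(u <- l) u.2 * phi u.1.1 u.1.2)%N.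

Definition usage x l := wsum (fun J _ => (x \in J) : nat) l.
Definition marked l := wsum (fun _ b => b : nat) l.
Definition amount l := wsum (fun _ _ => 1) l.

Definition each (Q : {set A} -> bool -> Prop) l :=
  forall i, (i < size l)%N -> Q (nth no_piece l i).1.1 (nth no_piece l i).1.2.

Definition positive l := forall i, (i < size l)%N -> (0 < (nth no_piece l i).2)%N.

Section Transfer.
Variables (P : {set A} -> bool -> bool) (g e f : A).

Definition transfer1 (st : nat * seq piece) (i : nat) : nat * seq piece :=
  let: (r, l) := st in
  let: (J, b, k) := nth no_piece l i in
  if [&& (i < size l)%N, P J b & (0 < r)%N] then
    if (k <= r)%N then
      ((r - k)%N, set_nth no_piece l i (exchange g e f J, true, k))
    else (0, rcons (set_nth no_piece l i (exchange g e f J, true, r))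
                   (J, b, (k - r)%N))
  else (r, l).

Definition transfer (n : nat) st := foldl transfer1 st (iota 0 n).

Lemma wsum_set_nth phi l i u : (i < size l)%N ->
  (wsum phi (set_nth no_piece l i u) +
     (nth no_piece l i).2 * phi (nth no_piece l i).1.1 (nth no_piece l i).1.2
   = wsum phi l + u.2 * phi u.1.1 u.1.2)%N.
Proof.
rewrite /wsum; elim: l i => [|a l IH] [|i] //= h; rewrite !big_cons.
  by lia.
by rewrite -addnA IH // addnA.
Qed.

Lemma wsum_rcons phi l u :
  wsum phi (rcons l u) = (wsum phi l + u.2 * phi u.1.1 u.1.2)%N.
Proof. by rewrite /wsum -cats1 big_cat big_seq1. Qed.

Lemma transfer1_wsum st i : exists J b d,
  [/\ d = 0 \/ P J b, ((transfer1 st i).1 + d = st.1)%N &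
      forall phi, (wsum phi (transfer1 st i).2 + d * phi J b =
        wsum phi st.2 + d * phi (exchange g e f J) true)%N].
Proof.
case: st => r l; rewrite /transfer1; case E: (nth _ _ _) => [[J b] k].
case: ifP => [/and3P[hi hP hr]|_]; last first.
  by exists set0, false, 0; split=> [||phi]; rewrite ?mul0n ?addn0 //; left.
case: (leqP k r) => hk; [exists J, b, k|exists J, b, r]; split=> [||phi] /=; try by right.
- by rewrite subnK.
- have := wsum_set_nth phi (exchange g e f J, true, k) hi.
  by rewrite E.
- by [].
have := wsum_set_nth phi (exchange g e f J, true, r) hi; rewrite E /= => h.
rewrite wsum_rcons /=.
have : (k * phi J b = r * phi J b + (k - r) * phi J b)%N.
  by rewrite -mulnDl subnKC // ltnW.
by lia.
Qed.

Lemma transfer1_size st i :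
  (size (transfer1 st i).2 + (0 < (transfer1 st i).1) <= size st.2 + (0 < st.1)
   /\ size st.2 <= size (transfer1 st i).2)%N.
Proof.
case: st => r l; rewrite /transfer1; case E: (nth _ _ _) => [[J b] k].
case: ifP => [/and3P[hi hP hr]|_] //=.
case: (leqP k r) => hk /=; rewrite ?size_rcons size_set_nth (maxn_idPr hi) hr; lia.
Qed.

Lemma transfer1_each (Q : {set A} -> bool -> Prop) st i :
  (forall J b, Q J b -> P J b -> Q (exchange g e f J) true) ->
  each Q st.2 -> each Q (transfer1 st i).2.
Proof.
move=> hQ; case: st => r l /= hl; rewrite /transfer1.
case E: (nth _ _ _) => [[J b] k].
case: ifP => [/and3P[hi hP hr]|_] //=.
have QJ : Q J b by have := hl i hi; rewrite E.
have h k' : each Q (set_nth no_piece l i (exchange g e f J, true, k')).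
  move=> j; rewrite size_set_nth (maxn_idPr hi) nth_set_nth /= => hj.
  by case: ifP => _ /=; [apply: hQ QJ hP | apply: hl].
case: (leqP k r) => hk //= j; rewrite size_rcons nth_rcons ltnS => hj.
case: ifP => hj1; first exact: h.
by case: ifP => hj2 //=; move: hj1 hj2 hj; case: ltngtP.
Qed.

Lemma transfer1_positive st i : positive st.2 -> positive (transfer1 st i).2.
Proof.
case: st => r l /= hl; rewrite /transfer1.
case E: (nth _ _ _) => [[J b] k].
case: ifP => [/and3P[hi hP hr]|_] //=.
have k0 : (0 < k)%N by have := hl i hi; rewrite E.
have h k' : (0 < k')%N ->
    positive (set_nth no_piece l i (exchange g e f J, true, k')).
  move=> hk' j; rewrite size_set_nth (maxn_idPr hi) nth_set_nth /= => hj.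
  by case: ifP => _ //=; apply: hl.
case: (leqP k r) => hk /=; first exact: h.
move=> j; rewrite size_rcons nth_rcons ltnS => hj.
case: ifP => hj1; first exact: h.
case: ifP => hj2 /=; first by rewrite subn_gt0.
by move: hj1 hj2 hj; case: ltngtP.
Qed.

Lemma transfer1_done st i : (forall J, P (exchange g e f J) true = false) ->
  (st.1 = 0 \/ forall j, (j < minn i (size st.2))%N ->
     ~~ P (nth no_piece st.2 j).1.1 (nth no_piece st.2 j).1.2) ->
  let st' := transfer1 st i in
  (st'.1 = 0 \/ forall j, (j < minn i.+1 (size st'.2))%N ->
     ~~ P (nth no_piece st'.2 j).1.1 (nth no_piece st'.2 j).1.2).
Proof.
move=> hP; case: st => r l /= [-> | hl]; rewrite /transfer1.
  case E: (nth _ _ _) => [[J b] k]; rewrite !andbF /=; by left.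
case E: (nth _ _ _) => [[J b] k].
case: ifP => [/and3P[hi hPJ hr]|hn] /=.
  case: (leqP k r) => hk /=; last by left.
  right=> j; rewrite size_set_nth (maxn_idPr hi) nth_set_nth /= => hj.
  case: eqP => ej /=; first by rewrite hP.
  by apply: hl; lia.
case: (posnP r) => hr; [by left|right=> j hj].
case: (ltngtP j i) => ij; [|lia|].
  by apply: hl; lia.
by move: hn; rewrite ij E /= hr andbT; have -> : (i < size l)%N by [lia|] => /= ->.
Qed.

Lemma transfer_each (Q : {set A} -> bool -> Prop) n st :
  (forall J b, Q J b -> P J b -> Q (exchange g e f J) true) ->
  each Q st.2 -> each Q (transfer n st).2.
Proof.
move=> hQ; rewrite /transfer; elim: (iota 0 n) st => //= i s IH st hst.
by apply: IH; apply: transfer1_each.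
Qed.

Lemma transfer_positive n st : positive st.2 -> positive (transfer n st).2.
Proof.
rewrite /transfer; elim: (iota 0 n) st => //= i s IH st hst.
by apply: IH; apply: transfer1_positive.
Qed.

Lemma transfer_size n st :
  (size (transfer n st).2 + (0 < (transfer n st).1) <= size st.2 + (0 < st.1)
   /\ size st.2 <= size (transfer n st).2)%N.
Proof.
rewrite /transfer; elim: (iota 0 n) st => //= i s IH st.
by have [h1 h2] := IH (transfer1 st i); have [h3 h4] := transfer1_size st i; lia.
Qed.

Lemma left_foldl s st : ((foldl transfer1 st s).1 <= st.1)%N.
Proof.
elim: s st => //= i s IH st; apply: leq_trans (IH _) _.
by have [J [b [d [_ <- _]]]] := transfer1_wsum st i; apply: leq_addr.
Qed.

Lemma transfer_wsum_ge (phi : {set A} -> bool -> nat) lo hi n st :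
  (forall J b, P J b -> phi J b + lo <= phi (exchange g e f J) true + hi)%N ->
  (wsum phi st.2 + (st.1 - (transfer n st).1) * lo <=
   wsum phi (transfer n st).2 + (st.1 - (transfer n st).1) * hi)%N.
Proof.
move=> h; rewrite /transfer; elim: (iota 0 n) st => [|i s IH] st /=.
  by rewrite subnn !mul0n.
have := IH (transfer1 st i); have := left_foldl s (transfer1 st i).
have [J [b [d [hd e1 e2]]]] := transfer1_wsum st i.
set r := (foldl _ _ _).1 => hr.
have -> : (st.1 - r = (transfer1 st i).1 - r + d)%N by lia.
have : (d * phi J b + d * lo <= d * phi (exchange g e f J) true + d * hi)%N.
  by rewrite -!mulnDr; case: hd => [->|/h hh]; rewrite ?mul0n // leq_mul2l hh orbT.
have := e2 phi; rewrite !mulnDl; lia.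
Qed.

Lemma transfer_wsum_le (phi : {set A} -> bool -> nat) lo hi n st :
  (forall J b, P J b -> phi (exchange g e f J) true + lo <= phi J b + hi)%N ->
  (wsum phi (transfer n st).2 + (st.1 - (transfer n st).1) * lo <=
   wsum phi st.2 + (st.1 - (transfer n st).1) * hi)%N.
Proof.
move=> h; rewrite /transfer; elim: (iota 0 n) st => [|i s IH] st /=.
  by rewrite subnn !mul0n.
have := IH (transfer1 st i); have := left_foldl s (transfer1 st i).
have [J [b [d [hd e1 e2]]]] := transfer1_wsum st i.
set r := (foldl _ _ _).1 => hr.
have -> : (st.1 - r = (transfer1 st i).1 - r + d)%N by lia.
have : (d * phi (exchange g e f J) true + d * lo <= d * phi J b + d * hi)%N.
  by rewrite -!mulnDr; case: hd => [->|/h hh]; rewrite ?mul0n // leq_mul2l hh orbT.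
have := e2 phi; rewrite !mulnDl; lia.
Qed.

Lemma transfer_done n st : (size st.2 <= n)%N ->
  (forall J, P (exchange g e f J) true = false) ->
  let st' := transfer n st in
  st'.1 = 0 \/ each (fun J b => ~~ P J b) st'.2.
Proof.
move=> hn hP st'.
have inv k : let st1 := transfer k st in
    st1.1 = 0 \/ forall j, (j < minn k (size st1.2))%N ->
       ~~ P (nth no_piece st1.2 j).1.1 (nth no_piece st1.2 j).1.2.
  elim: k => [|k IH]; first by right=> j; rewrite min0n.
  have -> : transfer k.+1 st = transfer1 (transfer k st) k.
    by rewrite /transfer -[k.+1]addn1 iotaD foldl_cat.
  exact: transfer1_done hP IH.
case: (posnP st'.1) => [|r0]; [by left | right].
have [h0|h] := inv n; first by rewrite /st' h0 in r0.
move=> j hj; apply: h; rewrite leq_min hj andbT.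
have [h1 _] := transfer_size n st; apply: leq_trans hj (leq_trans _ hn).
by move: h1 r0; rewrite -/st'; lia.
Qed.

End Transfer.

Definition unmark_without (g : A) u : piece :=
  (if u.1.2 then u.1.1 :\ g else u.1.1, u.1.2, u.2).

Definition clear u : piece := (u.1.1, false, u.2).

Definition undo (n : nat) (en : entry) l : seq piece :=
  match en with
  | None => map clear l
  | Some (g, e, f, c) =>
      (transfer (fun _ b => ~~ b) g e f n
        (transfer (fun J b => (g \in J) && ~~ b) g e f n
           (c, map (unmark_without g) l))).2
  end.

Definition undo_all n (l : seq piece) (es : seq entry) := foldr (undo n) l es.

Lemma undo_all_cat n l e1 e2 :
  undo_all n l (e1 ++ e2) = undo_all n (undo_all n l e2) e1.
Proof. exact: foldr_cat. Qed.

Lemma each_map Q (h : piece -> piece) l :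
  each (fun J b => forall k, Q (h (J, b, k)).1.1 (h (J, b, k)).1.2) l ->
  each Q (map h l).
Proof.
move=> hl i; rewrite size_map => hi; rewrite (nth_map no_piece) //.
by have := hl i hi (nth no_piece l i).2; case: (nth _ _ _) => [[J b] k].
Qed.

Lemma each_sub (Q Q' : {set A} -> bool -> Prop) l :
  (forall J b, Q J b -> Q' J b) -> each Q l -> each Q' l.
Proof. by move=> h hl i hi; apply/h/hl. Qed.

Lemma undo_size n en l : (size l <= size (undo n en l) <= size l + 1)%N.
Proof.
case: en => [[[[g e] f] c]|] /=; last by rewrite size_map leqnn leq_addr.
set st := transfer _ _ _ _ _ (c, _).
have [h1 h2] := transfer_size (fun _ b => ~~ b) g e f n st.
have := transfer_size (fun J b => (g \in J) && ~~ b) g e f n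
  (c, map (unmark_without g) l).
rewrite -/st /= size_map => -[h3 h4]; lia.
Qed.

Lemma undo_positive n en l : positive l -> positive (undo n en l).
Proof.
move=> hl.
have hm (h : piece -> piece) : (forall u, (h u).2 = u.2) -> positive (map h l).
  move=> hh i; rewrite size_map => hi.
  by rewrite (nth_map no_piece) // hh; apply: hl.
case: en => [[[[g e] f] c]|] /=; last exact: hm.
by do 2!apply: transfer_positive; apply: hm.
Qed.

Lemma undo_each (Q Q' : {set A} -> bool -> Prop) n g e f c l :
  (forall J, Q J true -> Q' (J :\ g) true) ->
  (forall J, Q J false -> Q' J false /\ Q' (exchange g e f J) true) ->
  each Q l -> each Q' (undo n (Some (g, e, f, c)) l).
Proof.
move=> h1 h2 hl.
apply: (@each_sub (fun J b => Q' J b /\ (~~ b -> Q' (exchange g e f J) true))).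
  by move=> J b [].
have tr J b : Q' J b /\ (~~ b -> Q' (exchange g e f J) true) -> ~~ b ->
    Q' (exchange g e f J) true /\ (~~ true -> Q' (exchange g e f (exchange g e f J)) true).
  by move=> [_ h] /h.
rewrite /=; apply: (transfer_each tr); apply: transfer_each => [J b hQ /andP[_ nb]|].
  exact: tr hQ nb.
apply: each_map => /=; apply: each_sub hl => J [] hQ k; rewrite /unmark_without /=.
  by split=> //; apply: h1.
by have [] := h2 J hQ.
Qed.

Lemma undo_amount n en l : amount (undo n en l) = amount l.
Proof.
have ham phi (h : piece -> piece) : (forall u, (h u).2 = u.2) ->
    (forall J b, phi J b = 1) -> wsum phi (map h l) = amount l.
  move=> hh hphi; rewrite /amount /wsum big_map; apply: eq_bigr => u _.
  by rewrite hphi hh.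
case: en => [[[[g e] f] c]|] /=; last exact: ham.
have tr P st : amount (transfer P g e f n st).2 = amount st.2.
  rewrite /transfer; elim: (iota 0 n) st => //= i s IH st; rewrite IH.
  have [J [b [d [_ _ h]]]] := transfer1_wsum P g e f st i.
  by have := h (fun _ _ => 1); rewrite /amount; lia.
by rewrite !tr /amount; apply: ham.
Qed.

Lemma in_exchange g e f J x :
  (x \in exchange g e f J) = (x == e) || (x == f) || (x \in J) && (x != g).
Proof. by rewrite !inE orbC [(_ != _) && _]andbC. Qed.

Lemma wsum_each0 phi l : each (fun J b => phi J b = 0) l -> wsum phi l = 0.
Proof.
move=> h; rewrite /wsum (big_nth no_piece) big_nat big1 // => i /andP[_ hi].
by rewrite h ?muln0.
Qed.

Lemma undo_usage n W g e f l : okop g e f -> (size l < n)%N ->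
  (forall x, (usage x l <= wpush W g e f x)%N) ->
  forall x, (usage x (undo n (Some (g, e, f, minn (W e) (W f))) l) <= W x)%N.
Proof.
move=> hop hn hl x; set c := minn _ _.
have h0 y : (usage y (map (unmark_without g) l) <= usage y l)%N.
  rewrite /usage /wsum big_map; apply: leq_sum => -[[J b] k] _ /=.
  rewrite leq_mul2l; case: b; rewrite ?leqnn ?orbT // in_setD1.
  by case: (y \in J); rewrite ?andbF ?leq_b1 ?orbT.
rewrite /=; set st1 := transfer _ _ _ _ _ (c, _); set st2 := transfer _ _ _ _ _ st1.
have r1 : (st1.1 <= c)%N := left_foldl _ _ _ _ _ _.
have r2 : (st2.1 <= st1.1)%N := left_foldl _ _ _ _ _ _.
have wx := hl x; rewrite /wpush in wx.
have ce : (c <= W e)%N := geq_minl _ _.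
have cf : (c <= W f)%N := geq_minr _ _.
have up P m st : (usage x (transfer P g e f m st).2 <= usage x st.2 +
    (st.1 - (transfer P g e f m st).1) * ((x == e) || (x == f)))%N.
  have := @transfer_wsum_le P g e f (fun J _ => (x \in J) : nat) 0
     ((x == e) || (x == f)) m st.
  rewrite muln0 addn0; apply=> J b _; rewrite in_exchange.
  by case: (x == e); case: (x == f); case: (x \in J); case: (x == g).
have u1 := up (fun J b => (g \in J) && ~~ b) n (c, map (unmark_without g) l).
have u2 := up (fun _ b => ~~ b) n st1.
rewrite -/st1 -/st2 /= in u1 u2; have h0x := h0 x.
case hx: ((x == e) || (x == f)); rewrite hx in u1 u2 wx.
  suff hg : (x == g) && (x != e) = false.
    rewrite hg !muln1 in u1 u2 wx.
    have : (c <= W x)%N by case/orP: hx => /eqP ->.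
    by rewrite -/c in wx; lia.
  apply/negbTE; case/orP: hop => [/andP[/eqP <- _]|/andP[ge gf]]; first by rewrite andbN.
  by case/orP: hx => /eqP ->; rewrite ?eqxx ?andbF // eq_sym (negbTE gf).
rewrite !muln0 !addn0 in u1 u2; rewrite subn0 in wx.
case hg: ((x == g) && (x != e)); rewrite hg ?addn0 in wx; last by lia.
case/andP: hg => /eqP exg xe; rewrite exg -/c in h0x u1 u2 wx hx xe *.
have gJ J : (g \in exchange g e f J) = false.
  by rewrite in_exchange hx eqxx andbF.
have v1 : (usage g st1.2 + (c - st1.1) <= usage g (map (unmark_without g) l))%N.
  have := @transfer_wsum_le (fun J b => (g \in J) && ~~ b) g e f
     (fun J _ => (g \in J) : nat) 1 0 n (c, map (unmark_without g) l).
  rewrite muln0 addn0 muln1; apply=> J b /andP[-> _]; by rewrite gJ.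
have hs : (size (c, map (unmark_without g) l).2 <= n)%N by rewrite size_map ltnW.
have [|r0|hh] := @transfer_done (fun J b => (g \in J) && ~~ b) g e f n _ hs.
- by move=> J; rewrite andbF.
- by rewrite -/st1 in r0; lia.
suff u0 : usage g st1.2 = 0 by lia.
apply: wsum_each0; rewrite -/st1 in hh.
have h1 : each (fun J b => b -> g \notin J) st1.2.
  apply: transfer_each => [J b _ _ _|]; first by rewrite gJ.
  by apply: each_map => j hj k /=; case: (_.1.2); rewrite ?setD11.
move=> i hi; have := hh i hi; have := h1 i hi.
by case: (_ \in _) => //=; case: (_.1.2) => // /(_ isT).
Qed.

Lemma undo_marked n g e f c l : (size l < n)%N ->
  (minn (amount l) (marked l + c) <= marked (undo n (Some (g, e, f, c)) l))%N.
Proof.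
move=> hn.
have h0 : marked (map (unmark_without g) l) = marked l.
  by rewrite /marked /wsum big_map; apply: eq_bigr => -[[J b] k].
have ha : amount (undo n (Some (g, e, f, c)) l) = amount l := undo_amount _ _ _.
move: ha; rewrite /=.
set st1 := transfer _ _ _ _ _ (c, _); set st2 := transfer _ _ _ _ _ st1 => ha.
have r1 : (st1.1 <= c)%N := left_foldl _ _ _ _ _ _.
have r2 : (st2.1 <= st1.1)%N := left_foldl _ _ _ _ _ _.
have up (P : {set A} -> bool -> bool) m st : (forall J b, P J b -> ~~ b) ->
    (marked st.2 + (st.1 - (transfer P g e f m st).1) <=
     marked (transfer P g e f m st).2)%N.
  move=> hP; have := @transfer_wsum_ge P g e f (fun _ b => b : nat) 1 0 m st.
  by rewrite muln0 !addn0 muln1; apply=> J b /hP; case: b.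
have u1 := up (fun J b => (g \in J) && ~~ b) n (c, map (unmark_without g) l).
have u2 := up (fun _ b => ~~ b) n st1.
rewrite -/st1 -/st2 /= h0 in u1 u2.
have {}u1 : (marked l + (c - st1.1) <= marked st1.2)%N by apply: u1 => J b /andP[].
have {}u2 : (marked st1.2 + (st1.1 - st2.1) <= marked st2.2)%N by apply: u2.
have hs : (size st1.2 <= n)%N.
  have := transfer_size (fun J b => (g \in J) && ~~ b) g e f n
    (c, map (unmark_without g) l).
  rewrite -/st1 /= size_map; case: (posnP c) => _ []; lia.
have [|r0|hh] := @transfer_done (fun _ b => ~~ b) g e f n st1 hs; first by [].
  by rewrite -/st2 in r0; lia.
suff -> : marked st2.2 = amount st2.2 by rewrite ha geq_minl.
rewrite /marked /amount /wsum !(big_nth no_piece) !big_nat.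
apply: eq_bigr => i /andP[_ hi]; have := hh i hi; rewrite negbK -/st2 => ->.
by [].
Qed.

End Exchange.

(** * Elimination of vertices *)

Section Elimination.
Variables (V A : finType) (D : digraph V A).
Notation adj := (underlying D).

Definition arc_rel : rel V := fun x y =>
  [exists e, (arc_tail D e == x) && (arc_head D e == y)].
Notation R := (connect arc_rel).
Definition Rop : rel V := fun x y => R y x.

Definition splits (U : {set V}) (e : A) : bool :=
  (arc_tail D e \in U) != (arc_head D e \in U).

Definition joins (e : A) (x y : V) : bool :=
  ((arc_tail D e == x) && (arc_head D e == y)) ||
  ((arc_tail D e == y) && (arc_head D e == x)).

Lemma joins_splits U e x y : joins e x y -> splits U e = ((x \in U) != (y \in U)).
Proof.
by rewrite /splits => /orP[]/andP[/eqP -> /eqP ->] //; rewrite eq_sym.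
Qed.

Lemma joins_inj e x y z : joins e x y -> joins e x z -> y = z.
Proof.
by case/orP=> /andP[/eqP h1 /eqP h2] /orP[]/andP[/eqP h3 /eqP h4]; congruence.
Qed.

Lemma joinsC e x y : joins e x y = joins e y x.
Proof. by rewrite /joins orbC. Qed.

Lemma splitsC U e : splits (~: U) e = splits U e.
Proof. by rewrite /splits !inE; do 2!case: (_ \in U). Qed.

Variable ar : V -> V -> option A.
Hypothesis ar_joins : forall x y e, ar x y = Some e -> joins e x y.
Hypothesis ar_neq : forall x y e, ar x y = Some e -> x != y.
Hypothesis ar_adj : forall x y, adj x y -> ar x y.
Hypothesis ar_sym : forall x y, ar x y = ar y x.

Lemma adjE x y : adj x y = ar x y :> bool.
Proof.
apply/idP/idP => [/ar_adj //|]; case E: (ar x y) => [e|] // _.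
rewrite /underlying (ar_neq E); apply/existsP; exists e; exact: ar_joins E.
Qed.

Lemma ar_some x y : adj x y -> exists e, ar x y = Some e.
Proof. by move/ar_adj; case: (ar x y) => // e _; exists e. Qed.

Lemma adj_sym : symmetric adj.
Proof. by move=> x y; rewrite !adjE ar_sym. Qed.

Lemma adj_irr : irreflexive adj.
Proof. by move=> x; rewrite /underlying eqxx. Qed.

Lemma ar_endpoint v x b e : ar v x = Some e -> ar v b = Some e -> x = b.
Proof. by move=> /ar_joins h1 /ar_joins h2; apply: joins_inj h1 h2. Qed.

Lemma ar_irr x : ar x x = None.
Proof. by case E: (ar x x) => [e|] //; have := ar_neq E; rewrite eqxx. Qed.

Lemma adj_R x y : adj x y -> R x y \/ R y x.
Proof.
case/andP=> _ /existsP[e /orP[] h]; [left|right]; apply: connect1;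
  by apply/existsP; exists e.
Qed.

Definition wt (W : A -> nat) (U : {set V}) : nat := (\sum_e W e * splits U e)%N.

Lemma sum_at (F : A -> nat) e : (\sum_x (x == e) * F x = F e)%N.
Proof.
rewrite (bigD1 e) //= eqxx mul1n big1 ?addn0 // => x /negbTE ->.
by rewrite mul0n.
Qed.

Lemma wt_wpush W g e f U : okop g e f ->
  (wt (wpush W g e f) U + minn (W e) (W f) * (splits U e + (f != e) * splits U f)
   = wt W U + minn (W e) (W f) * ((g != e) * splits U g))%N.
Proof.
move=> hop; set c := minn _ _.
have ce : (c <= W e)%N := geq_minl _ _.
have cf : (c <= W f)%N := geq_minr _ _.
rewrite mulnDr -(sum_at (splits U) e) -(sum_at (splits U) f) -(sum_at (splits U) g).
rewrite !big_distrr /= -!big_split /=; apply: eq_bigr => x _.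
rewrite /wpush -/c.
case: (x =P e) => [->|/eqP xe]; rewrite ?eqxx ?andbF ?orbT /=.
  rewrite [e == f]eq_sym [e == g]eq_sym; case: (f =P e) => _; case: (g =P e) => _ /=;
  nia.
case: (x =P f) => [ef|/eqP xf]; rewrite ?orbT ?orbF /=.
  have -> : (f != e) by rewrite -ef.
  have -> : (x == g) = false.
    case/orP: hop => [/andP[/eqP ge /eqP gf]|/andP[_ /negbTE gf]].
      by rewrite ef -gf ge eqxx in xe.
    by rewrite ef eq_sym.
  by rewrite ef /= ?mul1n ?mul0n ?muln0 ?addn0 ?add0n -mulnDl subnK.
case: (x =P g) => [xg|_]; rewrite ?mul0n ?muln0 ?addn0 ?andbT /=; last by nia.
case: (g =P e) => [ge|_] /=; first by rewrite xg ge eqxx in xe.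
by rewrite xg subn0 !mul1n mulnDl.
Qed.

Definition closedin (S : {set V}) (Q : rel V) (U : {set V}) : Prop :=
  forall x y, x \in S -> y \in S -> Q x y -> y \in U -> x \in U.

Definition dicutin (S U : {set V}) : Prop :=
  [/\ U \subset S, U != set0, U != S & closedin S R U].

Definition hits (J : {set A}) (U : {set V}) : Prop :=
  exists2 e, e \in J & splits U e.

Definition inside (S : {set V}) (e : A) : bool :=
  (arc_tail D e \in S) && (arc_head D e \in S).

Definition within (S : {set V}) (J : {set A}) : Prop :=
  forall e, e \in J -> inside S e.

Lemma joins_inside S e x y : joins e x y -> inside S e = (x \in S) && (y \in S).
Proof.
by rewrite /inside => /orP[]/andP[/eqP -> /eqP ->] //; rewrite andbC.
Qed.

Definition valid (tau : nat) (S : {set V}) (W : A -> nat) (fam : seq (piece A)) :=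
  [/\ positive fam, forall x, (usage x fam <= W x)%N, amount fam = tau &
      each (fun J _ => within S J /\ forall U, dicutin S U -> hits J U) fam].

Lemma exchange_hits J U g e f : hits J U ->
  (splits U g -> splits U e || splits U f) -> hits (exchange g e f J) U.
Proof.
case=> x xJ xU h; case: (x =P g) => [xg|/eqP xg].
  move: xU; rewrite xg => /h /orP[] hs; [exists e|exists f] => //;
  by rewrite in_exchange eqxx ?orbT.
by exists x => //; rewrite in_exchange xJ xg !orbT.
Qed.

Lemma exchange_within S J g e f : within S J -> inside S e -> inside S f ->
  within S (exchange g e f J).
Proof.
by move=> h he hf x; rewrite in_exchange -orbA => /or3P[/eqP->|/eqP->|/andP[/h]].
Qed.

Lemma each_clear (Q : {set A} -> bool -> Prop) l :
  each (fun J _ => Q J false) l -> each Q (map (@clear A) l).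
Proof. by move=> h; apply: each_map => i hi k; apply: h. Qed.

Lemma undo_all_size n es (l : seq (piece A)) :
  (size l <= size (undo_all n l es) <= size l + size es)%N.
Proof.
elim: es => [|en es IH]; first by rewrite addn0 leqnn.
rewrite /undo_all /= -/(undo_all n l es).
by have := undo_size n en (undo_all n l es); lia.
Qed.

Lemma usage_clear x (l : seq (piece A)) : usage x (map (@clear A) l) = usage x l.
Proof. by rewrite /usage /wsum big_map. Qed.

Lemma undo_all_usage n (W : A -> nat) (ops : seq (op A)) (l : seq (piece A)) :
  (forall g e f, Some (g, e, f) \in ops -> okop g e f) ->
  (size l + size ops <= n)%N ->
  (forall x, usage x l <= wfin W ops x)%N ->
  forall x, (usage x (undo_all n l (ents W ops)) <= W x)%N.
Proof.
elim: ops W => [|o ops IH] W //= hok hn hl.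
have hok' g e f (h : Some (g, e, f) \in ops) : okop g e f.
  by apply: hok; rewrite inE h orbT.
have hs W' := undo_all_size n (ents W' ops) l.
case: o hok hl => [[[g e] f]|] hok hl; rewrite /undo_all /= -/(undo_all _ _ _).
  apply: undo_usage; first by apply: hok; rewrite mem_head.
    by have := hs (wpush W g e f); rewrite size_ents; lia.
  by apply: IH => //; lia.
by move=> x; rewrite usage_clear; apply: IH => //; lia.
Qed.

Lemma undo_all_positive n es (l : seq (piece A)) : positive l -> positive (undo_all n l es).
Proof. by move=> h; elim: es => //= en es IH; apply: undo_positive. Qed.

Lemma undo_all_amount n es (l : seq (piece A)) : amount (undo_all n l es) = amount l.
Proof. by elim: es => //= en es IH; rewrite undo_amount. Qed.

Definition isolated (t : A * A * A) : seq (op A) := [:: Some t; None].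
Definition isolate (ts : seq (A * A * A)) : seq (op A) := flatten (map isolated ts).

Lemma isolate_undo n (W : A -> nat) ts (Q : {set A} -> Prop) (fam : seq (piece A)) :
  (forall g e f, (g, e, f) \in ts -> forall J, Q J -> Q (exchange g e f J)) ->
  each (fun J _ => Q J) fam ->
  each (fun J _ => Q J) (undo_all n fam (ents W (isolate ts))).
Proof.
elim: ts W => [|[[g e] f] ts IH] W hQ hfam //.
have {}IH := IH (wpush W g e f)
  (fun g e f h => hQ g e f (mem_behead (s := _ :: ts) h)) hfam.
apply: (@undo_each _ (fun J b => Q J /\ ~~ b) _ n g e f) => [J []//|J [hJ _]|].
  by split=> //; apply: hQ; rewrite ?mem_head.
by apply: each_clear; apply: each_sub IH => J _ hJ.
Qed.

Definition sideop (v b1 b : V) : seq (op A) :=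
  if ar v b is Some e then [:: Some (odflt e (ar b1 b), e, e)] else [::].

Definition sideops (v b1 : V) (bs : seq V) : seq (op A) :=
  flatten (map (sideop v b1) bs).

Lemma side_undo (Q : rel V) (S : {set V}) v b1 bs (W : A -> nat) n (fam : seq (piece A))
    (P : {set V} -> Prop) :
  v \in S -> b1 \in S -> b1 != v -> Q v b1 ->
  (forall U, P U -> closedin S Q U) ->
  (forall b, b \in bs -> [/\ b \in S, Q v b & Q b1 b]) ->
  pairwise Q bs -> uniq bs ->
  each (fun J b => [/\ ~~ b, within S J & forall U, P U -> hits J U]) fam ->
  each (fun J b => [/\ within S J, forall U, P U -> hits J U &
      b -> exists x e, [/\ x \in bs, ar v x = Some e & e \in J]])
    (undo_all n fam (ents W (sideops v b1 bs))).
Proof.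
move=> vS b1S b1v vb1 hP; elim: bs W => [|b bs IH] W hbs /=.
  by move=> _ _; apply: each_sub => J c [nc h1 h2]; split=> //; rewrite (negbTE nc).
case/andP=> hQb hQ /andP[nb ub] hfam.
have {}IH W' := IH W' (fun b h => hbs b (mem_behead (s := _ :: bs) h)) hQ ub hfam.
have [bS vb b1b] := hbs b (mem_head _ _).
rewrite /sideops /= -/(sideops _ _ _) /sideop; case E: (ar v b) => [e|] /=; last first.
  apply: each_sub (IH W) => J c [h1 h2 h3]; split=> // /h3[x [e' [xs ex eJ]]].
  by exists x, e'; rewrite inE xs orbT.
have je := ar_joins E.
set g := odflt e _.
have hg U : P U -> splits U g -> splits U e /\ b \notin U.
  move=> /hP hU.
  have [p [pS jg pb pU]] : exists p, [/\ p \in S, joins g p b, Q p b &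
      p \in U -> v \in U].
    rewrite /g; case E1: (ar b1 b) => [g1|] /=; last by exists v.
    exists b1; split=> //; first exact: ar_joins E1.
    by apply: hU.
  rewrite (joins_splits _ jg) (joins_splits _ je).
  case bU: (b \in U); first by rewrite (hU p b).
  by case: (boolP (p \in U)) => // /pU ->.
have eS : inside S e by rewrite (joins_inside _ je) vS bS.
have ng x e' : x \in bs -> ar v x = Some e' -> e' != g.
  move=> xs ex; apply: contraNneq nb => eg; rewrite eg in ex; move: ex; rewrite /g.
  case E1: (ar b1 b) => [g1|] /= ex; last by rewrite -(ar_endpoint ex E).
  have := ar_joins E1; have := ar_joins ex; have := ar_neq E.
  move=> nvb; rewrite /joins => /orP[]/andP[/eqP-> /eqP->] /orP[]/andP[/eqP e1 /eqP e2];
    by [rewrite -e1 eqxx in b1v|rewrite e1 eqxx in nvb|rewrite -e2 eqxx in b1v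
       |rewrite e2 eqxx in nvb|rewrite -e1 eqxx in nvb|rewrite -e2 eqxx in nvb
       |rewrite e1 eqxx in b1v|rewrite e2 eqxx in b1v].
apply: (@undo_each _ _ _ n g e e) (IH (wpush W g e e)) => J [h1 h2 h3].
  have [//|x [e' [xs ex eJ]]] := h3.
  have hx := ng x e' xs ex.
  have xS : x \in S by have [] := hbs x; rewrite // inE xs orbT.
  split=> [y||_].
  - by rewrite in_setD1 => /andP[_ /h1].
  - move=> U PU; have [y yJ yU] := h2 U PU.
    case: (y =P g) => [yg|/eqP yg]; last by exists y; rewrite // in_setD1 yg.
    exists e'; first by rewrite in_setD1 hx.
    have [hse bU] := hg U PU (etrans (congr1 _ (esym yg)) yU).
    move: hse; rewrite (joins_splits _ je) (joins_splits _ (ar_joins ex)).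
    rewrite (negbTE bU); case: (boolP (x \in U)) => [xU|_ //].
    have bx : Q b x by apply: (allP hQb).
    by rewrite (hP U PU b x) in bU.
  by exists x, e'; rewrite inE xs orbT in_setD1 hx.
split; split=> //.
- exact: exchange_within.
- move=> U PU; apply: exchange_hits (h2 U PU) _ => /(hg U PU)[-> _] //.
by exists b, e; rewrite mem_head in_exchange eqxx.
Qed.

Lemma side_marked v b1 bs (W : A -> nat) n (fam : seq (piece A)) :
  (size fam + size (sideops v b1 bs) <= n)%N ->
  (forall g e f, Some (g, e, f) \in sideops v b1 bs -> okop g e f) ->
  (minn (amount fam) (marked fam + csum (ents W (sideops v b1 bs)))
   <= marked (undo_all n fam (ents W (sideops v b1 bs))))%N.
Proof.
rewrite /sideops.
have : all isSome (flatten (map (sideop v b1) bs)).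
  by elim: bs => //= b bs IH; rewrite all_cat IH andbT /sideop; case: (ar v b).
elim: (flatten _) W => [|[[[g e] f]|] ops IH] W //=.
  by move=> _ _ _; rewrite /csum big_nil addn0; apply: geq_minr.
move=> hs hn hok.
have hok' g' e' f' (h : Some (g', e', f') \in ops) : okop g' e' f'.
  by apply: hok; rewrite inE h orbT.
have h1 : (size fam + size ops <= n)%N by lia.
have {}IH := IH (wpush W g e f) hs h1 hok'.
set r := undo_all _ _ _ in IH.
have sr : (size r < n)%N.
  have := undo_all_size n (ents (wpush W g e f) ops) fam.
  by rewrite -/r size_ents; lia.
have := undo_marked g e f (minn (W e) (W f)) sr.
rewrite {1}/r undo_all_amount /csum big_cons -/(csum _).
rewrite /undo_all /= -/(undo_all _ _ _) -/r; lia.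
Qed.

Definition sidelist (Q : rel V) (S : {set V}) (v : V) (bs : seq V) : Prop :=
  [/\ uniq bs, pairwise Q bs &
      forall b, (b \in bs) = [&& b \in S :\ v, isSome (ar v b) & Q v b]].

Lemma ar_ne v a b c e g : ar v a = Some e -> ar b c = Some g ->
  v != b -> v != c -> g != e.
Proof.
move=> /ar_joins h1 /ar_joins h2 vb vc; apply/eqP => ge; rewrite ge in h2.
have : (v == b) || (v == c); last by rewrite (negbTE vb) (negbTE vc).
move: h1 h2 => /orP[]/andP[/eqP h1 /eqP h2] /orP[]/andP[/eqP h3 /eqP h4];
  apply/orP; solve [left; apply/eqP; congruence | right; apply/eqP; congruence].
Qed.

Lemma sidelist_mem Q S v bs b : reflexive Q -> sidelist Q S v bs -> b \in bs ->
  [/\ b \in S, b != v, isSome (ar v b) & Q v b] /\ Q (head v bs) b.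
Proof.
move=> hQ [_ hp hb] bbs; split.
  by have := bbs; rewrite hb in_setD1 -andbA => /and4P[].
case: bs hp bbs {hb} => //= b1 bs /andP[h _]; rewrite inE => /orP[/eqP -> //|].
exact: (allP h).
Qed.

Lemma head_mem (T : eqType) (x : T) s y : y \in s -> head x s \in s.
Proof. by case: s => //= z s _; rewrite mem_head. Qed.

Lemma sideops_okop v b1 bs g e f : Some (g, e, f) \in sideops v b1 bs ->
  [/\ okop g e f, f = e & exists2 b, b \in bs &
    ar v b = Some e /\ (g = e \/ ar b1 b = Some g)].
Proof.
case/flattenP=> _ /mapP[b bbs ->]; rewrite /sideop.
case E: (ar v b) => [e'|] //; rewrite inE => /eqP[-> -> ->].
split=> //; first by rewrite /okop !andbb orbN.
by exists b => //; split=> //; case: (ar b1 b) => [g'|]; [right|left].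
Qed.

Lemma sidelist_undo (Q : rel V) (S : {set V}) v bs (W : A -> nat) n
    (fam : seq (piece A)) (P : {set V} -> Prop) :
  reflexive Q -> v \in S -> (forall U, P U -> closedin S Q U) ->
  sidelist Q S v bs ->
  each (fun J b => [/\ ~~ b, within S J & forall U, P U -> hits J U]) fam ->
  each (fun J b => [/\ within S J, forall U, P U -> hits J U &
      b -> exists x e, [/\ x \in bs, ar v x = Some e & e \in J]])
    (undo_all n fam (ents W (sideops v (head v bs) bs))).
Proof.
move=> hQ vS hP hbs; case E: bs => [|b bs'].
  by apply: each_sub => J c [nc h1 h2]; split=> //; rewrite (negbTE nc).
rewrite -E; have bb : b \in bs by rewrite E mem_head.
have [[h1 h2 h3 h4] h5] := sidelist_mem hQ hbs (head_mem v bb).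
have [u p _] := hbs.
apply: side_undo hP _ p u => // x xbs.
by have [[xS _ _ vx] hx] := sidelist_mem hQ hbs xbs.
Qed.

Lemma csum_nil : csum ([::] : seq (entry A)) = 0.
Proof. exact: big_nil. Qed.

Lemma csumN (l : seq (entry A)) : csum (None :: l) = csum l.
Proof. by rewrite /csum big_cons. Qed.

Lemma marked_each (l : seq (piece A)) : positive l -> (amount l <= marked l)%N ->
  each (fun _ b => b) l.
Proof.
rewrite /amount /marked /wsum.
elim: l => [|[[J b] k] l IH] //= hp; rewrite !big_cons /= muln1.
have k0 : (0 < k)%N := hp 0 isT.
have hl : (\sum_(u <- l) u.2 * (u.1.2 : nat) <= \sum_(u <- l) u.2 * 1)%N.
  by apply: leq_sum => u _; rewrite leq_mul2l leq_b1 orbT.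
case: b {hp} (fun j => hp j.+1) => hp /= h; last by lia.
case=> [|i] //= hi; apply: IH => //; last by lia.
Qed.

Definition generated (S : {set V}) : Prop :=
  forall x y, x \in S -> y \in S -> R x y ->
    connect (fun p q => [&& p \in S, q \in S, adj p q & R p q]) x y.

Definition step_ops v ts (bs0 bs1 : seq V) : seq (op A) :=
  isolate ts ++ sideops v (head v bs0) bs0 ++
  None :: sideops v (head v bs1) bs1 ++ [:: None].

Lemma wt_isolate ts (W : A -> nat) U :
  (forall g e f, (g, e, f) \in ts -> okop g e f /\ (splits U e + (f != e) * splits U f
     = (g != e) * splits U g)%N) ->
  wt (wfin W (isolate ts)) U = wt W U.
Proof.
elim: ts W => [|[[g e] f] ts IH] W //= h.
rewrite IH => [|g' e' f' h']; last by apply: h; rewrite inE h' orbT.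
have [hop hs] := h g e f (mem_head _ _).
by have := wt_wpush W U hop; rewrite hs => /addIn.
Qed.

Lemma wt_sideops v b1 bs (W : A -> nat) U : b1 != v ->
  (forall b e, b \in bs -> ar v b = Some e -> splits U e ->
     W e = 0 \/ exists2 g, ar b1 b = Some g & splits U g) ->
  (wt W U <= wt (wfin W (sideops v b1 bs)) U)%N.
Proof.
move=> b1v; rewrite /sideops; elim: bs W => [|b bs IH] W //= h.
rewrite /sideop; case E: (ar v b) => [e|] /=; last first.
  by apply: IH => b' e' hb'; apply: h; rewrite inE hb' orbT.
set g := odflt e _.
apply: leq_trans (IH _ _).
  have hop : okop g e e by rewrite /okop !andbb orbN.
  have := wt_wpush W U hop; rewrite eqxx mul0n addn0 minnn.
  case: (boolP (splits U e)) => se; last by rewrite muln0; lia.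
  have [->|[g' eg sg]] := h b e (mem_head _ _) E se; first by lia.
  have -> : g != e.
    rewrite /g eg; apply: (ar_ne E eg); [by rewrite eq_sym|exact: ar_neq E].
  by rewrite [in splits U g]/g eg /= sg; lia.
move=> b' e' hb' E' se'; have [W0|?] := h b' e' (mem_behead (s := _ :: _) hb') E' se';
  [left|by right].
apply/eqP; rewrite -leqn0 -W0; apply: wpush_le; rewrite /g.
case E1: (ar b1 b) => [g1|] /=; last by right.
by left; rewrite eq_sym; apply: (ar_ne E' E1); [by rewrite eq_sym|exact: ar_neq E].
Qed.

Lemma wt_csum (W : A -> nat) ops U :
  (forall g e f, Some (g, e, f) \in ops -> okop g e f /\ f = e) ->
  (wt W U <= wt (wfin W ops) U + csum (ents W ops))%N.
Proof.
elim: ops W => [|[[[g e] f]|] ops IH] W //= h; first exact: leq_addr.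
  have [hop fe] := h g e f (mem_head _ _).
  have := wt_wpush W U hop; rewrite fe eqxx mul0n addn0 /csum big_cons -/(csum _).
  have := IH (wpush W g e e) (fun g e f hh => h g e f (mem_behead (s := _ :: _) hh)).
  by case: (splits U e); nia.
by rewrite csumN; apply: IH => g e f hh; apply: h; rewrite inE hh orbT.
Qed.

Lemma isolate_zero (X : pred A) ts (W : A -> nat) :
  (forall g e f, (g, e, f) \in ts -> [/\ X e, X f & ~~ X g]) ->
  forall g e f, (g, e, f) \in ts ->
  wfin W (isolate ts) e = 0 \/ wfin W (isolate ts) f = 0.
Proof.
elim: ts W => [|[[g0 e0] f0] ts IH] W //= h g e f; rewrite inE.
have h' g1 e1 f1 (hh : (g1, e1, f1) \in ts) := h g1 e1 f1 (mem_behead (s := _ :: _) hh).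
case/orP=> [/eqP[_ -> ->]|]; last exact: IH.
have [Xe Xf nXg] := h g0 e0 f0 (mem_head _ _).
have le x : X x -> (wfin (wpush W g0 e0 f0) (isolate ts) x <= wpush W g0 e0 f0 x)%N.
  apply: wfin_le => g1 e1 f1 /flattenP[_ /mapP[[[g2 e2] f2] ht ->]].
  by rewrite !inE orbF => /eqP[-> _ _]; have [_ _ ->] := h' _ _ _ ht; left.
have [h1 h2] : e0 != g0 /\ f0 != g0.
  by split; apply: contraNneq nXg => <-.
have := le _ Xe; have := le _ Xf; rewrite /wpush !eqxx (negbTE h1) (negbTE h2) /= orbT.
by rewrite /isolate; case: (leqP (W e0) (W f0)) => hw; [left|right]; lia.
Qed.

Lemma sideops_zero v b1 bs (W : A -> nat) b e : b1 != v ->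
  b \in bs -> ar v b = Some e -> wfin W (sideops v b1 bs) e = 0.
Proof.
move=> b1v; rewrite /sideops; elim: bs W => [|b' bs IH] W //=; rewrite inE.
have le W' : (wfin W' (sideops v b1 bs) e <= W' e)%N \/ ar v b <> Some e.
  case: (ar v b =P Some e) => [E|]; [left|by right].
  apply: (@wfin_le _ (pred1 e)) => [g e1 f|]; last exact: eqxx.
  case/sideops_okop=> _ _ [c _ [Ec [->|Eg]]]; [by right|left].
  rewrite /= ; apply: (ar_ne E Eg); [by rewrite eq_sym|exact: ar_neq Ec].
case: (boolP (b \in bs)) => [hb _ E|_]; first by rewrite wfin_cat; apply: IH.
rewrite orbF => /eqP <- E; case: (le (wfin W (sideop v b1 b))) => // {}le.
apply/eqP; rewrite -leqn0 wfin_cat; apply: leq_trans le _.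
by rewrite /sideop E /= /wpush eqxx /= minnn subnn andbF.
Qed.

Definition zero (S : {set V}) (W : A -> nat) : Prop := forall e,
  arc_tail D e != arc_head D e ->
  ~~ (inside S e && (ar (arc_tail D e) (arc_head D e) == Some e)) -> W e = 0.

Section Step.
Variables (S : {set V}) (v : V) (ts : seq (A * A * A)) (bs0 bs1 : seq V).
Hypotheses (vS : v \in S) (v_simplicial : simplicial adj S v).
Hypothesis tsP : forall g e f, (g, e, f) \in ts <->
  exists a b, [/\ a \in S :\ v, b \in S :\ v, R a v, R v b &
     [/\ ar v a = Some e, ar v b = Some f & ar a b = Some g]].
Hypotheses (bs0P : sidelist R S v bs0) (bs1P : sidelist Rop S v bs1).
Hypothesis S_generated : generated S.

Let R_refl : reflexive R := connect0 _.
Let Rop_refl : reflexive Rop := fun x => connect0 _ x.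

Lemma ts_mem g e f : (g, e, f) \in ts ->
  [/\ g != e, g != f, f != e & [/\ inside S e, inside S f &
     exists a b, [/\ a \in bs1, b \in bs0 & [/\ ar v a = Some e, ar v b = Some f
        & ar a b = Some g]]]].
Proof.
case/tsP=> a [b [aS bS av vb [ea ef eg]]].
move: (aS) (bS); rewrite !in_setD1 => /andP[nav aS'] /andP[nbv bS'].
split; first by apply: (ar_ne ea eg); rewrite eq_sym.
- by apply: (ar_ne ef eg); rewrite eq_sym.
- apply/eqP => fe; rewrite fe in ef; have ab := ar_endpoint ea ef.
  by rewrite ab ar_irr in eg.
split; first by rewrite (joins_inside _ (ar_joins ea)) vS aS'.
  by rewrite (joins_inside _ (ar_joins ef)) vS bS'.
have [_ _ h0] := bs0P; have [_ _ h1] := bs1P.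
by exists a, b; rewrite h0 h1 aS bS ea ef /=; split.
Qed.

Lemma step_okop g e f : Some (g, e, f) \in step_ops v ts bs0 bs1 -> okop g e f.
Proof.
rewrite /step_ops !(mem_cat, inE) /= orbF => /or3P[|/sideops_okop[]//|/sideops_okop[]//].
case/flattenP=> _ /mapP[[[g' e'] f'] ht ->]; rewrite !inE orbF => /eqP[-> -> ->].
by have [h1 h2 _ _] := ts_mem ht; rewrite /okop h1 h2 orbT.
Qed.

Lemma dicutin_del U : dicutin S U -> U != [set v] -> U != S :\ v ->
  dicutin (S :\ v) (U :\ v).
Proof.
case=> US U0 nUS cU nUv nUS'; split.
- exact: setSD.
- apply: contraNneq U0 => h; rewrite -subset0; apply/subsetP => x xU.
  rewrite inE; apply: contraNT nUv => _; rewrite eqEsubset.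
  have sub : U \subset [set v].
    apply/subsetP => y yU; rewrite inE; apply/negPn/negP => yv.
    by have : y \in U :\ v by [rewrite in_setD1 yv]; rewrite h inE.
  rewrite sub; apply/subsetP => y; rewrite inE => /eqP ->.
  by have := subsetP sub x xU; rewrite inE => /eqP <-.
- apply/eqP => h; case: (boolP (v \in U)) => vU.
    by rewrite -(setD1K vU) h setD1K ?eqxx in nUS.
  have e : U :\ v = U.
    apply/setP => x; rewrite in_setD1.
    by case: (x =P v) => // ->; rewrite (negbTE vU).
  by rewrite -h e eqxx in nUS'.
move=> x y; rewrite !in_setD1 => /andP[-> xS] /andP[_ yS] xy /andP[_ yU].
exact: cU xy yU.
Qed.

Lemma within_del J : within (S :\ v) J -> within S J.
Proof.
by move=> h e /h; rewrite /inside !in_setD1 => /andP[/andP[_ ->] /andP[_ ->]].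
Qed.

Lemma splits_del U e : inside (S :\ v) e -> splits (U :\ v) e = splits U e.
Proof.
by rewrite /inside /splits !in_setD1 => /andP[/andP[-> _] /andP[-> _]].
Qed.

Lemma source_sides U : dicutin S U -> U = [set v] -> bs1 = [::] /\ ts = [::].
Proof.
move=> [_ _ _ cU] eU; have b10 : bs1 = [::].
  case E: bs1 => [|a l] //; have abs : a \in bs1 by rewrite E mem_head.
  have [[aS nav _ Rav] _] := sidelist_mem Rop_refl bs1P abs.
  have : a \in U by apply: (cU a v) => //; rewrite eU set11.
  by rewrite eU inE (negbTE nav).
split=> //; case E: ts => [|[[g e] f] l] //.
have /ts_mem[_ _ _ [_ _ [a [b [h _ _]]]]] : (g, e, f) \in ts by rewrite E mem_head.
by rewrite b10 in h.
Qed.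

Lemma sink_sides U : dicutin S U -> U = S :\ v -> bs0 = [::] /\ ts = [::].
Proof.
move=> [_ _ _ cU] eU; have b00 : bs0 = [::].
  case E: bs0 => [|b l] //; have bbs : b \in bs0 by rewrite E mem_head.
  have [[bS nbv _ Rvb] _] := sidelist_mem R_refl bs0P bbs.
  have : v \in U by apply: (cU v b) => //; rewrite eU in_setD1 nbv.
  by rewrite eU in_setD1 eqxx.
split=> //; case E: ts => [|[[g e] f] l] //.
have /ts_mem[_ _ _ [_ _ [a [b [_ h _]]]]] : (g, e, f) \in ts by rewrite E mem_head.
by rewrite b00 in h.
Qed.

Lemma valid_step tau n W fam : 
  (forall U, dicutin S U -> U = [set v] \/ U = S :\ v ->
     (tau <= csum (ents W (step_ops v ts bs0 bs1)))%N) ->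
  (size fam + size (step_ops v ts bs0 bs1) <= n)%N ->
  valid tau (S :\ v) (wfin W (step_ops v ts bs0 bs1)) fam ->
  valid tau S W (undo_all n fam (ents W (step_ops v ts bs0 bs1))).
Proof.
move=> htau hn [hpos hus ham hJ]; split.
- exact: undo_all_positive.
- by apply: undo_all_usage => //; apply: step_okop.
- by rewrite undo_all_amount.
move: hn htau; rewrite /step_ops.
set o1 := sideops v (head v bs1) bs1; set o0 := sideops v (head v bs0) bs0.
rewrite !(ents_cat, undo_all_cat, size_cat) /= !(ents_cat, undo_all_cat, size_cat) /=.
set W1 := wfin W (isolate ts); set W2 := wfin W1 o0.
move=> hn htau.
set fam1 := undo_all n fam [:: None].
have s1 : size fam1 = size fam by rewrite /fam1 /= size_map.
set fam2 := undo_all n fam1 (ents W2 o1).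
have s2 : (size fam2 <= size fam + size o1)%N.
  by have := undo_all_size n (ents W2 o1) fam1; rewrite size_ents s1 => /andP[].
set fam3 := undo_all n fam2 [:: None].
have s3 : size fam3 = size fam2 by rewrite /fam3 /= size_map.
set fam4 := undo_all n fam3 (ents W1 o0).
have p1 : positive fam1 by apply: undo_all_positive.
have p2 : positive fam2 by apply: undo_all_positive.
have p4 : positive fam4 by do 2!apply: undo_all_positive.
have a1 : amount fam1 = tau by rewrite undo_all_amount.
have a3 : amount fam3 = tau by rewrite !undo_all_amount.
have m1 : marked fam1 = 0.
  by rewrite /marked /wsum big_map /= big1 // => u _; rewrite muln0.
have m3 : marked fam3 = 0.
  by rewrite /marked /wsum big_map /= big1 // => u _; rewrite muln0.
have J2 : each (fun J _ => within S J /\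
    forall U, dicutin S U -> U != [set v] -> hits J U) fam2.
  have hc U : dicutin S (~: U) /\ ~: U != [set v] /\ ~: U != S :\ v ->
      closedin S Rop U.
    case=> [[_ _ _ cU] _] x y xS yS xy yU; apply/negPn/negP => xU.
    by have := cU y x yS xS xy; rewrite !inE xU yU => /(_ isT).
  have hm : each (fun J b => [/\ ~~ b, within S J & forall U, dicutin S (~: U) /\
      ~: U != [set v] /\ ~: U != S :\ v -> hits J U]) fam1.
    apply: each_clear; apply: each_sub hJ => J _ [hw hh]; split=> //.
      exact: within_del.
    move=> U [hU [n1 n2]]; have [e eJ] := hh _ (dicutin_del hU n1 n2).
    by rewrite splits_del ?splitsC; [exists e | apply: hw].
  have h := @sidelist_undo _ S v bs1 W2 n fam1 _ Rop_refl vS hc bs1P hm; rewrite -/o1 -/fam2 in h.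
  have mk U : dicutin S U -> U = S :\ v -> each (fun _ b => b) fam2.
    move=> hU eU; have [b00 t0] := sink_sides hU eU; apply: marked_each => //.
    have /= := @side_marked v (head v bs1) bs1 W2 n fam1.
    rewrite -/o1 -/fam2 m1 a1 undo_all_amount a1 s1 add0n => hh.
    have := htau U hU (or_intror eU).
    rewrite t0 /o0 b00 /= csumN csum_cat csumN csum_nil addn0 => le.
    apply: leq_trans (hh _ _).
    - by rewrite leq_min leqnn.
    - by apply: leq_trans hn; rewrite -/o1; lia.
    - by move=> g e f /sideops_okop[].
  move=> i hi; have [h1 h2 h3] := h i hi; split=> // U hU nU.
  case: (U =P S :\ v) => [eU|/eqP nU']; last first.
    have [|e eJ] := h2 (~: U); first by rewrite setCK.
    by rewrite splitsC; exists e.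
  have [x [e [xs ex eJ]]] := h3 (mk U hU eU i hi).
  exists e => //; rewrite (joins_splits _ (ar_joins ex)) eU !in_setD1 eqxx /=.
  by have [[-> -> _ _] _] := sidelist_mem Rop_refl bs1P xs.
have J4 : each (fun J _ => within S J /\ forall U, dicutin S U -> hits J U) fam4.
  have hc U : dicutin S U /\ U != [set v] -> closedin S R U by case=> [[]].
  have hm : each (fun J b => [/\ ~~ b, within S J & forall U, dicutin S U /\
      U != [set v] -> hits J U]) fam3.
    apply: each_clear; apply: each_sub J2 => J _ [hw hh]; split=> //.
    by move=> U [hU n1]; apply: hh.
  have h := @sidelist_undo _ S v bs0 W1 n fam3 _ R_refl vS hc bs0P hm; rewrite -/o0 -/fam4 in h.
  have mk U : dicutin S U -> U = [set v] -> each (fun _ b => b) fam4.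
    move=> hU eU; have [b10 t0] := source_sides hU eU; apply: marked_each => //.
    have /= := @side_marked v (head v bs0) bs0 W1 n fam3.
    rewrite -/o0 -/fam4 m3 a3 undo_all_amount a3 s3 add0n => hh.
    have := htau U hU (or_introl eU).
    rewrite /o1 b10 t0 /= csum_cat !csumN csum_nil addn0 => le.
    apply: leq_trans (hh _ _).
    - by rewrite leq_min leqnn.
    - by apply: leq_trans hn; lia.
    - by move=> g e f /sideops_okop[].
  move=> i hi; have [h1 h2 h3] := h i hi; split=> // U hU.
  case: (U =P [set v]) => [eU|/eqP nU]; last by apply: h2.
  have [x [e [xs ex eJ]]] := h3 (mk U hU eU i hi).
  exists e => //; rewrite (joins_splits _ (ar_joins ex)) eU !inE eqxx /=.
  by have [[_ /negbTE -> _ _] _] := sidelist_mem R_refl bs0P xs.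
apply: isolate_undo J4 => g e f ht J [hw hh].
have [_ _ _ [eS fS [a [b [_ _ [ea ef eg]]]]]] := ts_mem ht.
split=> [|U hU]; first exact: exchange_within.
apply: exchange_hits (hh U hU) _; rewrite (joins_splits _ (ar_joins ea)).
rewrite (joins_splits _ (ar_joins ef)) (joins_splits _ (ar_joins eg)).
by case: (a \in U); case: (b \in U); case: (v \in U).
Qed.

Lemma closed_pred x : x \in S :\ v -> R x v ->
  exists a, [/\ a \in bs1, R x a & R a v].
Proof.
rewrite in_setD1 => /andP[nxv xS] xv.
have /connectP[p] := S_generated xS vS xv; case/lastP: p => [_ e|p z].
  by rewrite e eqxx in nxv.
rewrite rcons_path last_rcons => /andP[hp /and4P[aS zS az Raz]] ez.
rewrite -{z}ez in zS az Raz; exists (last x p); split=> //.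
- have [_ _ ->] := bs1P; rewrite in_setD1 aS -adjE adj_sym az /Rop Raz !andbT.
  by apply: contraTneq az => ->; rewrite adj_irr.
apply: (connect_trans (y := last x p)); last exact: connect0.
elim: p x {xS nxv xv aS az Raz} hp => [|y p IH] x /=; first by rewrite connect0.
by case/andP=> /and4P[_ _ _ xy] /IH; apply: connect_trans.
Qed.

Lemma closed_succ x : x \in S :\ v -> R v x ->
  exists b, [/\ b \in bs0, R b x & R v b].
Proof.
rewrite in_setD1 => /andP[nxv xS] vx.
have /connectP[[|z p] /=] := S_generated vS xS vx.
  by move=> _ e; rewrite e eqxx in nxv.
case/andP=> /and4P[_ zS vz Rvz] hp e; exists z; split=> //.
- have [_ _ ->] := bs0P; rewrite in_setD1 zS -adjE vz Rvz !andbT.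
  by apply: contraTneq vz => ->; rewrite adj_irr.
rewrite e; elim: p z {zS vz Rvz e} hp => [|y p IH] z /=; first by rewrite connect0.
by case/andP=> /and4P[_ _ _ zy] /IH; apply: connect_trans.
Qed.

Lemma generated_del : generated (S :\ v).
Proof.
move=> x y; rewrite !in_setD1 => /andP[nxv xS] /andP[nyv yS] xy.
set e' := (fun p q => _).
have /connectP[p hp ey] := S_generated xS yS xy.
suff : (last x p != v -> connect e' x (last x p)) /\
   (last x p = v -> exists q, [/\ q \in S :\ v, connect e' x q, adj q v & R q v]).
  by rewrite -ey => -[h _]; apply: h.
elim/last_ind: p hp {ey} => [_|p z IH].
  by split=> [_|e]; [apply: connect0 | rewrite /= in e; rewrite e eqxx in nxv].
rewrite rcons_path last_rcons => /andP[/IH[h1 h2] /and4P[lS zS lz Rlz]].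
case: (last x p =P v) => [lv|/eqP lv].
  have [q [qS cq qv Rqv]] := h2 lv; rewrite lv in lz Rlz.
  split=> [zv|ez]; last by rewrite ez adj_irr in lz.
  have zS' : z \in S :\ v by rewrite in_setD1 zv.
  case: (q =P z) => [<- //|/eqP nqz].
  apply: connect_trans cq (connect1 _); rewrite /e' qS zS' /=.
  rewrite (connect_trans Rqv Rlz) andbT.
  apply: v_simplicial; rewrite // ?(adj_sym v) //.
  by move: qS; rewrite in_setD1 => /andP[].
split=> [zv|ez].
  apply: connect_trans (h1 lv) (connect1 _).
  by rewrite /e' !in_setD1 lv zv lS zS lz Rlz.
by exists (last x p); rewrite in_setD1 lv lS h1 // -ez.
Qed.

Let W1 W := wfin W (isolate ts).
Let W2 W := wfin (W1 W) (sideops v (head v bs0) bs0).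
Let W3 W := wfin (W2 W) (sideops v (head v bs1) bs1).

Lemma wfin_step W : wfin W (step_ops v ts bs0 bs1) = W3 W.
Proof. by rewrite /step_ops !wfin_cat /= wfin_cat. Qed.

Lemma head0 b : b \in bs0 -> head v bs0 != v.
Proof. by move=> /(head_mem v) /(sidelist_mem R_refl bs0P)[[]]. Qed.

Lemma head1 b : b \in bs1 -> head v bs1 != v.
Proof. by move=> /(head_mem v) /(sidelist_mem Rop_refl bs1P)[[]]. Qed.

Lemma neighbour_sides b : b \in S :\ v -> ar v b -> (b \in bs0) || (b \in bs1).
Proof.
move=> bS vb; have [_ _ ->] := bs0P; have [_ _ ->] := bs1P.
by rewrite bS vb /=; have := adj_R; move=> /(_ v b); rewrite adjE vb => /(_ isT)[->|]//;
  rewrite /Rop => ->; rewrite orbT.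
Qed.

Lemma step_le W x : x \in [pred e | ~~ inside (S :\ v) e
   || (ar (arc_tail D e) (arc_head D e) != Some e)] ->
  (wfin W (step_ops v ts bs0 bs1) x <= W x)%N.
Proof.
have notX b c g : b \in S :\ v -> c \in S :\ v -> ar b c = Some g ->
    g \notin [pred e | ~~ inside (S :\ v) e
   || (ar (arc_tail D e) (arc_head D e) != Some e)].
  move=> bS cS E; rewrite inE negb_or !negbK (joins_inside _ (ar_joins E)) bS cS /=.
  by have /orP[] := ar_joins E => /andP[/eqP -> /eqP ->]; rewrite ?E ?eqxx // ar_sym E.
have side Q bs g e f : reflexive Q -> sidelist Q S v bs ->
    Some (g, e, f) \in sideops v (head v bs) bs ->
    g \notin [pred e | ~~ inside (S :\ v) e
   || (ar (arc_tail D e) (arc_head D e) != Some e)] \/ g = e.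
  move=> hQ hbs /sideops_okop[_ _ [b bb [_ [->|E]]]]; [by right|left].
  have [[h1 h2 _ _] _] := sidelist_mem hQ hbs bb.
  have [[h3 h4 _ _] _] := sidelist_mem hQ hbs (head_mem v bb).
  by apply: notX E; rewrite in_setD1 ?h1 ?h2 ?h3 ?h4.
move=> Xx; apply: (@wfin_le _ (mem [pred e | ~~ inside (S :\ v) e
   || (ar (arc_tail D e) (arc_head D e) != Some e)])) => // g e f.
rewrite /step_ops !(mem_cat, inE) /= orbF => /or3P[|h|h]; last 2 first.
- exact: (side _ _ g e f R_refl bs0P h).
- exact: (side _ _ g e f Rop_refl bs1P h).
case/flattenP=> _ /mapP[[[g' e'] f'] /tsP[a [b [aS bS _ _ [_ _ E]]]] ->].
by rewrite !inE orbF => /eqP[-> _ _]; left; apply: notX E.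
Qed.

Lemma star_zero W b e : b \in S :\ v -> ar v b = Some e ->
  wfin W (step_ops v ts bs0 bs1) e = 0.
Proof.
move=> bS E; have vb : ar v b by rewrite E.
rewrite wfin_step /W3; have [h1|h1] := boolP (b \in bs1).
  exact: sideops_zero (head1 h1) h1 E.
have h0 : b \in bs0 by have := neighbour_sides bS vb; rewrite (negbTE h1) orbF.
apply/eqP; rewrite -leqn0 -(sideops_zero (W1 W) (head0 h0) h0 E).
apply: (@wfin_le _ (pred1 e)) => [g e1 f|]; last exact: eqxx.
case/sideops_okop=> _ _ [c cb [Ec [->|Eg]]]; [by right|left].
by apply: (ar_ne E Eg); [rewrite eq_sym (head1 cb)|exact: ar_neq Ec].
Qed.

Lemma zero_step W : zero S W -> zero (S :\ v) (wfin W (step_ops v ts bs0 bs1)).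
Proof.
move=> hz e nl; rewrite negb_and => he.
case: (boolP (inside S e && (ar (arc_tail D e) (arc_head D e) == Some e))) => [|hn].
  case/andP=> eS /eqP E; move: he; rewrite E eqxx orbF.
  move: eS; rewrite /inside !in_setD1 => /andP[tS hS]; rewrite tS hS !andbT negb_and.
  rewrite !negbK => /orP[]/eqP ev; rewrite ev in E nl tS hS.
    by apply: star_zero E; rewrite in_setD1 eq_sym nl hS.
  by rewrite ar_sym in E; apply: star_zero E; rewrite in_setD1 nl tS.
by apply/eqP; rewrite -leqn0 -(hz e nl hn); apply: step_le; rewrite inE.
Qed.

(* The extension is [v |: U'] if [U'] contains an out-neighbour of [v], and [U']
   if it misses an in-neighbour.  Otherwise both are dicuts, and the exchanges
   over paths through [v] have exhausted all in-arcs or all out-arcs of [v]. *)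
Lemma lift_dicut W U' : zero S W -> dicutin (S :\ v) U' ->
  exists2 U, dicutin S U & (wt W U <= wt (wfin W (step_ops v ts bs0 bs1)) U')%N.
Proof.
move=> hz [US U0 nUS cU].
have vU : v \notin U' by apply/negP => /(subsetP US); rewrite in_setD1 eqxx.
pose X := [pred e | [exists b in S :\ v, ar v b == Some e]].
have W1z : (forall a e, a \in bs1 -> ar v a = Some e -> W1 W e = 0) \/
   (forall b e, b \in bs0 -> b \notin bs1 -> ar v b = Some e -> W1 W e = 0).
  case: (pickP (fun a => [exists e, [&& a \in bs1, ar v a == Some e & W1 W e != 0]])).
    move=> a /existsP[e /and3P[aB /eqP ea nz]]; right=> b f bB nb ef.
    have [[aS av _ Rav] _] := sidelist_mem Rop_refl bs1P aB.
    have [[bS bv _ Rvb] _] := sidelist_mem R_refl bs0P bB.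
    have nab : a != b by apply: contraNneq nb => <-.
    have [|g eg] := @ar_some a b.
      by apply: v_simplicial; rewrite // adjE ?ea ?ef.
    have ht : (g, e, f) \in ts.
      by apply/tsP; exists a, b; rewrite !in_setD1 aS av bS bv; split.
    have [g' e' f' h'||//] := @isolate_zero X ts W _ g e f ht.
      have [a' [b' [a'S b'S _ _ [ea' ef' eg']]]] := (tsP g' e' f').1 h'.
      split; first by apply/existsP; exists a'; rewrite a'S ea' eqxx.
        by apply/existsP; exists b'; rewrite b'S ef' eqxx.
      apply/existsP => -[c /andP[cS /eqP Ec]]; have /eqP := erefl g'.
      apply/negP; apply: (ar_ne Ec eg').
        by move: a'S; rewrite in_setD1 eq_sym => /andP[].
      by move: b'S; rewrite in_setD1 eq_sym => /andP[].
    by rewrite -/(W1 W) => W0; rewrite W0 in nz.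
  move=> h; left=> a e aB ea; apply/eqP; apply: contraFT (h a) => nz.
  by apply/existsP; exists e; rewrite aB ea eqxx.
have [_ _ m0] := bs0P; have [_ _ m1] := bs1P.
have in0 b : b \in bs0 -> b \in S :\ v by rewrite m0 => /andP[].
have in1 b : b \in bs1 -> b \in S :\ v by rewrite m1 => /andP[].
have fin U : U = U' \/ U = v |: U' ->
    (v \in U -> forall a, a \in bs1 -> a \in U') ->
    (v \notin U -> forall b, b \in bs0 -> b \notin U') ->
    (v \in U -> (exists2 b, b \in bs0 & b \in U') \/
       forall b e, b \in bs0 -> ar v b = Some e -> W1 W e = 0) ->
    (v \notin U -> (exists2 a, a \in bs1 & a \notin U') \/
       forall a e, a \in bs1 -> ar v a = Some e -> W1 W e = 0) ->
    exists2 U, dicutin S U & (wt W U <= wt (wfin W (step_ops v ts bs0 bs1)) U')%N.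
  move=> hU v1 v0 z1 z0.
  have UE x : x != v -> (x \in U) = (x \in U').
    by case: hU => -> //; rewrite in_setU1 => /negbTE ->.
  have UE' x : x \in S :\ v -> (x \in U) = (x \in U').
    by rewrite in_setD1 => /andP[/UE].
  have dU : dicutin S U.
    have sub : U' \subset S by apply: subset_trans US (subsetDl _ _).
    split.
    - case: hU => -> //; rewrite subUset sub andbT sub1set //.
    - apply: contraNneq U0 => h; rewrite -subset0; apply/subsetP => x xU.
      suff : x \in U by rewrite h.
      by case: hU => ->; rewrite ?in_setU1 xU ?orbT.
    - apply: contraNneq nUS => h; rewrite eqEsubset US; apply/subsetP => x xS.
      by rewrite -(UE' x xS) h; move: xS; rewrite in_setD1 => /andP[].
    move=> x y xS yS xy yU; case: (y =P v) => [yv|/eqP yv].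
      case: (x =P v) => [->|/eqP xv]; first by rewrite -yv.
      rewrite yv in yU xy; rewrite UE //.
      have xS' : x \in S :\ v by rewrite in_setD1 xv.
      have [a [aB xa _]] := closed_pred xS' xy.
      by apply: (cU x a) => //; [apply: in1 | apply: v1].
    have yS' : y \in S :\ v by rewrite in_setD1 yv.
    rewrite UE // in yU; case: (x =P v) => [xv|/eqP xv]; last first.
      by rewrite UE //; apply: (cU x y); rewrite // in_setD1 xv.
    rewrite xv in xy *; apply/negPn/negP => nvU.
    have [b [bB yb _]] := closed_succ yS' xy.
    exact: (negP (v0 nvU b bB) (cU b y (in0 b bB) yS' yb yU)).
  exists U => //; have [_ _ _ clU] := dU.
  rewrite wfin_step; apply: (@leq_trans (wt (W3 W) U)); last first.
    apply: leq_sum => e _; have hz3 := zero_step hz; rewrite wfin_step in hz3.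
    case: (boolP (arc_tail D e == arc_head D e)) => [/eqP te|nl].
      by rewrite /splits te eqxx muln0.
    case: (boolP (inside (S :\ v) e)) => he; last by rewrite hz3 ?(negbTE he).
    by move: he; rewrite /inside /splits => /andP[h1 h2]; rewrite !UE'.
  rewrite -(_ : wt (W1 W) U = wt W U); last first.
    apply: wt_isolate => g e f ht; have [n1 n2 n3 _] := ts_mem ht.
    rewrite /okop n1 n2 orbT n3 !mul1n; split=> //.
    have [a [b [aS bS Rav Rvb [ea ef eg]]]] := (tsP g e f).1 ht.
    rewrite !(joins_splits _ (ar_joins ea), joins_splits _ (ar_joins ef),
      joins_splits _ (ar_joins eg)).
    have [aS' bS'] : a \in S /\ b \in S.
      by move: aS bS; rewrite !in_setD1 => /andP[_ ->] /andP[_ ->].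
    have := clU a v aS' vS Rav; have := clU v b vS bS' Rvb.
    by case: (a \in U); case: (b \in U); case: (v \in U) => // h1 h2;
      first [by have := h1 isT | by have := h2 isT].
  have side Q bs b (nb : b != head v bs) : reflexive Q -> sidelist Q S v bs ->
      b \in bs -> exists g, ar (head v bs) b = Some g.
    move=> hQ hbs bb; have [[h1 h2 h3 _] _] := sidelist_mem hQ hbs bb.
    have [[h5 h6 h7 _] _] := sidelist_mem hQ hbs (head_mem v bb).
    by apply: ar_some; apply: v_simplicial; rewrite // ?adjE // eq_sym.
  apply: (@leq_trans (wt (W2 W) U)).
    case E: bs0 => [|c l]; first by rewrite /W2 E.
    apply: wt_sideops; first by apply: (head0 (b := c)); rewrite E mem_head.
    move=> b e bB eb; rewrite (joins_splits _ (ar_joins eb)) => sp.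
    have vinU : v \in U.
      apply/negPn/negP => nvU; move: sp; rewrite (negbTE nvU) UE' ?in0 //.
      by rewrite (negbTE (v0 nvU b bB)).
    have bU : b \notin U by move: sp; rewrite vinU; case: (b \in U).
    case: (z1 vinU) => [[b' b'B b'U]|hW]; [right|by left; apply: hW eb].
    have hd := head_mem v bB.
    have hU' : head v bs0 \in U.
      rewrite UE' ?in0 //; apply: (cU _ b') => //; try exact: in0.
      by have [_] := sidelist_mem R_refl bs0P b'B.
    have [|g eg] := side _ _ b _ R_refl bs0P bB.
      by apply: contraNneq bU => ->.
    by exists g; rewrite // (joins_splits _ (ar_joins eg)) hU' (negbTE bU).
  case E: bs1 => [|c l]; first by rewrite /W3 E.
  apply: wt_sideops; first by apply: (head1 (b := c)); rewrite E mem_head.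
  move=> b e bB eb; rewrite (joins_splits _ (ar_joins eb)) => sp.
  have vinU : v \notin U.
    apply/negP => vinU; move: sp; rewrite vinU UE' ?in1 //.
    by rewrite (v1 vinU b bB).
  have bU : b \in U by move: sp; rewrite (negbTE vinU); case: (b \in U).
  case: (z0 vinU) => [[b' b'B b'U]|hW]; [right|left].
    have hd := head_mem v bB.
    have hU' : head v bs1 \notin U.
      rewrite UE' ?in1 //; apply: contra b'U => hh; apply: (cU _ (head v bs1)) => //;
        try exact: in1.
      by have [_] := sidelist_mem Rop_refl bs1P b'B.
    have [|g eg] := side _ _ b _ Rop_refl bs1P bB.
      by apply: contraNneq hU' => <-.
    by exists g; rewrite // (joins_splits _ (ar_joins eg)) bU (negbTE hU').
  apply/eqP; rewrite -leqn0 -(hW b e bB eb).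
  apply: (@wfin_le _ (pred1 e)) => [g e1 f|]; last exact: eqxx.
  case/sideops_okop=> _ _ [d dB [Ed [->|Eg]]]; [by right|left].
  by apply: (ar_ne eb Eg); [rewrite eq_sym (head0 dB)|exact: ar_neq Ed].
case: (pickP (fun b => (b \in bs0) && (b \in U'))) => [b /andP[bB bU]|nb].
  apply: (fin (v |: U')); first by right.
  - move=> _ a aB.
    have [[_ _ _ h1] _] := sidelist_mem Rop_refl bs1P aB.
    have [[_ _ _ h2] _] := sidelist_mem R_refl bs0P bB.
    exact: (cU a b (in1 a aB) (in0 b bB) (connect_trans h1 h2) bU).
  - by rewrite setU11.
  - by left; exists b.
  - by rewrite setU11.
have nb' b : b \in bs0 -> b \notin U' by move=> bB; have := nb b; rewrite bB /= => ->.
case: (pickP (fun a => (a \in bs1) && (a \notin U'))) => [a /andP[aB aU]|na].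
  apply: (fin U'); first by left.
  - by rewrite (negbTE vU).
  - by [].
  - by rewrite (negbTE vU).
  - by left; exists a.
have na' a : a \in bs1 -> a \in U'.
  by move=> aB; have := na a; rewrite aB /= => /negbFE.
case: W1z => hW.
  by apply: (fin U'); rewrite ?(negbTE vU) //; [left | move=> _; right].
apply: (fin (v |: U')); rewrite ?setU11 //; first by right.
move=> _; right=> b e bB; apply: hW => //.
by apply: contra (nb' b bB); apply: na'.
Qed.

Definition step_tau tau W :=
  if ((bs0 == [::]) || (bs1 == [::])) && (S :\ v != set0)
  then minn tau (csum (ents W (step_ops v ts bs0 bs1))) else tau.

Lemma dicutin_source : bs1 = [::] -> S :\ v != set0 -> dicutin S [set v].
Proof.
move=> b10 nS; split.
- by rewrite sub1set.
- by apply/set0Pn; exists v; rewrite set11.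
- by apply: contraNneq nS => <-; rewrite setDv.
move=> x y xS _ xy; rewrite !inE => /eqP yv; rewrite yv in xy.
apply/negPn/negP => xv; have xS' : x \in S :\ v by rewrite in_setD1 xv.
by have [a []] := closed_pred xS' xy; rewrite b10.
Qed.

Lemma dicutin_sink : bs0 = [::] -> S :\ v != set0 -> dicutin S (S :\ v).
Proof.
move=> b00 nS; split=> //; first exact: subsetDl.
- by apply/eqP => h; move: vS; rewrite -h in_setD1 eqxx.
move=> x y xS _ xy yS'; rewrite in_setD1 xS andbT.
apply/eqP => xv; rewrite xv in xy.
by have [b []] := closed_succ yS' xy; rewrite b00.
Qed.

Lemma dicut_step_tau W : zero S W -> S :\ v != set0 ->
  (bs0 == [::]) || (bs1 == [::]) -> exists2 U, dicutin S U &
  (wt W U <= csum (ents W (step_ops v ts bs0 bs1)))%N.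
Proof.
move=> hz nS hb.
have [U dU hU] : exists2 U, dicutin S U & U = [set v] \/ U = S :\ v.
  case/orP: hb => /eqP h; [exists (S :\ v)|exists [set v]]; try by [left|right].
    exact: dicutin_sink.
  exact: dicutin_source.
exists U => //.
have t0 : ts = [::] by case: hU => e; [case: (source_sides dU e)|case: (sink_sides dU e)].
apply: leq_trans (wt_csum (ops := step_ops v ts bs0 bs1) W U _) _.
  move=> g e f ht; split; first exact: step_okop.
  move: ht; rewrite /step_ops t0 !(mem_cat, inE) /= orbF.
  by case/orP=> /sideops_okop[].
rewrite [wt _ _]big1 // => e _.
case: (boolP (splits U e)) => [se|_]; last by rewrite muln0.
rewrite (zero_step hz) //.
  by apply: contraTneq se => te; rewrite /splits te eqxx.
rewrite negb_and; apply/orP; left; move: se.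
rewrite /inside /splits; case: hU => ->; rewrite !inE;
  case: (arc_tail D e == v); case: (arc_head D e == v) => //=;
  by case: (_ \in S); case: (_ \in S).
Qed.

End Step.

Definition forward_inv (w : A -> nat) (S : {set V}) (W : A -> nat) log tau : Prop :=
  [/\ zero S W, generated S,
      forall U', dicutin S U' -> exists2 U, dicutin setT U & (wt w U <= wt W U')%N,
      exists2 U, dicutin setT U & (wt w U <= tau)%N
    & forall tau0 n fam, (tau0 <= tau)%N -> (size fam + size log <= n)%N ->
        valid tau0 S W fam -> valid tau0 setT w (undo_all n fam log)].

Lemma forward_step w (S : {set V}) W log tau v ts bs0 bs1 :
  v \in S -> simplicial adj S v ->
  (forall g e f, (g, e, f) \in ts <->
    exists a b, [/\ a \in S :\ v, b \in S :\ v, R a v, R v b &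
     [/\ ar v a = Some e, ar v b = Some f & ar a b = Some g]]) ->
  sidelist R S v bs0 -> sidelist Rop S v bs1 ->
  forward_inv w S W log tau ->
  forward_inv w (S :\ v) (wfin W (step_ops v ts bs0 bs1))
    (log ++ ents W (step_ops v ts bs0 bs1)) (step_tau S v ts bs0 bs1 tau W).
Proof.
move=> vS hs hts h0 h1 [hz hg hl ht hb]; split.
- exact: zero_step.
- exact: generated_del.
- move=> U' /(lift_dicut vS hs hts h0 h1 hg hz)[U /hl[U0 d0 le0] le].
  by exists U0 => //; apply: leq_trans le0 le.
- rewrite /step_tau; case: ifP => // /andP[hd nS].
  case: leqP => _ //.
  have [U /hl[U0 d0 le0] le] := dicut_step_tau vS hts h0 h1 hg hz nS hd.
  by exists U0 => //; apply: leq_trans le0 le.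
move=> tau0 n fam ht0; rewrite size_cat size_ents => hn hv.
rewrite undo_all_cat; apply: hb.
- apply: leq_trans ht0 _; rewrite /step_tau; case: ifP => // _; exact: geq_minl.
- have := undo_all_size n (ents W (step_ops v ts bs0 bs1)) fam.
  by rewrite size_ents; lia.
apply: valid_step => //; last by lia.
move=> U dU hU; apply: leq_trans ht0 _; rewrite /step_tau.
suff -> : ((bs0 == [::]) || (bs1 == [::])) && (S :\ v != set0) by apply: geq_minr.
have [_ U0 nU _] := dU; case: hU => eU.
  have [-> _] := source_sides vS hts h0 h1 dU eU.
  rewrite eqxx orbT /=; apply: contraNneq nU => hS.
  by rewrite eU -(setD1K vS) hS setU0.
have [-> _] := sink_sides vS hts h0 h1 dU eU.
by rewrite eqxx /= -eU.
Qed.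

Lemma forward_init (w : A -> nat) (mts : seq (A * A * A)) U0 :
  (forall g e f, (g, e, f) \in mts <->
     [/\ f = e, g != e & ar (arc_tail D e) (arc_head D e) = Some g]) ->
  dicutin setT U0 ->
  forward_inv w setT (wfin w (isolate mts)) (ents w (isolate mts)) (\sum_e w e)%N.
Proof.
move=> hm dU0.
have split_eq U g e f : (g, e, f) \in mts -> splits U g = splits U e.
  by case/hm=> _ _ /ar_joins/joins_splits ->.
have okop_m g e f : (g, e, f) \in mts -> okop g e f.
  by case/hm=> -> ne _; rewrite /okop ne orbT.
split.
- move=> e nl; rewrite /inside !inE /= => nrep.
  have [g eg] : exists g, ar (arc_tail D e) (arc_head D e) = Some g.
    apply: ar_some; rewrite /underlying nl /=; apply/existsP; exists e.
    by rewrite !eqxx.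
  have nge : g != e by apply: contraNneq nrep => ge; rewrite eg ge eqxx.
  have ht : (g, e, e) \in mts by apply/hm.
  have hX g' e' f' : (g', e', f') \in mts -> let X := [pred x |
      ar (arc_tail D x) (arc_head D x) != Some x] in [/\ X e', X f' & ~~ X g'].
    case/hm=> -> ne' eg'; rewrite /= eg' -[Some g' == _]/(g' == e') ne'.
    split=> //; rewrite negbK.
    by have /orP[] := ar_joins eg' => /andP[/eqP -> /eqP ->]; rewrite ?eg' // ar_sym eg'.
  by case: (isolate_zero w hX ht).
- move=> x y _ _ /connectP[p hp ->]; elim: p x hp => [|z p IH] x /=.
    by rewrite connect0.
  case/andP=> xz /IH; case: (x =P z) => [-> //|/eqP nxz].
  apply: connect_trans; apply: connect1; rewrite /= !inE connect1 // andbT /=.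
  have /existsP[e he] := xz.
  by rewrite /underlying nxz; apply/existsP; exists e; rewrite he.
- move=> U dU; exists U => //; rewrite wt_isolate // => g e f ht.
  split; first exact: okop_m.
  have /hm[-> ne _] := ht; rewrite (split_eq U _ _ _ ht) ne eqxx.
  by rewrite mul0n addn0 mul1n.
- exists U0 => //; apply: leq_sum => e _.
  by case: (splits _ _); rewrite ?muln1 ?muln0.
move=> tau0 n fam _; rewrite size_ents => hn [hp hu ha hJ]; split.
- exact: undo_all_positive.
- apply: undo_all_usage => // g e f /flattenP[_ /mapP[[[g' e'] f'] ht ->]].
  by rewrite !inE orbF => /eqP[-> -> ->]; apply: okop_m.
- by rewrite undo_all_amount.
apply: isolate_undo hJ => g e f ht J [hw hh]; split=> [x _|U dU].
  by rewrite /inside !inE.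
by apply: exchange_hits (hh U dU) _; rewrite (split_eq U _ _ _ ht) => ->.
Qed.

End Elimination.

(** * From pieces to a packing of distinct dijoins *)

Section Merge.
Variable A : finType.
Definition mult : Type := {set A} * nat.
Implicit Types (l : seq mult) (x : mult).
Definition no_mult : mult := (set0, 0).

Definition insert l x : seq mult :=
  let i := find (fun y : mult => y.1 == x.1) l in
  if i < size l then set_nth no_mult l i (x.1, (nth no_mult l i).2 + x.2)
  else rcons l x.

Definition merge_pieces (fam : seq (piece A)) : seq mult :=
  foldl (fun l (u : piece A) => insert l (u.1.1, u.2)) [::] fam.

Lemma insert_spec l x (phi : {set A} -> nat) : uniq (map fst l) ->
  [/\ uniq (map fst (insert l x)),
      \sum_(y <- insert l x) y.2 * phi y.1 =
        \sum_(y <- l) y.2 * phi y.1 + x.2 * phi x.1,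
      size (insert l x) <= (size l).+1
    & {subset map fst (insert l x) <= x.1 :: map fst l}].
Proof.
move=> ul; rewrite /insert -has_find.
case: ifPn => [hx|nx]; last first.
  rewrite map_rcons rcons_uniq ul andbT size_rcons; split=> //.
  - apply: contra nx => /mapP[y yl e]; apply/hasP; exists y => //.
    by rewrite /= e.
  - by rewrite -cats1 big_cat big_seq1.
  - by move=> y; rewrite mem_rcons.
have hi : find (fun y : mult => y.1 == x.1) l < size l by rewrite -has_find.
have hn := nth_find no_mult hx; rewrite /= in hn.
set i := find _ _ in hi hn *.
have em : map fst (set_nth no_mult l i (x.1, (nth no_mult l i).2 + x.2)) = map fst l.
  apply: (@eq_from_nth _ set0); rewrite !size_map size_set_nth (maxn_idPr hi) //.
  move=> j hj; rewrite !(nth_map no_mult) ?size_set_nth ?(maxn_idPr hi) //.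
  by rewrite nth_set_nth /=; case: eqP => // ->; rewrite (eqP hn).
rewrite em ul size_set_nth (maxn_idPr hi); split=> //; last by move=> y; rewrite inE orbC => ->.
elim: l {ul hx em} i hi hn => [|a l IH] [|i] //= hi hn; rewrite !big_cons /=.
  by rewrite (eqP hn) mulnDl addnAC.
by rewrite IH // addnA.
Qed.

Lemma merge_pieces_spec (fam : seq (piece A)) (phi : {set A} -> nat) :
  [/\ uniq (map fst (merge_pieces fam)),
      \sum_(y <- merge_pieces fam) y.2 * phi y.1 = wsum (fun J _ => phi J) fam,
      size (merge_pieces fam) <= size fam
    & {subset map fst (merge_pieces fam) <= map (fun u => u.1.1) fam}].
Proof.
rewrite /merge_pieces; elim/last_ind: fam => [|fam u [IH1 IH2 IH3 IH4]].
  by rewrite /= /wsum !big_nil.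
rewrite foldl_rcons; have [h1 h2 h3 h4] := insert_spec (u.1.1, u.2) phi IH1.
split=> //.
- by rewrite h2 IH2 wsum_rcons.
- by rewrite size_rcons; apply: leq_trans h3 _.
move=> y /h4; rewrite map_rcons mem_rcons !inE => /orP[->//|/IH4 ->].
by rewrite orbT.
Qed.

End Merge.

Section Packing.
Variables (V A : finType) (D : digraph V A).

Lemma arcs_in0 (U : {set V}) :
  arcs_in D U = set0 <-> closedin [set: V] (connect (arc_rel D)) U.
Proof.
split=> [h x y _ _ /connectP[p hp ->]|h].
  elim: p x hp => [|z p IH] x //= /andP[/existsP[e /andP[/eqP te /eqP he]] hp].
  move/(IH _ hp) => zU; apply/negPn/negP => xU.
  by have : e \in arcs_in D U by [rewrite inE te he xU zU]; rewrite h inE.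
apply/setP => e; rewrite !inE; apply/negbTE; rewrite negb_and negbK.
case: (boolP (arc_head D e \in U)) => [hU|_]; last by rewrite orbT.
rewrite (h _ (arc_head D e)) ?inE // connect1 //.
by apply/existsP; exists e; rewrite !eqxx.
Qed.

Lemma dicutsP (C : {set A}) : reflect
  (exists2 U, dicutin D [set: V] U & C = arcs_out D U) (C \in dicuts D).
Proof.
apply: (iffP imsetP) => -[U hU ->]; exists U => //.
  move: hU; rewrite inE => /and3P[h1 h2 /eqP/arcs_in0 h3]; split=> //.
by rewrite inE; case: hU => _ -> -> /arcs_in0 ->; rewrite eqxx.
Qed.

Lemma splits_arcs_out U e : dicutin D [set: V] U ->
  splits D U e = (e \in arcs_out D U).
Proof.
case=> _ _ _ /arcs_in0 h; have : e \notin arcs_in D U by rewrite h inE.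
by rewrite /splits !inE; do 2!case: (_ \in U).
Qed.

Lemma wt_weight w U : dicutin D [set: V] U -> wt D w U = weight w (arcs_out D U).
Proof.
move=> dU; rewrite /wt /weight [RHS]big_mkcond /=; apply: eq_bigr => e _.
by rewrite splits_arcs_out //; case: ifP => _; rewrite ?muln1 ?muln0.
Qed.

Lemma valid_dijoin tau W fam J : valid D tau [set: V] W fam ->
  J \in map (fun u : piece A => u.1.1) fam -> dijoin D J.
Proof.
case=> _ _ _ hJ /(nthP set0)[i]; rewrite size_map => hi.
rewrite (nth_map (no_piece A)) // => eJ.
have [_ hh] := hJ i hi; rewrite eJ in hh.
apply/forallP => C; apply/implyP => /dicutsP[U dU ->].
have [e eJ' eU] := hh U dU; apply/set0Pn; exists e.
by rewrite in_setI eJ' -splits_arcs_out.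
Qed.

Lemma min_weight_valid tau w fam :
  (exists2 U, dicutin D [set: V] U & wt D w U <= tau) ->
  (0 < tau -> valid D tau [set: V] w fam) -> min_dicut_weight D w tau.
Proof.
move=> [U dU leU] hv.
have lb C : C \in dicuts D -> tau <= weight w C.
  case: (posnP tau) => [->//|/hv[_ hus <- hJ]] /dicutsP[X dX ->].
  rewrite -wt_weight //.
  apply: (@leq_trans (\sum_e usage e fam * splits D X e)); last first.
    by apply: leq_sum => e _; rewrite leq_mul2r hus orbT.
  rewrite /usage /amount /wsum.
  under [leqRHS]eq_bigr do rewrite big_distrl.
  rewrite /= exchange_big /= !(big_nth (no_piece A)) !big_mkord.
  apply: leq_sum => i _; have [_ /(_ X dX)[e eJ eX]] := hJ i (ltn_ord i).
  by rewrite (bigD1 e) //= eJ eX !muln1 leq_addr.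
split=> //; exists (arcs_out D U); first by apply/dicutsP; exists U.
apply/eqP; rewrite eqn_leq lb ?andbT; last by apply/dicutsP; exists U.
by rewrite -wt_weight.
Qed.

Lemma packing_merge tau w fam : valid D tau [set: V] w fam ->
  let l := merge_pieces fam in
  compact_packing D w tau (fun i : 'I_(size l) => (nth (no_mult A) l i).1)
                          (fun i => (nth (no_mult A) l i).2).
Proof.
move=> hv l; have [_ hus ham _] := hv.
have sp := merge_pieces_spec fam; rewrite -/l in sp.
have [ul _ _ subl] := sp (fun=> 1).
split.
- move=> i j; rewrite -!(nth_map (no_mult A) set0 fst) // => e.
  by move/eqP: e; rewrite nth_uniq ?size_map // => /eqP/val_inj.
- move=> i; apply: (valid_dijoin hv); apply: subl.
  by rewrite -(nth_map (no_mult A) set0 fst) // mem_nth // size_map.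
- have [_ h _ _] := sp (fun=> 1); rewrite -ham /amount -h (big_nth (no_mult A)) big_mkord.
  by apply: eq_bigr => i _; rewrite muln1.
move=> e; apply: leq_trans (hus e); have [_ h _ _] := sp (fun J => e \in J).
rewrite /usage -h (big_nth (no_mult A)) big_mkord [leqLHS]big_mkcond /=.
by apply: leq_sum => i _; case: ifP; rewrite ?muln1.
Qed.

End Packing.

(** * The program *)

(* Array names: [a], [o] the input and the output of [Defs.v]; [t] tables, with
   rows of length |V| ([tN] and [tM] hold the multiples of |V| and |A|, as there
   is no multiplication); [v], [g] the log; [f] the family; [s] scalars; [l]
   loop variables.  Arrays 10 to 13 hold L, L^2, L^4 and L^8 for L = |V|+|A|+1,
   and [bP] = L^8 bounds the size of the log and of the family. *)
Notation aN := 0%N (only parsing).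
Notation aM := 1%N (only parsing).
Notation aT := 2%N (only parsing).
Notation aH := 3%N (only parsing).
Notation aW := 4%N (only parsing).
Notation oN := 5%N (only parsing).
Notation oL := 6%N (only parsing).
Notation oJ := 7%N (only parsing).
Notation bP := 13%N (only parsing).
Notation tN := 14%N (only parsing).
Notation tM := 15%N (only parsing).
Notation tR := 16%N (only parsing).
Notation tH0 := 18%N (only parsing).
Notation tH1 := 19%N (only parsing).
Notation tE := 20%N (only parsing).
Notation tD := 21%N (only parsing).
Notation vK := 22%N (only parsing).
Notation gG := 23%N (only parsing).
Notation gE := 24%N (only parsing).
Notation gF := 25%N (only parsing).
Notation gC := 26%N (only parsing).
Notation gCl := 27%N (only parsing).
Notation sG := 28%N (only parsing).
Notation sE := 29%N (only parsing).
Notation sF := 30%N (only parsing).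
Notation sC := 31%N (only parsing).
Notation sAcc := 32%N (only parsing).
Notation sTau := 33%N (only parsing).
Notation sV := 34%N (only parsing).
Notation sB0 := 35%N (only parsing).
Notation sB1 := 36%N (only parsing).
Notation sBad := 37%N (only parsing).
Notation lx := 40%N (only parsing).
Notation ly := 41%N (only parsing).
Notation lz := 42%N (only parsing).
Notation lh := 43%N (only parsing).
Notation lk := 44%N (only parsing).
Notation le := 45%N (only parsing).
Notation fN := 50%N (only parsing).
Notation fL := 51%N (only parsing).
Notation fJ := 52%N (only parsing).
Notation fF := 53%N (only parsing).
Notation sRem := 54%N (only parsing).
Notation sQ := 55%N (only parsing).
Notation sPos := 56%N (only parsing).
Notation sEq := 57%N (only parsing).

Notation "p ;; q" := (PSeq p q) (at level 60, right associativity).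
Notation set x e := (PWrite x (Const 0) e).
Notation When b p := (PIf b p PSkip).
Notation at2 t x y := (Plus (Read t x) y).
Notation zeroT e := (Eq e (Const 0)).
Notation posT e := (Leq (Const 1) e).

Lemma holds_Eq s e1 e2 : holds s (Eq e1 e2) = (eval s e1 == eval s e2).
Proof. by rewrite /= -eq_le. Qed.

Lemma holds_Lt s e1 e2 : holds s (Lt e1 e2) = (eval s e1 < eval s e2)%R.
Proof. by rewrite /= ltNge. Qed.

Section Loops.
Variable B : nat -> nat.

Lemma run_for x a p (I : nat -> memory -> Prop) s :
  (forall k s z, I k s -> I k (update s x 0%R z)) ->
  I 0 s ->
  (forall k s, k < B a -> I k s -> s x 0%R = Posz k -> I k.+1 (run B p s)) ->
  I (B a) (run B (PFor x a p) s).
Proof.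
move=> hu h0 hS /=.
set f := fun (k : nat) (s : memory) => update (run B p s) x 0%R (Posz k.+1).
suff h k : k <= B a -> I k (iteri k f (update s x 0%R 0%R)) /\
   iteri k f (update s x 0%R 0%R) x 0%R = Posz k by case: (h _ (leqnn _)).
elim: k => [|k IH] hk; first by split; [exact: hu | rewrite /= updateE !eqxx].
have [h1 h2] := IH (ltnW hk).
by split; rewrite iteriS {1}/f ?updateE ?eqxx //; apply/hu/hS.
Qed.

Lemma run_for_fold N (T : Type) (f : T -> 'I_N -> T) (Rp : T -> memory -> Prop) x a p :
  B a = N ->
  (forall t s z, Rp t s -> Rp t (update s x 0%R z)) ->
  (forall t s i, Rp t s -> s x 0%R = Posz (nat_of_ord i) -> Rp (f t i) (run B p s)) ->
  forall t s, Rp t s -> Rp (foldl f t (enum 'I_N)) (run B (PFor x a p) s).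
Proof.
move=> hB hu hS t s h0.
have sz : size (enum 'I_N) = N by rewrite size_enum_ord.
rewrite -[enum 'I_N](take_oversize (n := B a)); last by rewrite sz hB.
apply: (@run_for x a p (fun k s => Rp (foldl f t (take k (enum 'I_N))) s) s)
  => [k s1 z||k s1 hk h hx]; last rewrite hB in hk.
- exact: hu.
- by rewrite take0.
rewrite (take_nth (Ordinal hk)) ?sz // foldl_rcons.
by rewrite (nth_ord_enum (Ordinal hk) (Ordinal hk)); apply: hS.
Qed.

End Loops.

Lemma idx_eq N i j (x y : 'I_N) : (i * N + x == j * N + y) = (i == j) && (x == y).
Proof.
have N0 : 0 < N := leq_ltn_trans (leq0n _) (ltn_ord x).
apply/eqP/andP => [h|[/eqP -> /eqP -> //]].
have := congr1 (divn^~ N) h; rewrite !divnMDl // !divn_small // !addn0 => ->.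
have := congr1 (modn^~ N) h; rewrite !modnMDl !modn_small // => e.
by rewrite eqxx; split=> //; apply/eqP/val_inj.
Qed.

Definition Mat N (s : memory) a (M : rel 'I_N) : Prop :=
  forall x y : 'I_N, s a (Posz (x * N + y)) = Posz (M x y).

Lemma Mat_update N s a (M : rel 'I_N) (x y : 'I_N) (b : bool) : Mat s a M ->
  Mat (update s a (Posz (x * N + y)) (Posz b)) a
      (fun x' y' => if (x' == x) && (y' == y) then b else M x' y').
Proof.
move=> h x' y'; rewrite updateE eqxx eqz_nat idx_eq /=.
by rewrite -val_eqE /=; case: ifP.
Qed.

Section Tables.
Variables (n m : nat) (D : digraph 'I_n 'I_m).
Variable B : nat -> nat.
Hypotheses (Bn : B 0 = n) (Bm : B 1 = m).

Definition Base (s : memory) : Prop :=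
  [/\ s aN 0%R = Posz n, s aM 0%R = Posz m,
      forall e : 'I_m, s aT (Posz e) = Posz (arc_tail D e),
      forall e : 'I_m, s aH (Posz e) = Posz (arc_head D e)
    & (forall x, x <= n -> s tN (Posz x) = Posz (x * n)) /\
      (forall x, x <= B bP -> s tM (Posz x) = Posz (x * m))].

Lemma run_seq p q s : run B (p ;; q) s = run B q (run B p s).
Proof. by []. Qed.

Lemma run_when b p s : run B (When b p) s = if holds s b then run B p s else s.
Proof. by []. Qed.

Definition multiples_of a x y : prog :=
  PFor lx x (PWrite a (Plus (cell lx) (Const 1)) (Plus (Read a (cell lx)) (cell y))).

Lemma run_multiples_of a x y b s : a != lx -> y != lx -> y != a ->
  s y 0%R = Posz b -> s a 0%R = 0%R ->
  forall k, k <= B x -> run B (multiples_of a x y) s a (Posz k) = Posz (k * b).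
Proof.
move=> na ny nya hy ha.
pose I k (s : memory) := s y 0%R = Posz b /\
  forall x, x <= k -> s a (Posz x) = Posz (x * b).
suff [] : I (B x) (run B (multiples_of a x y) s) by [].
apply: run_for => [k s1 z [h1 h2]||k s1 _ [h1 h2] hx].
- by split=> [|j hj]; rewrite update_neq //; apply: h2.
- by split=> // j; rewrite leqn0 => /eqP ->; rewrite mul0n.
rewrite /= hx h1 h2 // -!PoszD addn1; split=> [|j]; first by rewrite update_neq.
rewrite updateE eqxx eqz_nat /=; case: eqP => [-> _|ne hj].
  by rewrite mulSn addnC.
by apply: h2; lia.
Qed.

Definition tables : prog := multiples_of tN aN aN ;; multiples_of tM bP aM.

Lemma run_tables s : s aN 0%R = Posz n -> s aM 0%R = Posz m ->
  (forall e : 'I_m, s aT (Posz e) = Posz (arc_tail D e)) ->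
  (forall e : 'I_m, s aH (Posz e) = Posz (arc_head D e)) ->
  s tN 0%R = 0%R -> s tM 0%R = 0%R -> Base (run B tables s).
Proof.
move=> h0 h1 h2 h3 h4 h5; rewrite run_seq.
have fr p a : a \notin writes p -> forall s, run B p s a = s a.
  by move=> h s1; apply: run_frame.
split; try by [rewrite !fr | move=> e; rewrite !fr].
split=> k hk; last by apply: run_multiples_of; rewrite ?fr.
by rewrite fr //; apply: run_multiples_of; rewrite ?Bn.
Qed.

Definition warshall : prog :=
  PFor lx aN (PWrite tR (at2 tN (cell lx) (cell lx)) (Const 1)) ;;
  PFor le aM (PWrite tR (at2 tN (Read aT (cell le)) (Read aH (cell le))) (Const 1)) ;;
  PFor lz aN (PFor lx aN (PFor ly aN
    (When (And (posT (Read tR (at2 tN (cell lx) (cell lz))))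
               (posT (Read tR (at2 tN (cell lz) (cell ly)))))
       (PWrite tR (at2 tN (cell lx) (cell ly)) (Const 1))))).

Notation R := (connect (arc_rel D)).

Definition MatB s a M := Base s /\ @Mat n s a M.

Lemma warshall_round (M M' : rel 'I_n) (z : 'I_n) :
  (forall x y, M' x y = M x y || M x z && M z y) ->
  (forall z' : 'I_n, z' < z -> forall x y, M x z' -> M z' y -> M x y) ->
  forall z' : 'I_n, z' < z.+1 -> forall x y, M' x z' -> M' z' y -> M' x y.
Proof.
move=> hM hz z'; rewrite ltnS leq_eqVlt => /orP[/eqP/val_inj ->|lt] x y.
  rewrite !hM => /orP[h1|/andP[h1 _]] /orP[h2|/andP[_ h2]];
  by rewrite h1 h2 orbT.
have tr := hz z' lt; rewrite !hM => /orP[h1|/andP[h1 h1']] /orP[h2|/andP[h2' h2]].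
- by rewrite (tr x y).
- by rewrite (tr x z) // h2 orbT.
- by rewrite h1 (tr z y) // orbT.
by rewrite h1 h2 orbT.
Qed.

Lemma run_warshall s : Base s -> (forall i, s tR i = 0%R) ->
  MatB (run B warshall s) tR R.
Proof.
move=> hB h0; rewrite /warshall !run_seq.
set s1 := run B _ s; set s2 := run B _ s1.
have [M1 [hM1 refl1 sub1]] : exists M, [/\ MatB s1 tR M, forall x, M x x &
    forall x y, M x y -> R x y].
  have [] : exists M, [/\ MatB s1 tR M, forall x : 'I_n, x < B 0 -> M x x &
    forall x y, M x y -> R x y]; last first.
    by move=> M [h1 h2 h3]; exists M; split=> // x; apply: h2; rewrite Bn.
  apply: (run_for (I := fun k s => exists M, [/\ MatB s tR M,
    forall x : 'I_n, x < k -> M x x & forall x y, M x y -> R x y])) => //.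
  - exists (fun _ _ => false); split=> //; split=> // x y; exact: h0.
  move=> k s' hk [M [[bs hM] rM sM]] hx; rewrite Bn in hk.
  exists (fun x' y' => if (x' == Ordinal hk) && (y' == Ordinal hk) then true else M x' y').
  have [_ _ _ _ [hN _]] := bs.
  rewrite /= hx (hN _ (ltnW hk)) -PoszD.
  split=> [|x|x y]; first by split=> //; apply: (Mat_update (Ordinal hk) (Ordinal hk) true).
    rewrite ltnS leq_eqVlt => /orP[/eqP ex|/rM ->]; last by case: ifP.
    by rewrite (_ : x = Ordinal hk) ?eqxx //; apply: val_inj.
  by case: ifP => [/andP[/eqP -> /eqP ->] _|_ /sM //]; apply: connect0.
have [M2 [hM2 refl2 arc2 sub2]] : exists M, [/\ MatB s2 tR M, forall x, M x x,
    forall x y, arc_rel D x y -> M x y & forall x y, M x y -> R x y].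
  have [] : exists M, [/\ MatB s2 tR M, forall x, M x x,
    forall e : 'I_m, e < B 1 -> M (arc_tail D e) (arc_head D e) &
    forall x y, M x y -> R x y]; last first.
    move=> M [h1 h2 h3 h4]; exists M; split=> // x y.
    by case/existsP=> e /andP[/eqP <- /eqP <-]; apply: h3; rewrite Bm.
  apply: (run_for (I := fun k s => exists M, [/\ MatB s tR M, forall x, M x x,
    forall e : 'I_m, e < k -> M (arc_tail D e) (arc_head D e) &
    forall x y, M x y -> R x y])) => //.
  - by exists M1; split.
  move=> k s' hk [M [[bs hM] rM aM sM]] hx; rewrite Bm in hk.
  set e := Ordinal hk.
  exists (fun x' y' => if (x' == arc_tail D e) && (y' == arc_head D e) then true else M x' y').
  have [_ _ hT hH [hN _]] := bs.
  rewrite /= hx (hT e) (hH e) (hN _ (ltnW (ltn_ord _))) -PoszD.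
  split=> [|x|x|x y]; first by split=> //; apply: (Mat_update (arc_tail D e) (arc_head D e) true).
  - by case: ifP.
  - rewrite ltnS leq_eqVlt => /orP[/eqP ex|/aM ->]; last by case: ifP.
    by rewrite (_ : x = e) ?eqxx //; apply: val_inj.
  case: ifP => [/andP[/eqP -> /eqP ->] _|_ /sM //]; apply: connect1.
  by apply/existsP; exists e; rewrite !eqxx.
have [M3 [hM3 refl3 arc3 sub3 tr3]] : exists M, [/\ MatB (run B
    (PFor lz aN (PFor lx aN (PFor ly aN
    (When (And (posT (Read tR (at2 tN (cell lx) (cell lz))))
               (posT (Read tR (at2 tN (cell lz) (cell ly)))))
       (PWrite tR (at2 tN (cell lx) (cell ly)) (Const 1)))))) s2) tR M, forall x, M x x,
    forall x y, arc_rel D x y -> M x y, forall x y, M x y -> R x y &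
    forall z : 'I_n, z < B 0 -> forall x y, M x z -> M z y -> M x y].
  apply: (run_for (I := fun k s => exists M, [/\ MatB s tR M, forall x, M x x,
    forall x y, arc_rel D x y -> M x y, forall x y, M x y -> R x y &
    forall z : 'I_n, z < k -> forall x y, M x z -> M z y -> M x y])) => //.
    by exists M2; split.
  move=> k s' hk [M [hM rM aM sM tM]] hz; rewrite Bn in hk; set z := Ordinal hk.
  pose N x y := M x y || M x z && M z y.
  have Nz x : N x z = M x z by rewrite /N rM andbT orbb.
  have zN x : N z x = M z x by rewrite /N rM /= orbb.
  exists N; split.
  - pose I (P : 'I_n -> 'I_n -> bool) (s : memory) := s lz 0%R = Posz z /\
      exists M', [/\ MatB s tR M', forall x y, M x y -> M' x y,
      forall x y, M' x y -> N x y & forall x y, P x y -> N x y -> M' x y].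
    suff [_ [M' [[hb hM'] h1 h2 h3]]] : I (fun x y => x < B 0) (run B (PFor lx aN (PFor ly aN
      (When (And (posT (Read tR (at2 tN (cell lx) (cell lz))))
               (posT (Read tR (at2 tN (cell lz) (cell ly)))))
       (PWrite tR (at2 tN (cell lx) (cell ly)) (Const 1))))) s').
      split=> // x y; rewrite hM'; congr (Posz (nat_of_bool _)); apply/idP/idP; first exact: h2.
      by apply: h3; rewrite Bn.
    apply: (run_for (I := fun k => I (fun x y => x < k))) => //.
      by split=> //; exists M; split=> // x y h; rewrite /N h.
    move=> i s3 hi [hz3 hI] hx3; rewrite Bn in hi.
    pose J k (s : memory) := s lx 0%R = Posz i /\
      I (fun x y => (x < i) || (x == Ordinal hi) && (y < k)) s.
    suff [_ [hz4 [M' [h1 h2 h3 h4]]]] : J (B 0) (run B (PFor ly aN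
      (When (And (posT (Read tR (at2 tN (cell lx) (cell lz))))
               (posT (Read tR (at2 tN (cell lz) (cell ly)))))
       (PWrite tR (at2 tN (cell lx) (cell ly)) (Const 1)))) s3).
      split=> //; exists M'; split=> // x y; rewrite ltnS leq_eqVlt => hxi; apply: h4.
      by rewrite Bn ltn_ord andbT orbC.
    apply: run_for => //.
      case: hI => M' [h1 h2 h3 h4]; split=> //; split=> //; exists M'; split=> // x y.
      by rewrite ltn0 andbF orbF; apply: h4.
    move=> j s4 hj [hx4 [hz4 [M' [[hb hM'] h2 h3 h4]]]] hy4; rewrite Bn in hj.
    have [_ _ _ _ [hN _]] := hb.
    rewrite run_when.
    have -> : holds s4 (And (posT (Read tR (at2 tN (cell lx) (cell lz))))
       (posT (Read tR (at2 tN (cell lz) (cell ly))))) = M (Ordinal hi) z && M z (Ordinal hj).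
      rewrite /= hx4 hz4 hy4 !hN -?PoszD; try exact: ltnW.
      rewrite (hM' (Ordinal hi) z) (hM' z (Ordinal hj)) !lez_nat !lt0b.
      have e1 : M' (Ordinal hi) z = M (Ordinal hi) z.
        by apply/idP/idP => [/h3|/h2 //]; rewrite Nz.
      have e2 : M' z (Ordinal hj) = M z (Ordinal hj).
        by apply/idP/idP => [/h3|/h2 //]; rewrite zN.
      by rewrite e1 e2.
    case: ifP => hc.
      rewrite /= hx4 hy4 hN; last exact: ltnW.
      rewrite -PoszD; split=> //; split=> //.
      exists (fun x' y' => if (x' == Ordinal hi) && (y' == Ordinal hj) then true else M' x' y').
      split=> [|x y|x y|x y].
      - by split=> //; apply: (Mat_update (Ordinal hi) (Ordinal hj) true).
      - by move/h2 => ->; case: ifP.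
      - case: ifP => [/andP[/eqP -> /eqP ->] _|_ /h3 //].
        by rewrite /N hc orbT.
      case: ifP => // hne hP; apply: h4; move: hP; rewrite ltnS (leq_eqVlt y).
      case/orP=> [->//|/andP[/eqP ex /orP[/eqP ey|->]]]; last by rewrite ex eqxx orbT.
      by rewrite ex eqxx /= in hne; rewrite -(_ : y = Ordinal hj) ?eqxx in hne; last exact: val_inj.
    split=> //; split=> //; exists M'; split=> // x y hP hN'.
    move: hP; rewrite ltnS (leq_eqVlt y) => /orP[lt|/andP[/eqP ex /orP[/eqP ey|lt]]].
    - by apply: h4; rewrite ?lt.
    - have ey' : y = Ordinal hj by apply: val_inj.
      by move: hN'; rewrite /N ex ey' hc orbF => /h2.
    by apply: h4; rewrite // ex eqxx lt orbT.
  - by move=> x; rewrite /N rM.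
  - by move=> x y /aM h; rewrite /N h.
  - move=> x y /orP[/sM //|/andP[/sM h1 /sM h2]]; exact: connect_trans h1 h2.
  by apply: (warshall_round (M := M) (z := z)) => [x y|]; [rewrite /N | apply: tM].
have eM : forall x y, M3 x y = R x y.
  move=> x y; apply/idP/idP; first exact: sub3.
  case/connectP=> p hp ->; elim: p x hp => [|z p IH] x //= /andP[xz /IH hz].
  by apply: (tr3 z) => //; [rewrite Bn | apply: arc3].
by case: hM3 => hb hM3; split=> // x y; rewrite hM3 eM.
Qed.

Definition height (Q : rel 'I_n) (x : 'I_n) : nat := \sum_(y < n) ~~ Q x y.

Lemma foldl_addn N (c : nat) (b : 'I_N -> nat) :
  foldl (fun c y => c + b y) c (enum 'I_N) = c + \sum_(y < N) b y.
Proof.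
rewrite -[\sum_(y < N) _]big_enum /=; elim: (enum 'I_N) c => [|y l IH] c /=.
  by rewrite big_nil addn0.
by rewrite IH big_cons addnA.
Qed.

(* The number of non-successors (non-predecessors) is monotone along R, so
   scanning the neighbours of a vertex by this number lists them along R. *)
Definition heights : prog :=
  PFor lx aN (
    set sC (Const 0) ;; set sE (Const 0) ;;
    PFor ly aN (
      When (zeroT (Read tR (at2 tN (cell lx) (cell ly))))
        (set sC (Plus (cell sC) (Const 1))) ;;
      When (zeroT (Read tR (at2 tN (cell ly) (cell lx))))
        (set sE (Plus (cell sE) (Const 1)))) ;;
    PWrite tH0 (cell lx) (cell sC) ;; PWrite tH1 (cell lx) (cell sE)).

Definition Heights (s : memory) : Prop := forall x : 'I_n,
  s tH0 (Posz x) = Posz (height R x) /\ s tH1 (Posz x) = Posz (height (Rop D) x).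

Lemma read_Mat s a M (x y : 'I_n) (ex ey : expr) : MatB s a M ->
  eval s ex = Posz x -> eval s ey = Posz y ->
  eval s (Read a (at2 tN ex ey)) = Posz (M x y).
Proof.
by case=> [[_ _ _ _ [hN _]] hM] hx hy; rewrite /= hx hy (hN _ (ltnW (ltn_ord x))) -PoszD.
Qed.

Lemma run_heights s : MatB s tR R ->
  MatB (run B heights s) tR R /\ Heights (run B heights s).
Proof.
move=> h0.
pose I k (s : memory) := MatB s tR R /\ forall x : 'I_n, x < k ->
  s tH0 (Posz x) = Posz (height R x) /\ s tH1 (Posz x) = Posz (height (Rop D) x).
suff [h1 h2] : I (B 0) (run B heights s).
  by split=> // x; apply: h2; rewrite Bn.
apply: run_for => // k s1 hk [hM hH] hx; rewrite Bn in hk.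
pose x := Ordinal hk; rewrite !run_seq.
set s2 := run B (set sE _) _; set s3 := run B (PFor ly _ _) _.
pose Rp (c : nat * nat) (s : memory) := [/\ I k s, s lx 0%R = Posz k,
  s sC 0%R = Posz c.1 & s sE 0%R = Posz c.2].
pose f (c : nat * nat) (y : 'I_n) := (c.1 + ~~ R x y, c.2 + ~~ Rop D x y).
have : Rp (foldl f (0, 0) (enum 'I_n)) s3.
  apply: run_for_fold => // c s4 y [[h1 h2] h3 h4 h5] h6.
  rewrite run_seq [run B (When _ _) s4]run_when holds_Eq.
  rewrite (read_Mat (x := x) (y := y) h1) //.
  set s5 := (if _ then _ else _).
  have [g1 g2 g3 g4 g5] : [/\ I k s5, s5 lx 0%R = Posz k, s5 ly 0%R = Posz y,
     s5 sC 0%R = Posz (c.1 + ~~ R x y) & s5 sE 0%R = Posz c.2].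
    rewrite /s5; case: (R x y); rewrite /= ?addn0; first by split.
    by rewrite h4 -PoszD addn1; split.
  rewrite run_when holds_Eq (read_Mat (x := y) (y := x) g1.1) //.
  rewrite /f /Rop; case: (R y x) => /=; rewrite ?addn0; first by split.
  by rewrite g5 -PoszD addn1; split.
have -> : foldl f (0, 0) (enum 'I_n) = (height R x, height (Rop D) x).
  have e l c : foldl f c l = (foldl (fun c y => c + ~~ R x y) c.1 l,
     foldl (fun c y => c + ~~ Rop D x y) c.2 l).
    by elim: l c => [|y l IH] c /=; [case: c | rewrite IH].
  by rewrite e !foldl_addn.
case=> [[g1 g2] g3 g4 g5]; rewrite /= !updateE /= g3 g4 g5; split=> // y.
rewrite ltnS leq_eqVlt !updateE /= eqz_nat; case: eqP => [ey _|ne /= /g2 //].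
by rewrite (_ : y = x) //; apply: val_inj.
Qed.

(* The arc chosen to represent an edge is stored with 1 added; 0 is no edge. *)
Definition edges : prog :=
  PFor le aM (When (Not (Eq (Read aT (cell le)) (Read aH (cell le))))
    (PWrite tE (at2 tN (Read aT (cell le)) (Read aH (cell le))) (Plus (cell le) (Const 1)) ;;
     PWrite tE (at2 tN (Read aH (cell le)) (Read aT (cell le))) (Plus (cell le) (Const 1)))).

Definition code (o : option 'I_m) : int := Posz (if o is Some e then e.+1 else 0).

Definition Edges (s : memory) (ar : 'I_n -> 'I_n -> option 'I_m) : Prop :=
  forall x y : 'I_n, s tE (Posz (x * n + y)) = code (ar x y).

Definition represents (ar : 'I_n -> 'I_n -> option 'I_m) : Prop :=
  [/\ forall x y e, ar x y = Some e -> joins D e x y,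
      forall x y e, ar x y = Some e -> x != y,
      forall x y, underlying D x y -> ar x y
    & forall x y, ar x y = ar y x].

Lemma run_edges s : MatB s tR R -> Heights s -> (forall i, s tE i = 0%R) ->
  exists ar, [/\ represents ar, MatB (run B edges s) tR R, Heights (run B edges s)
    & Edges (run B edges s) ar].
Proof.
move=> hM hH h0.
pose I k (s : memory) := [/\ MatB s tR R, Heights s & exists ar,
  [/\ forall x y e, ar x y = Some e -> joins D e x y,
      forall x y e, ar x y = Some e -> x != y,
      forall e : 'I_m, e < k -> arc_tail D e != arc_head D e ->
        ar (arc_tail D e) (arc_head D e) & 
      (forall x y, ar x y = ar y x) /\ Edges s ar]].
suff [h1 h2 [ar [a1 a2 a3 [a4 a5]]]] : I (B 1) (run B edges s).
  exists ar; split=> //; split=> // x y /andP[nxy /existsP[e /orP[]/andP[/eqP ex /eqP ey]]].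
    by have := a3 e; rewrite Bm ltn_ord ex ey => /(_ isT nxy).
  by have := a3 e; rewrite Bm ltn_ord ex ey a4 eq_sym => /(_ isT nxy).
apply: run_for => //.
  split=> //; exists (fun _ _ => None); split=> //; split=> // x y; exact: h0.
move=> k s1 hk [h1 h2 [ar [a1 a2 a3 [a4 a5]]]] hx; rewrite Bm in hk.
pose e := Ordinal hk; have [[_ _ hT hHd [hN _]] _] := h1.
rewrite run_when.
have -> : holds s1 (Not (Eq (Read aT (cell le)) (Read aH (cell le)))) =
    (arc_tail D e != arc_head D e).
  by rewrite -[holds s1 (Not _)]/(~~ holds s1 (Eq _ _)) holds_Eq /= hx (hT e) (hHd e).
have ek (e' : 'I_m) : e' < k.+1 -> e' = e \/ e' < k.
  by rewrite ltnS leq_eqVlt => /orP[/eqP h|]; [left; apply: val_inj | right].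
case: ifPn => [ne|]; last first.
  rewrite negbK => /eqP ee; split=> //; exists ar; split=> // e' /ek[->|]; last exact: a3.
  by rewrite ee eqxx.
rewrite /= !updateE /= hx (hT e) (hHd e) !hN; try exact: ltnW (ltn_ord _).
rewrite -!PoszD; split=> //.
exists (fun x y => if joins D e x y then Some e else ar x y); split.
- by move=> x y e'; case: ifP => [h [<-]|_ /a1].
- move=> x y e'; case: ifP => [h [_]|_ /a2 //].
  by move: h ne => /orP[]/andP[/eqP -> /eqP ->]; rewrite // eq_sym.
- move=> e' /ek[->|h] hne; first by rewrite /joins !eqxx.
  by case: ifP => // _; apply: a3.
split=> x y; first by rewrite joinsC a4.
rewrite !updateE eqxx !eqz_nat !idx_eq /= !val_eqE addn1 a5 /joins.
rewrite (eq_sym x (arc_head D e)) (eq_sym x (arc_tail D e)).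
rewrite (eq_sym y (arc_head D e)) (eq_sym y (arc_tail D e)).
by case: (arc_head D e == x); case: (arc_tail D e == y);
  case: (arc_tail D e == x); case: (arc_head D e == y).
Qed.

End Tables.

Arguments run : simpl never.

Lemma readW_eq B a i e s j : run B (PWrite a i e) s a j =
  if j == eval s i then eval s e else s a j.
Proof. by rewrite /run updateE eqxx. Qed.

Lemma readW_ne B a i e s b : b != a -> run B (PWrite a i e) s b = s b.
Proof. exact: update_neq. Qed.

Lemma read_set B x e s : run B (set x e) s x 0%R = eval s e.
Proof. by rewrite readW_eq. Qed.

Ltac heap := repeat first
  [ rewrite readW_eq | (rewrite readW_ne; last by []) | progress rewrite /= ].

Section Forward.
Variables (n m : nat) (D : digraph 'I_n 'I_m) (w : 'I_m -> nat).
Variable B : nat -> nat.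
Hypotheses (Bn : B 0 = n) (Bm : B 1 = m).
Variable ar : 'I_n -> 'I_n -> option 'I_m.
Hypothesis arP : represents D ar.
Notation R := (connect (arc_rel D)).

Definition Tab (s : memory) : Prop :=
  [/\ MatB D B s tR R, Heights D s & Edges s ar].

Lemma frame_Tab p s : all (fun a => a \notin writes p) [:: 0; 1; 2; 3; 14; 15; 16; 18; 19; 20] ->
  Tab s -> Tab (run B p s).
Proof.
move=> h; have {}h a : a \in [:: 0; 1; 2; 3; 14; 15; 16; 18; 19; 20] ->
    run B p s a = s a by move=> ha; apply/run_frame/(allP h).
by rewrite /Tab /MatB /Base /Mat /Heights /Edges !h.
Qed.

Definition entry_at (s : memory) (i : nat) (en : entry 'I_m) : Prop :=
  match en with
  | None => s gCl (Posz i) = 1%R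
  | Some (g, e, f, c) => s gCl (Posz i) = 0%R /\
     [/\ s gG (Posz i) = Posz g, s gE (Posz i) = Posz e, s gF (Posz i) = Posz f
       & s gC (Posz i) = Posz c]
  end.

Definition Log (l : seq (entry 'I_m)) (s : memory) : Prop :=
  s vK 0%R = Posz (size l) /\
  forall i, i < size l -> entry_at s i (nth None l i).

Definition State (W : 'I_m -> nat) (l : seq (entry 'I_m)) (acc : nat) (s : memory) :=
  [/\ forall e : 'I_m, s aW (Posz e) = Posz (W e), Log l s & s sAcc 0%R = Posz acc].

Definition push_log : prog :=
  set sC (Read aW (cell sE)) ;;
  When (Leq (Read aW (cell sF)) (cell sC)) (set sC (Read aW (cell sF))) ;;
  PWrite gG (cell vK) (cell sG) ;; PWrite gE (cell vK) (cell sE) ;;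
  PWrite gF (cell vK) (cell sF) ;; PWrite gC (cell vK) (cell sC) ;;
  PWrite gCl (cell vK) (Const 0) ;;
  set vK (Plus (cell vK) (Const 1)) ;; set sAcc (Plus (cell sAcc) (cell sC)).

Definition push_weights : prog :=
  PWrite aW (cell sE) (Minus (Read aW (cell sE)) (cell sC)) ;;
  When (Not (Eq (cell sF) (cell sE)))
    (PWrite aW (cell sF) (Minus (Read aW (cell sF)) (cell sC))) ;;
  When (Not (Eq (cell sG) (cell sE)))
    (PWrite aW (cell sG) (Plus (Read aW (cell sG)) (cell sC))).

Definition push : prog := push_log ;; push_weights.

Definition push_clear : prog :=
  PWrite gCl (cell vK) (Const 1) ;; set vK (Plus (cell vK) (Const 1)).

Lemma run_push_log W l acc s (g e f : 'I_m) : State W l acc s ->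
  s sG 0%R = Posz g -> s sE 0%R = Posz e -> s sF 0%R = Posz f ->
  State W (rcons l (Some (g, e, f, minn (W e) (W f)))) (acc + minn (W e) (W f))
    (run B push_log s) /\ run B push_log s sC 0%R = Posz (minn (W e) (W f)).
Proof.
case=> hW [hK hl] hA hg he hf; rewrite /push_log run_seq.
set s1 := run B (set sC _) s; rewrite run_seq run_when.
have -> : holds s1 (Leq (Read 4 (cell 30)) (cell 31)) = (W f <= W e).
  by rewrite /s1; heap; rewrite hf he !hW.
set s2 := (if _ then _ else _).
have [eC hh] : s2 sC 0%R = Posz (minn (W e) (W f)) /\
    forall a, a != sC -> s2 a = s a.
  rewrite /s2; case: leqP => hc; rewrite /s1; split;
    try by move=> a ha; rewrite !(readW_ne _ _ _ _ ha).
  - by heap; rewrite hf hW.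
  - by heap; rewrite he hW.
rewrite !run_seq; clearbody s2.
split; last by heap.
split=> [x||]; first by heap; rewrite hh // hW.
  split; first by heap; rewrite hh // hK size_rcons -PoszD addn1.
  move=> i; rewrite size_rcons ltnS leq_eqVlt nth_rcons => /orP[/eqP ->|hi].
    by rewrite ltnn eqxx; split; [|split]; heap; rewrite ?eC ?hh // hK eqxx.
  rewrite hi; have := hl i hi; rewrite /entry_at.
  have ne : (Posz i == Posz (size l)) = false by rewrite eqz_nat (ltn_eqF hi).
  by case: (nth None l i) => [[[[g' e'] f'] c']|]; heap; rewrite (hh 22) // hK ne
    (hh 27) // ?(hh 23) // ?(hh 24) // ?(hh 25) // ?(hh 26).
by heap; rewrite hh // hA eC.
Qed.

Lemma run_push W l acc s (g e f : 'I_m) : State W l acc s ->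
  s sG 0%R = Posz g -> s sE 0%R = Posz e -> s sF 0%R = Posz f ->
  State (wpush W g e f) (rcons l (Some (g, e, f, minn (W e) (W f))))
    (acc + minn (W e) (W f)) (run B push s).
Proof.
move=> h hg he hf; rewrite run_seq; have [[hW hl hA] hC] := run_push_log h hg he hf.
have [hg1 [he1 hf1]] : run B push_log s sG 0%R = Posz g /\
  run B push_log s sE 0%R = Posz e /\ run B push_log s sF 0%R = Posz f.
  by rewrite !run_frame.
set s1 := run B push_log s in hW hl hA hC hg1 he1 hf1 *; clearbody s1.
split; last 2 first.
- by move: hl; rewrite /Log /entry_at !run_frame.
- by rewrite run_frame.
move=> x; rewrite /push_weights !run_seq.
set c := minn _ _ in hC *.
have ce : c <= W e by apply: geq_minl.
have cf : c <= W f by apply: geq_minr.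
pose W2 y := if y == e then W e - c else W y.
set s2 := run B (PWrite aW _ _) s1.
have h2 (y : 'I_m) : s2 aW (Posz y) = Posz (W2 y).
  rewrite /s2; heap; rewrite he1 hC eqz_nat val_eqE /W2; case: eqP => // _.
  by rewrite hW subzn.
have [e2 f2 g2 c2] : [/\ s2 sE 0%R = Posz e, s2 sF 0%R = Posz f, s2 sG 0%R = Posz g
   & s2 sC 0%R = Posz c] by rewrite /s2; split; heap.
clearbody s2; rewrite [run B (When _ _) s2]run_when.
have -> : holds s2 (Not (Eq (cell 30) (cell 29))) = (f != e).
  by rewrite -[holds s2 (Not _)]/(~~ holds s2 (Eq _ _)) holds_Eq /= f2 e2.
pose W3 y := if (f != e) && (y == f) then W f - c else W2 y.
set s3 := (if _ then _ else _).
have [h3 e3 g3 c3] : [/\ forall y : 'I_m, s3 aW (Posz y) = Posz (W3 y),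
  s3 sE 0%R = Posz e, s3 sG 0%R = Posz g & s3 sC 0%R = Posz c].
  rewrite /s3 /W3; case: ifP => hfe; split=> //= y; heap; rewrite ?h2 //.
  rewrite f2 c2 eqz_nat val_eqE; case: eqP => // _.
  by rewrite h2 /W2 (negbTE hfe) subzn.
clearbody s3; rewrite run_when.
have -> : holds s3 (Not (Eq (cell 28) (cell 29))) = (g != e).
  by rewrite -[holds s3 (Not _)]/(~~ holds s3 (Eq _ _)) holds_Eq /= g3 e3.
have -> : wpush W g e f x = if (g != e) && (x == g) then W3 g + c else W3 x.
  rewrite /wpush /W3 /W2 -/c; case: (eqVneq x e) => [->|xe] /=.
    rewrite andbF addn0 (eq_sym e g) (eq_sym e f).
    by case: (g == e); case: (f == e).
  rewrite andbT; case: (eqVneq x g) => [xg|_]; rewrite ?andbF ?andbT ?addn0 /=.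
    rewrite xg in xe *; rewrite xe (negbTE xe); case: (eqVneq g f) => [gf|_].
      by rewrite -gf xe.
    by rewrite andbF subn0.
  case: (eqVneq x f) => [xf|_]; rewrite ?andbF ?subn0 //.
  by rewrite -xf xe.
case: ifP => hge; last by rewrite h3.
by heap; rewrite g3 c3 eqz_nat val_eqE; case: (eqVneq x g) => [_|_] /=; rewrite h3.
Qed.

Lemma run_push_clear W l acc s : State W l acc s ->
  State W (rcons l None) acc (run B push_clear s).
Proof.
case=> hW [hK hl] hA; rewrite /push_clear run_seq; split=> [e||]; try by heap.
split; first by heap; rewrite hK size_rcons -PoszD addn1.
move=> i; rewrite size_rcons ltnS leq_eqVlt nth_rcons => /orP[/eqP ->|hi].
  by rewrite ltnn eqxx /=; heap; rewrite hK eqxx.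
rewrite hi; have := hl i hi; rewrite /entry_at.
have ne : (Posz i == Posz (size l)) = false by rewrite eqz_nat (ltn_eqF hi).
by case: (nth None l i) => [[[[g' e'] f'] c']|]; heap; rewrite hK ne.
Qed.

Definition OpState W l acc ops s :=
  State (wfin W ops) (l ++ ents W ops) (acc + csum (ents W ops)) s.

Lemma OpState_nil W l acc s : State W l acc s -> OpState W l acc [::] s.
Proof. by rewrite /OpState /= cats0 /csum big_nil addn0. Qed.

Lemma run_push_op W l acc ops s (g e f : 'I_m) : OpState W l acc ops s ->
  s sG 0%R = Posz g -> s sE 0%R = Posz e -> s sF 0%R = Posz f ->
  OpState W l acc (rcons ops (Some (g, e, f))) (run B push s).
Proof.
move=> h hg he hf; have := run_push h hg he hf.
rewrite /OpState -[rcons ops _]cats1 wfin_cat ents_cat csum_cat /=.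
by rewrite [csum [:: Some _]]/csum big_seq1 addnA catA cats1.
Qed.

Lemma run_clear_op W l acc ops s : OpState W l acc ops s ->
  OpState W l acc (rcons ops None) (run B push_clear s).
Proof.
move/run_push_clear; rewrite /OpState -[rcons ops _]cats1 wfin_cat ents_cat csum_cat.
by rewrite /= csumN csum_nil addn0 catA cats1.
Qed.

Lemma frame_State W l acc p s :
  all (fun a => a \notin writes p) [:: 4; 22; 23; 24; 25; 26; 27; 32] ->
  State W l acc s -> State W l acc (run B p s).
Proof.
move=> h; have {}h a : a \in [:: 4; 22; 23; 24; 25; 26; 27; 32] ->
    run B p s a = s a by move=> ha; apply/run_frame/(allP h).
by rewrite /State /Log /entry_at !h.
Qed.

Lemma frame_OpState W l acc ops p s :
  all (fun a => a \notin writes p) [:: 4; 22; 23; 24; 25; 26; 27; 32] ->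
  OpState W l acc ops s -> OpState W l acc ops (run B p s).
Proof. exact: frame_State. Qed.

Lemma foldl_cat_map (T U : Type) (F : T -> seq U) l s :
  foldl (fun l x => l ++ F x) l s = l ++ flatten (map F s).
Proof.
elim: s l => [|x s IH] l /=; first by rewrite cats0.
by rewrite IH catA.
Qed.

End Forward.

Lemma run_if B b p q s :
  run B (PIf b p q) s = if holds s b then run B p s else run B q s.
Proof. by []. Qed.

Lemma predz_nat k : (Posz k.+1 - 1)%R = Posz k.
Proof. by lia. Qed.

Lemma holds_And s a b : holds s (And a b) = holds s a && holds s b.
Proof. by []. Qed.

Lemma holds_And6 s a b c d e f :
  holds s (And a (And b (And c (And d (And e f))))) =
  [&& holds s a, holds s b, holds s c, holds s d, holds s e & holds s f].
Proof. by []. Qed.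

Lemma holds_zero s e k : eval s e = Posz k -> holds s (zeroT e) = (k == 0).
Proof. by move=> h; rewrite holds_Eq h. Qed.

Lemma holds_pos s e k : eval s e = Posz k -> holds s (posT e) = (0 < k).
Proof. by move=> h; rewrite /= h. Qed.

Lemma holds_neq_ord N s e1 e2 (x y : 'I_N) : eval s e1 = Posz x -> eval s e2 = Posz y ->
  holds s (Not (Eq e1 e2)) = (x != y).
Proof.
by move=> hx hy; rewrite -[holds s (Not _)]/(~~ holds s (Eq _ _)) holds_Eq hx hy
  eqz_nat val_eqE.
Qed.

Section Elim.
Variables (n m : nat) (D : digraph 'I_n 'I_m) (w : 'I_m -> nat).
Variable B : nat -> nat.
Hypotheses (Bn : B 0 = n) (Bm : B 1 = m).
Variable ar : 'I_n -> 'I_n -> option 'I_m.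
Hypothesis arP : represents D ar.
Notation R := (connect (arc_rel D)).
Notation TabS := (Tab D B ar).

Lemma isolate_rcons (ts : seq ('I_m * 'I_m * 'I_m)) t :
  isolate (ts ++ [:: t]) = rcons (rcons (isolate ts) (Some t)) None.
Proof. by rewrite /isolate map_cat flatten_cat /= -!cats1 -catA. Qed.

Lemma read_edge s (ex ey : expr) (x y : 'I_n) : TabS s ->
  eval s ex = Posz x -> eval s ey = Posz y ->
  eval s (Read tE (at2 tN ex ey)) = code (ar x y).
Proof.
case=> [[[_ _ _ _ [hN _]] _] _ hE] hx hy.
by rewrite /= hx hy (hN _ (ltnW (ltn_ord x))) -PoszD.
Qed.

Lemma read_rel s (ex ey : expr) (x y : 'I_n) : TabS s ->
  eval s ex = Posz x -> eval s ey = Posz y ->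
  eval s (Read tR (at2 tN ex ey)) = Posz (R x y).
Proof. by case=> h _ _ hx hy; exact: (read_Mat h hx hy). Qed.

Definition edge_at ex ey : expr := Minus (Read tE (at2 tN ex ey)) (Const 1).

Lemma read_edge_at s (ex ey : expr) (x y : 'I_n) e : TabS s ->
  eval s ex = Posz x -> eval s ey = Posz y -> ar x y = Some e ->
  eval s (edge_at ex ey) = Posz e.
Proof.
move=> hT hx hy he.
have := read_edge hT hx hy; rewrite he /code /= => ->; exact: predz_nat.
Qed.

Definition sum_weights : prog :=
  PFor le aM (set sTau (Plus (cell sTau) (Read aW (cell le)))).

Lemma run_sum_weights s : (forall e : 'I_m, s aW (Posz e) = Posz (w e)) ->
  s sTau 0%R = 0%R -> run B sum_weights s sTau 0%R = Posz (\sum_e w e).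
Proof.
move=> hW h0.
pose Rp c (s : memory) := s sTau 0%R = Posz c /\
  forall e : 'I_m, s aW (Posz e) = Posz (w e).
suff [] : Rp (foldl (fun c e => c + w e) 0 (enum 'I_m)) (run B sum_weights s).
  by rewrite foldl_addn.
apply: run_for_fold => // c s1 e [h1 h2] he.
by split; [heap; rewrite he h1 h2 | heap].
Qed.

Definition merge_parallel : prog :=
  PFor le aM (When (Not (Eq (Read aT (cell le)) (Read aH (cell le))))
    (set sG (edge_at (Read aT (cell le)) (Read aH (cell le))) ;;
     When (Not (Eq (cell sG) (cell le)))
       (set sE (cell le) ;; set sF (cell le) ;; push ;; push_clear))).

Definition parallel (e : 'I_m) : seq ('I_m * 'I_m * 'I_m) :=
  if ar (arc_tail D e) (arc_head D e) is Some g then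
    if g != e then [:: (g, e, e)] else [::] else [::].

Lemma holds_NEq s e1 e2 : holds s (Not (Eq e1 e2)) = (eval s e1 != eval s e2).
Proof. by rewrite -[holds s (Not _)]/(~~ holds s (Eq _ _)) holds_Eq. Qed.

Lemma run_merge_parallel s : TabS s -> State w [::] 0 s ->
  let ops := isolate (flatten (map parallel (enum 'I_m))) in
  TabS (run B merge_parallel s) /\ OpState w [::] 0 ops (run B merge_parallel s).
Proof.
move=> hT hS ops.
pose Rp ts (s : memory) := TabS s /\ OpState w [::] 0 (isolate ts) s.
have : Rp (foldl (fun ts e => ts ++ parallel e) [::] (enum 'I_m)) (run B merge_parallel s).
  apply: run_for_fold => //; last by split=> //; apply: OpState_nil.
  move=> ts s1 e [h1 h2] he; rewrite run_when holds_NEq.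
  have [[[_ _ hTl hHd _] _] _ _] := h1.
  have eT : eval s1 (Read 2 (cell 45)) = Posz (arc_tail D e) by rewrite /= he hTl.
  have eH : eval s1 (Read 3 (cell 45)) = Posz (arc_head D e) by rewrite /= he hHd.
  rewrite eT eH eqz_nat val_eqE; have [_ ar_neq ar_adj _] := arP.
  case: ifPn => [ne|]; last first.
    rewrite negbK /parallel => /eqP ->.
    case E: (ar _ _) => [g|]; last by rewrite cats0.
    by have := ar_neq _ _ _ E; rewrite eqxx.
  have [g eg] : exists g, ar (arc_tail D e) (arc_head D e) = Some g.
    have /ar_adj : underlying D (arc_tail D e) (arc_head D e).
      by rewrite /underlying ne; apply/existsP; exists e; rewrite !eqxx.
    by case: (ar _ _) => // g _; exists g.
  rewrite /parallel eg run_seq; set s2 := run B (set _ _) s1.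
  have T2 : TabS s2 by apply: frame_Tab.
  have O2 : OpState w [::] 0 (isolate ts) s2 by apply: frame_OpState.
  have g2 : s2 sG 0%R = Posz g by rewrite /s2 read_set (read_edge_at h1 eT eH eg).
  have e2 : s2 le 0%R = Posz e by rewrite /s2; heap.
  clearbody s2; rewrite run_when holds_NEq /= g2 e2 eqz_nat val_eqE.
  case: ifP => _; last by rewrite cats0.
  rewrite 3!run_seq; set s3 := run B (set 30 _) _.
  split; first by do !apply: frame_Tab => //.
  rewrite isolate_rcons; apply: run_clear_op.
  apply: run_push_op; rewrite /s3; try by heap.
by rewrite foldl_cat_map.
Qed.

Definition Alive (S : {set 'I_n}) (s : memory) : Prop :=
  forall x : 'I_n, s tD (Posz x) = Posz (x \notin S).

Definition Ctx S (v : 'I_n) (s : memory) : Prop :=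
  [/\ TabS s, Alive S s & s sV 0%R = Posz v].

Lemma frame_Ctx S v p s :
  all (fun a => a \notin writes p) [:: 0; 1; 2; 3; 14; 15; 16; 18; 19; 20; 21; 34] ->
  Ctx S v s -> Ctx S v (run B p s).
Proof.
move=> h [hT hA hV]; have {}h a : a \in [:: 0; 1; 2; 3; 14; 15; 16; 18; 19; 20; 21; 34] ->
   a \notin writes p by move=> ha; apply: (allP h).
split; last by rewrite run_frame ?h.
- by apply: frame_Tab => //; apply/allP => a ha; apply: h; move: ha; rewrite !inE;
    repeat case/orP=> [->|]; rewrite ?orbT // => ->; rewrite ?orbT.
by rewrite /Alive run_frame ?h.
Qed.

Definition choose_vertex : prog :=
  PFor lx aN (
    set sBad (Read tD (cell lx)) ;;
    PFor ly aN (PFor lz aN (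
      When (And (zeroT (Read tD (cell ly))) (And (zeroT (Read tD (cell lz)))
           (And (Not (Eq (cell ly) (cell lz)))
           (And (posT (Read tE (at2 tN (cell lx) (cell ly))))
           (And (posT (Read tE (at2 tN (cell lx) (cell lz))))
                (zeroT (Read tE (at2 tN (cell ly) (cell lz)))))))))
        (set sBad (Const 1)))) ;;
    When (zeroT (cell sBad)) (set sV (cell lx))).

Definition spoils (S : {set 'I_n}) (x y z : 'I_n) : bool :=
  [&& y \in S, z \in S, y != z, ar x y : bool, ar x z : bool & ~~ ar y z].

Definition eliminable (S : {set 'I_n}) (x : 'I_n) : bool :=
  (x \in S) && ~~ has (fun y => has (spoils S x y) (enum 'I_n)) (enum 'I_n).

Lemma eliminableP (S : {set 'I_n}) x : reflect (x \in S /\ simplicial (underlying D) S x) (eliminable S x).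
Proof.
have [ar_joins ar_neq ar_adj ar_sym] := arP.
have hadj := adjE ar_joins ar_neq ar_adj.
apply: (iffP andP) => [[xS /hasPn hx]|[xS hx]]; split=> //.
  move=> y z yS zS xy xz yz; have := hx y (mem_enum _ _).
  move/hasPn/(_ z (mem_enum _ _)); rewrite /spoils yS zS yz -!hadj xy xz /=.
  by rewrite negbK.
apply/hasPn => y _; apply/hasPn => z _; apply/negP.
case/and5P=> yS zS yz xy /andP[xz]; rewrite -!hadj in xy xz * => /negP; apply.
exact: hx.
Qed.

Lemma foldl_orb (T : Type) (P : pred T) b s :
  foldl (fun b x => b || P x) b s = b || has P s.
Proof. by elim: s b => [|x s IH] b /=; rewrite ?orbF // IH orbA. Qed.

Lemma code_pos (o : option 'I_m) s e : eval s e = code o -> holds s (posT e) = o.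
Proof. by rewrite /code => /holds_pos ->; case: o. Qed.

Lemma code_zero (o : option 'I_m) s e : eval s e = code o -> holds s (zeroT e) = ~~ o.
Proof. by rewrite /code => /holds_zero ->; case: o. Qed.

Lemma dead_zero S s (x : 'I_n) e : Alive S s -> eval s e = Posz x ->
  holds s (zeroT (Read tD e)) = (x \in S).
Proof.
by move=> hA hx; rewrite (holds_zero (k := x \notin S)) /= ?hx ?hA //; case: (_ \in _).
Qed.

Lemma rel_pos s ex ey (x y : 'I_n) : TabS s -> eval s ex = Posz x -> eval s ey = Posz y ->
  holds s (posT (Read tR (at2 tN ex ey))) = R x y.
Proof. by move=> hT hx hy; rewrite (holds_pos (read_rel hT hx hy)) lt0b. Qed.

Lemma run_choose_vertex S s : TabS s -> Alive S s -> (exists x, eliminable S x) ->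
  exists v : 'I_n, eliminable S v /\ run B choose_vertex s sV 0%R = Posz v.
Proof.
move=> hT hA [x0 hx0].
pose I k (s : memory) := [/\ TabS s, Alive S s &
  (forall x : 'I_n, x < k -> ~~ eliminable S x) \/
  exists v : 'I_n, eliminable S v /\ s sV 0%R = Posz v].
suff [_ _ [h|//]] : I (B 0) (run B choose_vertex s).
  by have := h x0; rewrite Bn hx0 ltn_ord => /(_ isT).
apply: run_for => //; first by split=> //; left.
move=> k s1 hk [h1 h2 h3] hx; rewrite Bn in hk; pose x := Ordinal hk.
rewrite 2!run_seq; set s2 := run B (set _ _) s1.
have [g1 g2 g3 g4] : [/\ TabS s2, Alive S s2, s2 lx 0%R = Posz x &
    s2 sBad 0%R = Posz (x \notin S)].
  split; [exact: frame_Tab | by rewrite /s2 /Alive run_frame | by rewrite /s2; heap |].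
  by rewrite /s2 read_set /= hx (h2 x).
have gV : s2 sV 0%R = s1 sV 0%R by rewrite /s2; heap.
clearbody s2; set s3 := run B (PFor _ _ _) s2.
pose Rp (b : bool) (s : memory) := [/\ TabS s, Alive S s, s lx 0%R = Posz x &
    s sBad 0%R = Posz b] /\ s sV 0%R = s1 sV 0%R.
have : Rp (foldl (fun b y => b || has (spoils S x y) (enum 'I_n)) (x \notin S)
   (enum 'I_n)) s3.
  apply: run_for_fold => // b s4 y [[e1 e2 e3 e4] eV] e5.
  rewrite -foldl_orb.
  pose Rq (b : bool) (s : memory) := Rp b s /\ s ly 0%R = Posz y.
  suff [] : Rq (foldl (fun b z => b || spoils S x y z) b (enum 'I_n)) (run B
    (PFor lz aN (
      When (And (zeroT (Read tD (cell ly))) (And (zeroT (Read tD (cell lz)))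
           (And (Not (Eq (cell ly) (cell lz)))
           (And (posT (Read tE (at2 tN (cell lx) (cell ly))))
           (And (posT (Read tE (at2 tN (cell lx) (cell lz))))
                (zeroT (Read tE (at2 tN (cell ly) (cell lz)))))))))
        (set sBad (Const 1)))) s4) by [].
  apply: run_for_fold => // b' s5 z [[[f1 f2 f3 f4] fV] f5] f6.
  rewrite run_when holds_And6 (dead_zero (x := y) f2) // (dead_zero (x := z) f2) //.
  rewrite (holds_neq_ord (x := y) (y := z)) //.
  rewrite (code_pos (read_edge (x := x) (y := y) f1 _ _)) //.
  rewrite (code_pos (read_edge (x := x) (y := z) f1 _ _)) //.
  rewrite (code_zero (read_edge (x := y) (y := z) f1 _ _)) //.
  rewrite -/(spoils S x y z); case: (spoils S x y z); rewrite ?orbF ?orbT //.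
rewrite foldl_orb => -[[e1 e2 e3 e4] eV]; rewrite run_when.
rewrite (holds_zero (s := s3) (e := cell 37) e4) eqb0 negb_or negbK -/(eliminable S x).
have eqx (y : 'I_n) : y < k.+1 -> y = x \/ y < k.
  by rewrite ltnS leq_eqVlt => /orP[/eqP e|]; [left; apply: val_inj|right].
case: ifP => hel.
  split; [exact: frame_Tab | by rewrite /Alive run_frame |].
  by right; exists x; rewrite read_set /= e3.
split=> //; rewrite eV; case: h3 => [h3|]; [left|by right].
by move=> y /eqx[->|/h3 //]; rewrite hel.
Qed.

Definition pair_ops : prog :=
  PFor lx aN (PFor ly aN (
    When (And (zeroT (Read tD (cell lx))) (And (zeroT (Read tD (cell ly)))
         (And (posT (Read tR (at2 tN (cell lx) (cell sV))))
         (And (posT (Read tR (at2 tN (cell sV) (cell ly))))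
         (And (posT (Read tE (at2 tN (cell sV) (cell lx))))
         (And (posT (Read tE (at2 tN (cell sV) (cell ly))))
              (posT (Read tE (at2 tN (cell lx) (cell ly))))))))))
      (set sG (edge_at (cell lx) (cell ly)) ;; set sE (edge_at (cell sV) (cell lx)) ;;
       set sF (edge_at (cell sV) (cell ly)) ;; push ;; push_clear))).

Definition triangle (S : {set 'I_n}) (v a b : 'I_n) : seq ('I_m * 'I_m * 'I_m) :=
  if [&& a \in S, b \in S, R a v & R v b] then
    if (ar v a, ar v b, ar a b) is (Some e, Some f, Some g) then [:: (g, e, f)] else [::]
  else [::].

Definition triangles S v := flatten (map
  (fun a => flatten (map (triangle S v a) (enum 'I_n))) (enum 'I_n)).

Lemma triangles_mem (S : {set 'I_n}) v g e f : (g, e, f) \in triangles S v <->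
  exists a b, [/\ a \in S, b \in S, R a v, R v b &
     [/\ ar v a = Some e, ar v b = Some f & ar a b = Some g]].
Proof.
split.
  case/flattenP=> _ /mapP[a _ ->] /flattenP[_ /mapP[b _ ->]]; rewrite /triangle.
  case: ifP => // /and4P[aS bS av vb].
  case Ea: (ar v a) => [e'|] //; case Eb: (ar v b) => [f'|] //.
  case Eg: (ar a b) => [g'|] //; rewrite inE => /eqP[-> -> ->].
  by exists a, b; rewrite Ea Eb Eg; split.
move=> [a [b [aS bS av vb [ea eb eg]]]].
apply/flattenP; exists (flatten (map (triangle S v a) (enum 'I_n))).
  by apply/mapP; exists a; rewrite // mem_enum.
apply/flattenP; exists (triangle S v a b); first by apply/mapP; exists b; rewrite // mem_enum.
by rewrite /triangle aS bS av vb ea eb eg mem_head.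
Qed.

Lemma size_triangles S v : size (triangles S v) <= n * n.
Proof.
have hf (T : Type) (F : 'I_n -> seq T) c : (forall x, size (F x) <= c) ->
    size (flatten (map F (enum 'I_n))) <= n * c.
  move=> hF; have -> : n * c = size (enum 'I_n) * c by rewrite size_enum_ord.
  elim: (enum 'I_n) => //= x l IH; rewrite size_cat mulSn; exact: leq_add.
apply: (hf _ _ n) => a; rewrite -[X in _ <= X]muln1; apply: (hf _ _ 1) => b; rewrite /triangle.
by case: ifP => // _; case: (ar v a) => [e|] //; case: (ar v b) => [f|] //; case: (ar a b).
Qed.

Lemma run_pair_ops S v W l acc s : Ctx S v s -> State W l acc s ->
  Ctx S v (run B pair_ops s) /\
  OpState W l acc (isolate (triangles S v)) (run B pair_ops s).
Proof.
move=> hC hS.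
pose Rp ts (s : memory) := Ctx S v s /\ OpState W l acc (isolate ts) s.
suff : Rp (foldl (fun ts a => ts ++ flatten (map (triangle S v a) (enum 'I_n))) [::]
  (enum 'I_n)) (run B pair_ops s) by rewrite foldl_cat_map.
apply: run_for_fold => //; last by split=> //; apply: OpState_nil.
move=> ts s1 x hs1 hx; rewrite -foldl_cat_map.
pose Rq ts (s : memory) := Rp ts s /\ s lx 0%R = Posz x.
suff [] : Rq (foldl (fun ts b => ts ++ triangle S v x b) ts (enum 'I_n)) (run B
  (PFor ly aN (
    When (And (zeroT (Read tD (cell lx))) (And (zeroT (Read tD (cell ly)))
         (And (posT (Read tR (at2 tN (cell lx) (cell sV))))
         (And (posT (Read tR (at2 tN (cell sV) (cell ly))))
         (And (posT (Read tE (at2 tN (cell sV) (cell lx))))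
         (And (posT (Read tE (at2 tN (cell sV) (cell ly))))
              (posT (Read tE (at2 tN (cell lx) (cell ly))))))))))
      (set sG (edge_at (cell lx) (cell ly)) ;; set sE (edge_at (cell sV) (cell lx)) ;;
       set sF (edge_at (cell sV) (cell ly)) ;; push ;; push_clear))) s1) by [].
apply: run_for_fold => // ts' s2 y [[hC2 hO2] hx2] hy2.
have [hT2 hA2 hV2] := hC2.
rewrite run_when holds_And holds_And6 (dead_zero (x := x) hA2) // (dead_zero (x := y) hA2) //.
rewrite (rel_pos (x := x) (y := v) hT2) // (rel_pos (x := v) (y := y) hT2) //.
rewrite (code_pos (read_edge (x := v) (y := x) hT2 _ _)) //.
rewrite (code_pos (read_edge (x := v) (y := y) hT2 _ _)) //.
rewrite (code_pos (read_edge (x := x) (y := y) hT2 _ _)) //.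
rewrite /triangle; case: (boolP (x \in S)) => xS; last by rewrite /= cats0.
case: (boolP (y \in S)) => yS; last by rewrite /= cats0.
case: (boolP (R x v)) => xv; last by rewrite /= cats0.
case: (boolP (R v y)) => vy; last by rewrite /= cats0.
case Ea: (ar v x) => [e|]; last by rewrite /= cats0.
case Eb: (ar v y) => [f|]; last by rewrite /= cats0.
case Eg: (ar x y) => [g|]; last by rewrite /= cats0.
rewrite /= 4!run_seq.
set s3 := run B (set 28 _) s2; set s4 := run B (set 29 _) s3; set s5 := run B (set 30 _) s4.
have hT3 : TabS s3 by apply: frame_Tab.
have hT4 : TabS s4 by apply: frame_Tab.
split; last by do 5!rewrite run_frame //.
split; first by do 5!apply: frame_Ctx => //.
rewrite isolate_rcons; apply: run_clear_op; apply: run_push_op.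
- by do 3!apply: frame_OpState => //.
- by rewrite /s5 /s4; do 2!rewrite run_frame //; rewrite /s3 read_set (read_edge_at hT2 _ _ Eg).
- by rewrite /s5 run_frame // /s4 read_set (read_edge_at hT3 _ _ Ea).
by rewrite /s5 read_set (read_edge_at hT4 _ _ Eb).
Qed.

End Elim.

Section Sides.
Variables (n m : nat) (D : digraph 'I_n 'I_m) (w : 'I_m -> nat).
Variable B : nat -> nat.
Hypotheses (Bn : B 0 = n) (Bm : B 1 = m).
Variable ar : 'I_n -> 'I_n -> option 'I_m.
Hypothesis arP : represents D ar.
Notation R := (connect (arc_rel D)).
Notation TabS := (Tab D B ar).
Notation CtxS := (Ctx D B ar).

(* [d] selects the side: out-neighbours for [false], in-neighbours for [true]. *)
Definition side_head (d : bool) : nat := if d then sB1 else sB0.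
Definition side_height (d : bool) : nat := if d then tH1 else tH0.
Definition side_test (d : bool) : test :=
  if d then posT (Read tR (at2 tN (cell lx) (cell sV)))
  else posT (Read tR (at2 tN (cell sV) (cell lx))).
Definition side_rel (d : bool) : rel 'I_n := if d then Rop D else R.

Definition side_first (d : bool) : expr := Minus (cell (side_head d)) (Const 1).

Definition side_body (d : bool) : prog :=
  When (zeroT (cell (side_head d))) (set (side_head d) (Plus (cell lx) (Const 1))) ;;
  set sE (edge_at (cell sV) (cell lx)) ;; set sF (cell sE) ;;
  PIf (zeroT (Read tE (at2 tN (side_first d) (cell lx))))
    (set sG (cell sE)) (set sG (edge_at (side_first d) (cell lx))) ;;
  push.

Definition side (d : bool) : prog :=
  set (side_head d) (Const 0) ;;
  PFor lh aN (PFor lx aN (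
    When (And (zeroT (Read tD (cell lx)))
         (And (posT (Read tE (at2 tN (cell sV) (cell lx))))
         (And (side_test d) (Eq (Read (side_height d) (cell lx)) (cell lh)))))
      (side_body d))).

Definition in_level (S : {set 'I_n}) v d (h x : 'I_n) : bool :=
  [&& x \in S, ar v x : bool, side_rel d v x & height (side_rel d) x == h].

Definition side_list (S : {set 'I_n}) v d : seq 'I_n :=
  flatten (map (fun h => flatten (map
    (fun x => if in_level S v d h x then [:: x] else [::]) (enum 'I_n))) (enum 'I_n)).

Definition head_code (bs : seq 'I_n) : nat := if bs is b :: _ then b.+1 else 0.

Definition SideState S v W l acc o d (bs : seq 'I_n) (s : memory) : Prop :=
  [/\ CtxS S v s, OpState W l acc (o ++ sideops ar v (head v bs) bs) s
    & s (side_head d) 0%R = Posz (head_code bs)].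

Lemma sideops_rcons v x bs e : ar v x = Some e ->
  sideops ar v (head v (rcons bs x)) (rcons bs x) =
  rcons (sideops ar v (head v bs) bs) (Some (odflt e (ar (head x bs) x), e, e)).
Proof.
move=> he; have -> : head v (rcons bs x) = head x bs by case: bs.
rewrite /sideops map_rcons -cats1 flatten_cat /= cats0 [sideop _ v _ x]/sideop he cats1.
by congr rcons; case: bs.
Qed.

Lemma run_side_body S v W l acc o d bs s (x h : 'I_n) e :
  SideState S v W l acc o d bs s -> s lx 0%R = Posz x -> ar v x = Some e ->
  SideState S v W l acc o d (rcons bs x) (run B (side_body d) s).
Proof.
move=> [hC hO hH] hx he; have [_ _ hV] := hC.
rewrite /side_body run_seq run_when.
rewrite (holds_zero (s := s) (e := cell (side_head d)) hH).
set s1 := (if _ then _ else _).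
have [C1 O1 H1 x1] : [/\ CtxS S v s1,
    OpState W l acc (o ++ sideops ar v (head v bs) bs) s1,
    s1 (side_head d) 0%R = Posz (head x bs).+1 & s1 lx 0%R = Posz x].
  rewrite /s1; case: (bs) hH hO => [|b bs1] hH1 hO1 /=; last by split.
  split; last by rewrite run_frame //; case: (d).
  - by apply: frame_Ctx => //; case: (d).
  - by apply: frame_OpState => //; case: (d).
  by rewrite read_set /= hx -PoszD addn1.
clearbody s1; have [T1 A1 V1] := C1.
rewrite 3!run_seq.
set s2 := run B (set 29 _) s1; set s3 := run B (set 30 _) s2.
have e2 : s2 sE 0%R = Posz e by rewrite /s2 read_set (read_edge_at T1 _ _ he).
have [C3 O3 e3 f3] : [/\ CtxS S v s3,
    OpState W l acc (o ++ sideops ar v (head v bs) bs) s3,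
    s3 sE 0%R = Posz e & s3 sF 0%R = Posz e].
  split.
  - by do 2!apply: frame_Ctx => //.
  - by do 2!apply: frame_OpState => //.
  - by rewrite /s3 run_frame.
  by rewrite /s3 read_set /= e2.
have H3 : s3 (side_head d) 0%R = Posz (head x bs).+1.
  by rewrite /s3 /s2 !run_frame //; case: (d).
have x3 : s3 lx 0%R = Posz x by rewrite /s3 /s2 !run_frame.
clearbody s3; have [T3 A3 V3] := C3.
have F3 : eval s3 (side_first d) = Posz (head x bs).
  by rewrite /side_first /= H3 predz_nat.
set s4 := run B (PIf _ _ _) s3.
have g4 : s4 sG 0%R = Posz (odflt e (ar (head x bs) x)).
  rewrite /s4 run_if.
  rewrite (code_zero (read_edge (ey := cell 40) (y := x) T3 F3 _)) //.
  case E: (ar (head x bs) x) => [g|].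
    rewrite -[LHS]/(run B (set 28 (edge_at (side_first d) (cell 40))) s3 28 0%R).
    by rewrite read_set (read_edge_at T3 F3 _ E).
  by rewrite -[LHS]/(run B (set 28 (cell 29)) s3 28 0%R) read_set /= e3.
have O4 : OpState W l acc (o ++ sideops ar v (head v bs) bs) s4.
  by apply: frame_OpState => //; case: (d).
split.
- by apply: frame_Ctx => //; apply: frame_Ctx => //; case: (d).
- rewrite (sideops_rcons _ he) -rcons_cat; apply: run_push_op => //.
  + by rewrite /s4 run_frame //; case: (d).
  by rewrite /s4 run_frame //; case: (d).
rewrite run_frame; last by case: (d).
rewrite /s4 run_frame; last by case: (d).
by rewrite H3; case: (bs).
Qed.

Lemma run_side S v W l acc o d s : CtxS S v s -> OpState W l acc o s ->
  SideState S v W l acc o d (side_list S v d) (run B (side d) s).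
Proof.
move=> hC hO; rewrite /side run_seq; set s0 := run B (set _ _) s.
have h0 : SideState S v W l acc o d [::] s0.
  split; last by rewrite /s0 read_set.
  - by apply: frame_Ctx => //; case: (d).
  - by rewrite cats0; apply: frame_OpState => //; case: (d).
clearbody s0; pose F h x := if in_level S v d h x then [:: x] else [::].
suff : SideState S v W l acc o d (foldl (fun bs h => bs ++ flatten (map (F h) (enum 'I_n)))
  [::] (enum 'I_n)) (run B (PFor lh aN (PFor lx aN (
    When (And (zeroT (Read tD (cell lx)))
         (And (posT (Read tE (at2 tN (cell sV) (cell lx))))
         (And (side_test d) (Eq (Read (side_height d) (cell lx)) (cell lh)))))
      (side_body d)))) s0) by rewrite foldl_cat_map.
apply: run_for_fold => //; first by case: (d).
move=> bs s1 h hs1 hh; rewrite -foldl_cat_map.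
pose Rq bs (s : memory) := SideState S v W l acc o d bs s /\ s lh 0%R = Posz h.
suff [] : Rq (foldl (fun bs x => bs ++ F h x) bs (enum 'I_n)) (run B (PFor lx aN (
    When (And (zeroT (Read tD (cell lx)))
         (And (posT (Read tE (at2 tN (cell sV) (cell lx))))
         (And (side_test d) (Eq (Read (side_height d) (cell lx)) (cell lh)))))
      (side_body d))) s1) by [].
apply: run_for_fold => //; first by rewrite /Rq; case: (d).
move=> bs' s2 x [hS2 hh2] hx2; have [[hT2 hA2 hV2] hO2 hH2] := hS2.
rewrite run_when holds_And (dead_zero (x := x) hA2) // holds_And.
rewrite (code_pos (read_edge (x := v) (y := x) hT2 _ _)) // holds_And holds_Eq.
have -> : holds s2 (side_test d) = side_rel d v x.
  rewrite /side_test /side_rel; case: (d).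
    by rewrite (rel_pos (x := x) (y := v) hT2).
  by rewrite (rel_pos (x := v) (y := x) hT2).
have -> : (eval s2 (Read (side_height d) (cell 40)) == eval s2 (cell 43)) =
    (height (side_rel d) x == h).
  have [_ /(_ x)[e0 e1] _] := hT2.
  by rewrite /side_height /side_rel /=; case: (d); rewrite hx2 hh2 ?e0 ?e1.
rewrite /F -/(in_level S v d h x); case: ifP => hin; last by rewrite cats0.
have vx : ar v x by case/and4P: hin.
case E: (ar v x) vx => [e|] // _; rewrite cats1; split.
  exact: (run_side_body h hS2 hx2 E).
by rewrite run_frame //; case: (d).
Qed.

Lemma flatten_if (T : Type) (c : pred T) s :
  flatten (map (fun x => if c x then [:: x] else [::]) s) = filter c s.
Proof. by elim: s => //= x s ->; case: (c x). Qed.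

Lemma height_lt d x : height (side_rel d) x < n.
Proof.
have refl : side_rel d x x by rewrite /side_rel /Rop; case: (d); apply: connect0.
apply: (@leq_ltn_trans (\sum_(y < n) (y != x))).
  by apply: leq_sum => y _; case: eqP => [->|]; rewrite ?refl // leq_b1.
rewrite (bigD1 x) //= eqxx add0n -[X in _ < X]card_ord (cardD1 x) inE add1n ltnS.
rewrite -sum1_card; apply: eq_leq; apply: eq_big => y; first by rewrite !inE andbT.
by move=> ->.
Qed.

Lemma side_rel_trans d : transitive (side_rel d).
Proof.
by rewrite /side_rel /Rop; case: d => y x z; [move=> h1 h2; apply: connect_trans h2 h1
  | apply: connect_trans].
Qed.

Lemma height_le d x y : side_rel d x y || side_rel d y x ->
  height (side_rel d) x <= height (side_rel d) y -> side_rel d x y.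
Proof.
case/orP=> // yx; apply: contraTT => nxy; rewrite -ltnNge.
rewrite /height (bigD1 y) //= [X in _ < X](bigD1 y) //= nxy.
have -> : side_rel d y y by rewrite /side_rel /Rop; case: (d); apply: connect0.
rewrite add0n add1n ltnS; apply: leq_sum => z _.
by case: (boolP (side_rel d x z)) => [xz|]; rewrite ?leq_b1 // (side_rel_trans yx xz).
Qed.

Lemma side_listP (S : {set 'I_n}) v d : simplicial (underlying D) S v ->
  sidelist ar (side_rel d) S v (side_list (S :\ v) v d).
Proof.
move=> hs; have [ar_joins ar_neq ar_adj ar_sym] := arP.
have hadj := adjE ar_joins ar_neq ar_adj.
set S' := S :\ v.
have E : side_list S' v d = flatten (map (fun h => filter (in_level S' v d h) (enum 'I_n))
   (enum 'I_n)).
  by congr flatten; apply: eq_map => h; rewrite flatten_if.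
have mem hs' b : (b \in flatten (map (fun h => filter (in_level S' v d h) (enum 'I_n)) hs'))
    = has (fun h => in_level S' v d h b) hs'.
  elim: hs' => //= h hs' IH; rewrite mem_cat IH mem_filter mem_enum andbT //.
split.
- rewrite E; suff : forall hs', uniq hs' -> uniq (flatten
      (map (fun h => filter (in_level S' v d h) (enum 'I_n)) hs')).
    by apply; apply: enum_uniq.
  elim=> //= h hs' IH /andP[nh uh].
  rewrite cat_uniq filter_uniq ?enum_uniq //= IH // andbT.
  apply/hasPn => b; rewrite mem => /hasP[h' hh' /and4P[_ _ _ /eqP e']].
  rewrite mem_filter negb_and /in_level e'; apply/orP; left.
  apply: contra nh => /and4P[_ _ _ /eqP/val_inj <-]; exact: hh'.
- have tot x y : x \in S' -> y \in S' -> ar v x -> ar v y ->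
      height (side_rel d) x <= height (side_rel d) y -> side_rel d x y.
    move=> xS yS vx vy; apply: height_le.
    case: (x =P y) => [->|/eqP xy].
      by rewrite /side_rel /Rop; case: (d); rewrite connect0.
    have : underlying D x y.
      move: xS yS; rewrite !in_setD1 => /andP[_ xS] /andP[_ yS].
      by apply: hs; rewrite ?hadj.
    by case/adj_R=> h; rewrite /side_rel /Rop; case: (d); rewrite h ?orbT.
  rewrite E; have : pairwise (fun h h' : 'I_n => h < h') (enum 'I_n).
    rewrite -(pairwise_map val ltn) val_enum_ord.
    by rewrite -sorted_pairwise ?iota_ltn_sorted //; exact: ltn_trans.
  elim: {1 3}(enum 'I_n) => //= h hs' IH /andP[hh ph].
  rewrite pairwise_cat IH // andbT; apply/andP; split.
    apply/allrelP => x y; rewrite mem_filter => /andP[/and4P[xS vx _ /eqP ex] _].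
    rewrite mem => /hasP[h' h'in /and4P[yS vy _ /eqP ey]].
    by apply: tot => //; rewrite ex ey ltnW // (allP hh).
  have : all (in_level S' v d h) (filter (in_level S' v d h) (enum 'I_n)) by apply: filter_all.
  elim: (filter _ _) => //= x l IHl /andP[/and4P[xS vx _ /eqP ex] hl].
  rewrite IHl // andbT; apply/allP => y yl.
  have /and4P[yS vy _ /eqP ey] := allP hl y yl.
  by apply: tot => //; rewrite ex ey.
move=> b; rewrite E mem; apply/hasP/and3P => [[h _ /and4P[h1 h2 h3 _]]|[h1 h2 h3]].
  by split.
exists (Ordinal (height_lt d b)); first by rewrite mem_enum.
by rewrite /in_level h1 h2 h3 /=.
Qed.

Lemma size_side_list S v d : size (side_list S v d) <= n * n.
Proof.
have hf (T : Type) (F : 'I_n -> seq T) c : (forall x, size (F x) <= c) ->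
    size (flatten (map F (enum 'I_n))) <= n * c.
  move=> hF; have -> : n * c = size (enum 'I_n) * c by rewrite size_enum_ord.
  elim: (enum 'I_n) => //= x l IH; rewrite size_cat mulSn; exact: leq_add.
apply: (hf _ _ n) => a; rewrite -[X in _ <= X]muln1; apply: (hf _ _ 1) => b.
by case: ifP.
Qed.

End Sides.

Definition process : prog :=
  PWrite tD (cell sV) (Const 1) ;; set sAcc (Const 0) ;; pair_ops ;;
  side false ;; push_clear ;; side true ;; push_clear ;;
  When (And (Not (And (posT (cell sB0)) (posT (cell sB1))))
            (Leq (Plus (cell lk) (Const 2)) (cell aN)))
    (When (Lt (cell sAcc) (cell sTau)) (set sTau (cell sAcc))).

Definition eliminate : prog := PFor lk aN (choose_vertex ;; process).

Definition forward : prog :=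
  tables ;; warshall ;; heights ;; edges ;; sum_weights ;; merge_parallel ;; eliminate.

Section Loop.
Variables (n m : nat) (D : digraph 'I_n 'I_m) (w : 'I_m -> nat).
Variable B : nat -> nat.
Hypotheses (Bn : B 0 = n) (Bm : B 1 = m).
Notation R := (connect (arc_rel D)).

Section Fixed.
Variable ar : 'I_n -> 'I_n -> option 'I_m.
Hypothesis arP : represents D ar.
Notation TabS := (Tab D B ar).
Notation CtxS := (Ctx D B ar).

Lemma run_process (S : {set 'I_n}) (v : 'I_n) W l acc tau k s :
  TabS s -> Alive S s -> s sV 0%R = Posz v -> v \in S ->
  State W l acc s -> s sTau 0%R = Posz tau -> s lk 0%R = Posz k -> #|S| + k = n ->
  let ts := triangles D ar (S :\ v) v in
  let bs0 := side_list D ar (S :\ v) v false in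
  let bs1 := side_list D ar (S :\ v) v true in
  let ops := step_ops ar v ts bs0 bs1 in
  let s' := run B process s in
  [/\ TabS s', Alive (S :\ v) s',
      State (wfin W ops) (l ++ ents W ops) (csum (ents W ops)) s'
    & s' sTau 0%R = Posz (step_tau ar S v ts bs0 bs1 tau W)].
Proof.
move=> hT hA hV vS hS htau hk hcard ts bs0 bs1 ops s'; rewrite /s' /process 2!run_seq.
set s1 := run B (PWrite 21 _ _) s; set s2 := run B (set 32 _) s1.
have A1 : Alive (S :\ v) s1.
  move=> x; rewrite /s1; heap; rewrite hV eqz_nat val_eqE in_setD1.
  by case: eqP => //= _; rewrite hA.
have C2 : CtxS (S :\ v) v s2.
  by apply: frame_Ctx => //; split=> //.
have S2 : State W l 0 s2.
  by case: hS => h1 h2 h3; split=> //; rewrite /s2 read_set.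
have [t2 k2] : s2 sTau 0%R = Posz tau /\ s2 lk 0%R = Posz k.
  by rewrite /s2 /s1; split; heap.
clearbody s2; rewrite run_seq; set s3 := run B pair_ops s2.
have [C3 O3] : CtxS (S :\ v) v s3 /\ OpState W l 0 (isolate ts) s3.
  exact: run_pair_ops.
have [t3 k3] : s3 sTau 0%R = Posz tau /\ s3 lk 0%R = Posz k.
  by rewrite /s3 !run_frame.
clearbody s3; rewrite run_seq; set s4 := run B (side false) s3.
have [C4 O4 H4] := run_side Bn false C3 O3; rewrite -/s4 -/bs0 in C4 O4 H4.
have [t4 k4] : s4 sTau 0%R = Posz tau /\ s4 lk 0%R = Posz k.
  by rewrite /s4 !run_frame.
clearbody s4; rewrite run_seq; set s5 := run B push_clear s4.
have C5 : CtxS (S :\ v) v s5 by apply: frame_Ctx.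
have O5 := run_clear_op B O4; rewrite -/s5 in O5.
have [t5 k5 H5] : [/\ s5 sTau 0%R = Posz tau, s5 lk 0%R = Posz k &
    s5 sB0 0%R = Posz (head_code bs0)] by rewrite /s5 !run_frame.
clearbody s5; rewrite run_seq; set s6 := run B (side true) s5.
have [C6 O6 H6] := run_side Bn true C5 O5; rewrite -/s6 -/bs1 in C6 O6 H6.
have [t6 k6 H6'] : [/\ s6 sTau 0%R = Posz tau, s6 lk 0%R = Posz k &
    s6 sB0 0%R = Posz (head_code bs0)] by rewrite /s6 !run_frame.
clearbody s6; rewrite run_seq; set s7 := run B push_clear s6.
have C7 : CtxS (S :\ v) v s7 by apply: frame_Ctx.
have O7 := run_clear_op B O6; rewrite -/s7 in O7.
have [t7 k7 H7 H7'] : [/\ s7 sTau 0%R = Posz tau, s7 lk 0%R = Posz k,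
    s7 sB0 0%R = Posz (head_code bs0) & s7 sB1 0%R = Posz (head_code bs1)].
  by rewrite /s7 !run_frame.
clearbody s7.
have eops : rcons (rcons (isolate ts ++ sideops ar v (head v bs0) bs0) None ++
    sideops ar v (head v bs1) bs1) None = ops.
  by rewrite /ops /step_ops -!cats1 -!catA.
rewrite eops /OpState add0n in O7; have [T7 A7 V7] := C7.
have [_ _ acc7] := O7.
have n7 : s7 0%N 0%R = Posz n by have [[[]]] := T7.
have -> : step_tau ar S v ts bs0 bs1 tau W =
    if [&& ~~ ((0 < head_code bs0) && (0 < head_code bs1)), k + 2 <= n
       & csum (ents W ops) < tau] then csum (ents W ops) else tau.
  rewrite /step_tau; have -> : (S :\ v != set0) = (k + 2 <= n).
    rewrite -card_gt0; move: hcard; rewrite (cardsD1 v S) vS add1n.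
    by move: #|_ :\ _| => c hc; apply/idP/idP; lia.
  have e0 (bs : seq 'I_n) : (0 < head_code bs) = (bs != [::]) by case: bs.
  rewrite !e0 negb_and !negbK -/ops minnC /minn.
  by case: ((bs0 == [::]) || (bs1 == [::])); case: (k + 2 <= n).
set cond := (X in if X then _ else _).
have -> : run B (When (And (Not (And (posT (cell sB0)) (posT (cell sB1))))
            (Leq (Plus (cell lk) (Const 2)) (cell aN)))
    (When (Lt (cell sAcc) (cell sTau)) (set sTau (cell sAcc)))) s7 =
    if cond then run B (set sTau (cell sAcc)) s7 else s7.
  have -> : cond = holds s7 (And (Not (And (posT (cell sB0)) (posT (cell sB1))))
            (Leq (Plus (cell lk) (Const 2)) (cell aN))) &&
            holds s7 (Lt (cell sAcc) (cell sTau)).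
    rewrite holds_Lt /= acc7 t7 H7 H7' k7 n7 ltz_nat /cond.
    by rewrite -PoszD !lez_nat andbA.
  by rewrite run_when; case: (holds s7 (And _ _)) => //=; rewrite run_when; case: (holds _ _).
case: cond; last by split.
split; last by rewrite read_set /= acc7.
- exact: frame_Tab.
- by rewrite /Alive run_frame.
exact: frame_State.
Qed.

Lemma size_isolate (ts : seq (('I_m * 'I_m * 'I_m))) :
  size (isolate ts) = 2 * size ts.
Proof. by rewrite /isolate; elim: ts => //= t ts ->; rewrite mulnS. Qed.

Lemma size_sideops v b bs : size (sideops ar v b bs) <= size bs.
Proof.
rewrite /sideops; elim: bs => //= x bs IH; rewrite size_cat -add1n; apply: leq_add => //.
by rewrite /sideop; case: (ar v x).
Qed.

Lemma size_step_ops S v : size (step_ops ar v (triangles D ar S v)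
  (side_list D ar S v false) (side_list D ar S v true)) <= 4 * (n * n) + 2.
Proof.
rewrite /step_ops !size_cat /= size_cat /= size_isolate.
have h2 := size_triangles D ar S v.
have h0 := leq_trans (size_sideops v (head v (side_list D ar S v false))
  (side_list D ar S v false)) (size_side_list D ar S v false).
have h1 := leq_trans (size_sideops v (head v (side_list D ar S v true))
  (side_list D ar S v true)) (size_side_list D ar S v true).
have aux a b c N : a <= N -> b <= N -> c <= N -> 2 * c + (a + (b + 1).+1) <= 4 * N + 2.
  by clear; lia.
exact: aux h0 h1 h2.
Qed.

Lemma run_eliminate W l acc tau s : chordal (underlying D) ->
  TabS s -> (forall x, s tD x = 0%R) -> State W l acc s -> s sTau 0%R = Posz tau ->
  forward_inv D ar w setT W l tau -> size l <= 2 * m ->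
  let s' := run B eliminate s in
  exists W' l' acc' tau', [/\ TabS s', State W' l' acc' s', s' sTau 0%R = Posz tau',
    forward_inv D ar w set0 W' l' tau' & size l' <= 2 * m + n * (4 * (n * n) + 2)].
Proof.
move=> hch hT hD hS htau hF hl s'; have [ar_joins ar_neq ar_adj ar_sym] := arP.
pose I k (s : memory) := exists S W' l' acc' tau',
  [/\ TabS s /\ Alive S s, #|S| + k = n, State W' l' acc' s, s sTau 0%R = Posz tau'
    & forward_inv D ar w S W' l' tau' /\ size l' <= 2 * m + k * (4 * (n * n) + 2)].
suff [S [W' [l' [acc' [tau' [[h1 _] h2 h3 h4 [h5 h6]]]]]]] : I (B 0) s'.
  exists W', l', acc', tau'; rewrite Bn in h2 h6; split=> //.
  have /eqP : #|S| = 0 by lia.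
  by rewrite cards_eq0 => /eqP eS; rewrite -eS.
apply: run_for => //.
  exists setT, W, l, acc, tau; rewrite cardsT card_ord mul0n !addn0; split=> //.
  by split=> // x; rewrite hD inE.
move=> k s1 hk [S [W1 [l1 [acc1 [tau1 [[h1 h1'] h2 h3 h4 [h5 h6]]]]]]] hx.
rewrite Bn in hk; rewrite run_seq; set s2 := run B choose_vertex s1.
have [x0 x0S] : exists x, x \in S by apply/card_gt0P; lia.
have adjC := adj_sym ar_joins ar_neq ar_adj ar_sym.
have [z zS hz] := exists_simplicial adjC (@adj_irr _ _ D) hch x0S.
have [|v [/(eliminableP arP)[vS hv] eV]] := run_choose_vertex Bn h1 h1'.
  by exists z; apply/(eliminableP arP).
rewrite -/s2 in eV.
have T2 : TabS s2 by apply: frame_Tab.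
have A2 : Alive S s2 by rewrite /s2 /Alive run_frame.
have S2 : State W1 l1 acc1 s2 by apply: frame_State.
have t2 : s2 sTau 0%R = Posz tau1 by rewrite /s2 run_frame.
have k2 : s2 lk 0%R = Posz k by rewrite /s2 run_frame.
clearbody s2.
have [p1 p2 p3 p4] := run_process T2 A2 eV vS S2 t2 k2 h2.
exists (S :\ v); eexists; eexists; eexists; eexists; split; [ | | exact: p3 | exact: p4 | ].
- by split.
- by have := h2; rewrite (cardsD1 v S) vS add1n addSnnS.
split.
  apply: forward_step => //.
  - exact: triangles_mem.
  - exact: (side_listP arP false hv).
  - exact: (side_listP arP true hv).
rewrite size_cat size_ents mulSn [X in _ <= X]addnCA [X in _ <= X]addnC.
by apply: leq_add => //; apply: size_step_ops.
Qed.

End Fixed.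

Lemma parallel_mem ar (ars : represents D ar) g e f :
  (g, e, f) \in flatten (map (parallel D ar) (enum 'I_m)) <->
  [/\ f = e, g != e & ar (arc_tail D e) (arc_head D e) = Some g].
Proof.
split=> [/flattenP[_ /mapP[e' _ ->]]|[-> ne eg]].
  rewrite /parallel; case E: (ar _ _) => [g'|] //; case: ifP => // ne.
  by rewrite inE => /eqP[-> -> ->].
apply/flattenP; exists (parallel D ar e); first by apply/mapP; exists e; rewrite ?mem_enum.
by rewrite /parallel eg ne mem_head.
Qed.

Lemma run_forward s : chordal (underlying D) ->
  (exists U, dicutin D setT U) ->
  s aN 0%R = Posz n -> s aM 0%R = Posz m ->
  (forall e : 'I_m, s aT (Posz e) = Posz (arc_tail D e)) ->
  (forall e : 'I_m, s aH (Posz e) = Posz (arc_head D e)) ->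
  (forall e : 'I_m, s aW (Posz e) = Posz (w e)) ->
  (forall a, 14 <= a -> a != 40 -> forall i, s a i = 0%R) ->
  let s' := run B forward s in
  exists ar W l acc tau, [/\ Tab D B ar s', State W l acc s', s' sTau 0%R = Posz tau,
    forward_inv D ar w set0 W l tau & size l <= 2 * m + n * (4 * (n * n) + 2)].
Proof.
move=> hch [U0 dU0] hN hM hT hH hW hz s'; rewrite /s' /forward.
rewrite run_seq; set s1 := run B tables s.
have B1 : Base D B s1 by apply: run_tables => //; apply: hz.
rewrite run_seq; set s2 := run B warshall s1.
have M2 : MatB D B s2 tR R.
  by apply: run_warshall => // i; rewrite /s1 run_frame // hz.
rewrite run_seq; set s3 := run B heights s2.
have [M3 H3] := run_heights Bn M2; rewrite -/s3 in M3 H3.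
rewrite run_seq; set s4 := run B edges s3.
have [|ar [arP M4 H4 E4]] := run_edges Bm M3 H3.
  by move=> i; rewrite /s3 /s2 /s1 !run_frame // hz.
rewrite -/s4 in M4 H4 E4.
have T4 : Tab D B ar s4 by split.
have W4 (e : 'I_m) : s4 aW (Posz e) = Posz (w e).
  by rewrite /s4 /s3 /s2 /s1 !run_frame.
have Z4 a i : 14 <= a -> a != 40 ->
    all (fun p => a \notin writes p) [:: tables; warshall; heights; edges] -> s4 a i = 0%R.
  move=> h1 h2 /and5P[w1 w2 w3 w4 _].
  by rewrite /s4 /s3 /s2 /s1 !run_frame // hz.
clearbody s4; rewrite run_seq; set s5 := run B sum_weights s4.
have T5 : Tab D B ar s5 by apply: frame_Tab.
have t5 : s5 sTau 0%R = Posz (\sum_e w e) by apply: run_sum_weights; rewrite ?Z4.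
have S5 : State w [::] 0 s5.
  apply: frame_State => //; split=> //; last by rewrite Z4.
  by split=> //; rewrite Z4.
have D5 x : s5 tD x = 0%R by rewrite /s5 run_frame // Z4.
clearbody s5; rewrite run_seq; set s6 := run B merge_parallel s5.
have [T6 O6] := run_merge_parallel Bm arP T5 S5; rewrite -/s6 in T6 O6.
have t6 : s6 sTau 0%R = Posz (\sum_e w e) by rewrite /s6 run_frame.
have D6 x : s6 tD x = 0%R by rewrite /s6 run_frame.
clearbody s6.
have [ar_joins ar_neq ar_adj ar_sym] := arP.
have hF := forward_init ar_joins ar_adj ar_sym w (parallel_mem arP) dU0.
have [|W' [l' [acc' [tau' h]]]] := run_eliminate arP hch T6 D6 O6 t6 hF.
  rewrite size_ents size_isolate leq_mul2l /=.
  apply: (@leq_trans (size (enum 'I_m))); last by rewrite size_enum_ord.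
  elim: (enum 'I_m) => //= e s0 IH.
  rewrite size_cat -add1n; apply: leq_add => //; rewrite /parallel.
  by case: (ar _ _) => // g; case: ifP.
by exists ar, W', l', acc', tau'.
Qed.

End Loop.

Definition split_piece : prog :=
  PFor ly aM (PWrite fJ (at2 tM (cell fN) (cell ly)) (Read fJ (at2 tM (cell lx) (cell ly)))) ;;
  PWrite fL (cell fN) (Minus (Read fL (cell lx)) (cell sRem)) ;;
  PWrite fF (cell fN) (Read fF (cell lx)) ;;
  PWrite fL (cell lx) (cell sRem) ;;
  set fN (Plus (cell fN) (Const 1)).

Definition exchange_piece : prog :=
  set sRem (Minus (cell sRem) (Read fL (cell lx))) ;;
  PWrite fF (cell lx) (Const 1) ;;
  PWrite fJ (at2 tM (cell lx) (cell sG)) (Const 0) ;;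
  PWrite fJ (at2 tM (cell lx) (cell sE)) (Const 1) ;;
  PWrite fJ (at2 tM (cell lx) (cell sF)) (Const 1).

Definition transfer_test (d : bool) : test :=
  if d then And (posT (Read fJ (at2 tM (cell lx) (cell sG)))) (zeroT (Read fF (cell lx)))
  else zeroT (Read fF (cell lx)).

Definition transfer_prog (d : bool) : prog :=
  PFor lx bP (When (And (Lt (cell lx) (cell fN)) (And (transfer_test d) (posT (cell sRem))))
    (When (Lt (cell sRem) (Read fL (cell lx))) split_piece ;; exchange_piece)).

Definition unmark_prog : prog :=
  PFor lx bP (When (And (Lt (cell lx) (cell fN)) (posT (Read fF (cell lx))))
    (PWrite fJ (at2 tM (cell lx) (cell sG)) (Const 0))).

Definition clear_prog : prog :=
  PFor lx bP (When (Lt (cell lx) (cell fN)) (PWrite fF (cell lx) (Const 0))).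

Definition undo_prog : prog :=
  PFor lk bP (When (Lt (cell lk) (cell vK)) (
    set sQ (Minus (Minus (cell vK) (Const 1)) (cell lk)) ;;
    PIf (posT (Read gCl (cell sQ))) clear_prog
      (set sG (Read gG (cell sQ)) ;; set sE (Read gE (cell sQ)) ;;
       set sF (Read gF (cell sQ)) ;; set sRem (Read gC (cell sQ)) ;;
       unmark_prog ;; transfer_prog true ;; transfer_prog false))).

Lemma sub_index (K k : nat) : k < K -> (Posz K - 1 - Posz k)%R = Posz (K - k.+1).
Proof. lia. Qed.

Section Undo.
Variable m : nat.
Variable B : nat -> nat.
Hypothesis Bm : B 1 = m.
Notation piece := (piece 'I_m).
Notation no_piece := (no_piece 'I_m).

Definition Rows (s : memory) : Prop :=
  s aM 0%R = Posz m /\ forall i, i <= B bP -> s tM (Posz i) = Posz (i * m).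

Definition piece_at (s : memory) (i : nat) (u : piece) : Prop :=
  [/\ s fL (Posz i) = Posz u.2, s fF (Posz i) = Posz u.1.2
    & forall e : 'I_m, s fJ (Posz (i * m + e)) = Posz (e \in u.1.1)].

Definition Pieces (N : nat) (u : nat -> piece) (s : memory) : Prop :=
  s fN 0%R = Posz N /\ forall i, i < N -> piece_at s i (u i).

Definition Fam (l : seq piece) : memory -> Prop := Pieces (size l) (nth no_piece l).

Definition Regs (g e f : 'I_m) (s : memory) : Prop :=
  [/\ s sG 0%R = Posz g, s sE 0%R = Posz e & s sF 0%R = Posz f].

Lemma Pieces_ext N u u' s : (forall i, i < N -> u i = u' i) ->
  Pieces N u s -> Pieces N u' s.
Proof. by move=> h [h1 h2]; split=> // i hi; rewrite -h //; apply: h2. Qed.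

Lemma frame_Rows p s : all (fun a => a \notin writes p) [:: 1; 15] -> Rows s -> Rows (run B p s).
Proof.
move=> h; have {}h a : a \in [:: 1; 15] ->
    run B p s a = s a by move=> ha; apply/run_frame/(allP h).
by rewrite /Rows !h.
Qed.

Lemma frame_Regs g e f p s : all (fun a => a \notin writes p) [:: 28; 29; 30] ->
  Regs g e f s -> Regs g e f (run B p s).
Proof.
move=> h; have {}h a : a \in [:: 28; 29; 30] ->
    run B p s a = s a by move=> ha; apply/run_frame/(allP h).
by rewrite /Regs !h.
Qed.

Lemma frame_Pieces N u p s : all (fun a => a \notin writes p) [:: 50; 51; 52; 53] ->
  Pieces N u s -> Pieces N u (run B p s).
Proof.
move=> h; have {}h a : a \in [:: 50; 51; 52; 53] ->
    run B p s a = s a by move=> ha; apply/run_frame/(allP h).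
by rewrite /Pieces /piece_at !h.
Qed.

Lemma run_exchange_piece N u g e f s i r : Rows s -> Pieces N u s -> Regs g e f s ->
  s lx 0%R = Posz i -> i < N -> i <= B bP -> s sRem 0%R = Posz r -> (u i).2 <= r ->
  Pieces N (fun j => if j == i then (exchange g e f (u i).1.1, true, (u i).2) else u j)
    (run B exchange_piece s) /\
  run B exchange_piece s sRem 0%R = Posz (r - (u i).2).
Proof.
move=> [hm hM] [hN hu] [hg he hf] hx hi hiP hr hle.
have [h1 h2 h3] := hu i hi; rewrite /exchange_piece !run_seq.
split; last by heap; rewrite hr hx h1 subzn.
split=> [|j hj]; first by heap.
have [g1 g2 g3] := hu j hj; split=> [||x].
- by heap; rewrite g1; case: (j =P i) => [->|].
- by heap; rewrite hx eqz_nat g2; case: (j =P i).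
heap; rewrite hx hg he hf hM // -!PoszD !eqz_nat !idx_eq g3.
case: (j =P i) => [->|_] //=; rewrite in_exchange.
by case: (x == f); case: (x == e); case: (x == g); rewrite ?andbF ?andbT.
Qed.

Lemma run_split_piece N u s i r : Rows s -> Pieces N u s ->
  s lx 0%R = Posz i -> i < N -> N <= B bP -> s sRem 0%R = Posz r -> r < (u i).2 ->
  Pieces N.+1 (fun j => if j == i then ((u i).1, r) else
     if j == N then ((u i).1, (u i).2 - r) else u j) (run B split_piece s).
Proof.
move=> [hm hM] [hN hu] hx hi hNP hr hlt; rewrite /split_piece run_seq.
set s1 := run B (PFor _ _ _) s.
pose I k (s : memory) := [/\ Rows s, s fN 0%R = Posz N, s lx 0%R = Posz i,
  s sRem 0%R = Posz r & forall j, j < N -> piece_at s j (u j)] /\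
  forall e : 'I_m, e < k -> s fJ (Posz (N * m + e)) = Posz (e \in (u i).1.1).
have [[R1 N1 x1 r1 u1] c1] : I (B 1) s1.
  apply: run_for => //.
  move=> k s2 hk [[R2 N2 x2 r2 u2] c2] hy; rewrite Bm in hk; pose e := Ordinal hk.
  have [_ hM2] := R2; have [_ _ hJi] := u2 i hi.
  have iP : i <= B bP by apply: leq_trans hNP; apply: ltnW.
  have ev : eval s2 (at2 15 (cell 50) (cell 41)) = Posz (N * m + e).
    by rewrite /= N2 hy hM2.
  have ev2 : eval s2 (Read 52 (at2 15 (cell 40) (cell 41))) = Posz (e \in (u i).1.1).
    by rewrite /= x2 hy hM2 // -hJi.
  split; first split; try by rewrite run_frame.
  - exact: frame_Rows.
  - move=> j hj; have [p1 p2 p3] := u2 j hj.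
    split; try by rewrite run_frame.
    by move=> x; rewrite readW_eq ev eqz_nat idx_eq (ltn_eqF hj) p3.
  move=> x hx'; rewrite readW_eq ev eqz_nat idx_eq eqxx andTb ev2.
  case: (x =P e) => [->|ne] //; apply: c2.
  rewrite ltn_neqAle -ltnS hx' andbT; apply/eqP => xk; apply: ne; exact: val_inj.
have {}c1 (e : 'I_m) : s1 fJ (Posz (N * m + e)) = Posz (e \in (u i).1.1).
  by apply: c1; rewrite Bm.
clearbody s1; rewrite !run_seq; have [q1 q2 q3] := u1 i hi.
split=> [|j]; first by heap; rewrite N1 -PoszD addn1.
have Ni : (N == i) = false by rewrite eq_sym ltn_eqF.
rewrite ltnS leq_eqVlt => /orP[/eqP ->|hj].
  rewrite Ni eqxx; split=> [||x].
  - by heap; rewrite x1 N1 r1 q1 eqz_nat Ni eqxx subzn // ltnW.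
  - by heap; rewrite x1 N1 eqxx q2.
  by heap; rewrite c1.
have [p1 p2 p3] := u1 j hj; rewrite (ltn_eqF hj); case: (j =P i) => [ji|/eqP ji].
  rewrite ji in p1 p2 p3 *; split=> [||x].
  - by heap; rewrite x1 r1 eqxx.
  - by heap; rewrite N1 eqz_nat (ltn_eqF hi).
  by heap.
split=> [||x].
- by heap; rewrite x1 N1 r1 !eqz_nat (negbTE ji) (ltn_eqF hj).
- by heap; rewrite N1 eqz_nat (ltn_eqF hj).
by heap.
Qed.

Definition selects (d : bool) (g : 'I_m) : {set 'I_m} -> bool -> bool :=
  if d then (fun J b => (g \in J) && ~~ b) else (fun _ b => ~~ b).

Lemma run_transfer_step d g e f l r i s : Rows s -> Fam l s -> Regs g e f s ->
  s sRem 0%R = Posz r -> s lx 0%R = Posz i -> i < B bP -> size l + (0 < r) <= B bP ->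
  let st := transfer1 (selects d g) g e f (r, l) i in
  let s' := run B (When (And (Lt (cell lx) (cell fN)) (And (transfer_test d) (posT (cell sRem))))
    (When (Lt (cell sRem) (Read fL (cell lx))) split_piece ;; exchange_piece)) s in
  Fam st.2 s' /\ s' sRem 0%R = Posz st.1.
Proof.
move=> hR hF hG hr hx hi hsz /=; rewrite run_when.
have [hN hu] := hF; have [_ hM] := hR; have [hg _ _] := hG.
case E: (nth no_piece l i) => [[J b] k].
have -> : holds s (And (Lt (cell 40) (cell 50)) (And (transfer_test d) (posT (cell 54)))) =
    [&& i < size l, selects d g J b & 0 < r].
  rewrite /transfer_test /selects; case: (ltnP i (size l)) => il; last first.
    by rewrite /= hx hN lez_nat il.
  have [p1 p2 p3] := hu i il; rewrite E /= in p1 p2 p3.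
  have hl : holds s (Lt (cell 40) (cell 50)) by rewrite holds_Lt /= hx hN ltz_nat.
  have hb : holds s (zeroT (Read 53 (cell 40))) = ~~ b.
    by rewrite holds_Eq /= hx p2; case: (b).
  have hr0 : holds s (posT (cell 54)) = (0 < r) by rewrite (holds_pos (k := r)).
  have hj : holds s (posT (Read 52 (at2 15 (cell 40) (cell 28)))) = (g \in J).
    rewrite (holds_pos (k := g \in J)) ?lt0b //= hx hg hM; last exact: ltnW.
    by rewrite -p3.
  rewrite holds_And hl holds_And hr0; case: (d); last by rewrite hb.
  by rewrite holds_And hj hb.
case: ifP => [/and3P[il sel r0]|_] //; rewrite run_seq run_when.
have [p1 p2 p3] := hu i il; rewrite E /= in p1 p2 p3.
have -> : holds s (Lt (cell 54) (Read 51 (cell 40))) = (r < k).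
  by rewrite holds_Lt /= hx hr p1 ltz_nat.
rewrite ltnNge; case: (leqP k r) => hk /=.
  have := @run_exchange_piece _ _ g e f s i r hR hF hG hx il (ltnW hi) hr.
  rewrite E /= => /(_ hk)[h1 h2]; split=> //.
  rewrite /Fam size_set_nth (maxn_idPr il); apply: Pieces_ext h1 => j hj.
  by rewrite nth_set_nth.
rewrite r0 addn1 in hsz; set s1 := run B split_piece s.
have F1 := @run_split_piece _ _ s i r hR hF hx il (ltnW hsz) hr; rewrite E /= in F1.
have {}F1 := F1 hk.
have R1 : Rows s1 by apply: frame_Rows.
have G1 : Regs g e f s1 by apply: frame_Regs.
have x1 : s1 lx 0%R = Posz i by rewrite /s1 run_frame.
have r1 : s1 sRem 0%R = Posz r by rewrite /s1 run_frame.
have := run_exchange_piece R1 F1 G1 x1 (ltnW il) (ltnW hi) r1.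
rewrite eqxx /= subnn => /(_ (leqnn r))[h1 h2]; split=> //.
rewrite /Fam size_rcons size_set_nth (maxn_idPr il); apply: Pieces_ext h1 => j hj.
rewrite nth_rcons size_set_nth (maxn_idPr il) nth_set_nth /=.
case: (j =P i) => [->|ne]; first by rewrite il.
move: hj; rewrite ltnS leq_eqVlt => /orP[/eqP ->|hj]; last by rewrite hj (ltn_eqF hj).
by rewrite ltnn eqxx.
Qed.

Lemma run_transfer d g e f l r s : Rows s -> Fam l s -> Regs g e f s ->
  s sRem 0%R = Posz r -> size l + (0 < r) <= B bP ->
  let st := transfer (selects d g) g e f (B bP) (r, l) in
  let s' := run B (transfer_prog d) s in
  Fam st.2 s' /\ s' sRem 0%R = Posz st.1.
Proof.
move=> hR hF hG hr hsz st s'.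
pose I k (s : memory) := let st := transfer (selects d g) g e f k (r, l) in
  [/\ Rows s, Regs g e f s, Fam st.2 s & s sRem 0%R = Posz st.1].
suff [] : I (B bP) s' by [].
apply: run_for => // k s1 hk [R1 G1 F1 r1] x1.
have [z1 _] := transfer_size (selects d g) g e f k (r, l).
have h := run_transfer_step d R1 F1 G1 r1 x1 hk (leq_trans z1 hsz).
rewrite /I /=; have -> : transfer (selects d g) g e f k.+1 (r, l) =
   transfer1 (selects d g) g e f (transfer (selects d g) g e f k (r, l)) k.
  by rewrite /transfer -[k.+1]addn1 iotaD foldl_cat.
move: h; rewrite -surjective_pairing => -[h1 h2].
split=> //; first by apply: frame_Rows => //; case: (d).
by apply: frame_Regs => //; case: (d).
Qed.

Lemma run_unmark g e f l s : Rows s -> Fam l s -> Regs g e f s -> size l <= B bP ->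
  Fam (map (unmark_without g) l) (run B unmark_prog s).
Proof.
move=> hR hF hG hsz.
pose I k (s : memory) := [/\ Rows s, Regs g e f s & Pieces (size l)
  (fun i => if i < k then unmark_without g (nth no_piece l i) else nth no_piece l i) s].
suff [_ _ h] : I (B bP) (run B unmark_prog s).
  rewrite /Fam size_map; apply: Pieces_ext h => i hi.
  by rewrite (leq_trans hi hsz) (nth_map no_piece).
apply: run_for => // k s1 hk [R1 G1 P1] x1; have [hN hu] := P1.
have [_ hM] := R1; have [hg _ _] := G1.
rewrite run_when holds_And holds_Lt.
have -> : (eval s1 (cell 40) < eval s1 (cell 50))%R = (k < size l).
  by rewrite /= x1 hN ltz_nat.
case: (ltnP k (size l)) => kl; last first.
  split=> //; apply: Pieces_ext P1 => i hi.
  by rewrite ltnS (leq_trans (ltnW hi) kl) (leq_trans hi kl).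
have [p1 p2 p3] := hu k kl; rewrite ltnn in p1 p2 p3.
case E: (nth no_piece l k) => [[J b] c]; rewrite E /= in p1 p2 p3.
have lek j : (j < k.+1) = (j == k) || (j < k) by rewrite ltnS leq_eqVlt.
rewrite (holds_pos (k := b)) /= ?x1 ?p2 // lt0b; case: b E p2 => E p2; last first.
  split=> //; apply: Pieces_ext P1 => i hi; rewrite lek.
  by case: (i =P k) => [->|] //=; rewrite ltnn E.
split; [exact: frame_Rows | exact: frame_Regs |].
split=> [|j hj]; first by heap.
have [q1 q2 q3] := hu j hj; rewrite lek; split=> [||x].
- by heap; rewrite q1; case: (j =P k) => [->|] //=; rewrite ltnn E.
- by heap; rewrite q2; case: (j =P k) => [->|] //=; rewrite ltnn E.
heap; rewrite x1 hg hM; last exact: ltnW.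
rewrite -PoszD eqz_nat idx_eq q3; case: (j =P k) => [->|] //=.
by rewrite ltnn E /= in_setD1; case: (x == g).
Qed.

Lemma run_clear l s : Fam l s -> size l <= B bP ->
  Fam (map (@clear _) l) (run B clear_prog s).
Proof.
move=> hF hsz.
pose I k (s : memory) := Pieces (size l)
  (fun i => if i < k then clear (nth no_piece l i) else nth no_piece l i) s.
suff h : I (B bP) (run B clear_prog s).
  rewrite /Fam size_map; apply: Pieces_ext h => i hi.
  by rewrite (leq_trans hi hsz) (nth_map no_piece).
apply: run_for => // k s1 hk P1 x1; have [hN hu] := P1.
have lek j : (j < k.+1) = (j == k) || (j < k) by rewrite ltnS leq_eqVlt.
rewrite run_when holds_Lt.
have -> : (eval s1 (cell 40) < eval s1 (cell 50))%R = (k < size l).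
  by rewrite /= x1 hN ltz_nat.
case: (ltnP k (size l)) => kl; last first.
  apply: Pieces_ext P1 => i hi.
  by rewrite ltnS (leq_trans (ltnW hi) kl) (leq_trans hi kl).
split=> [|j hj]; first by heap.
have [q1 q2 q3] := hu j hj; rewrite lek; split=> [||x].
- by heap; rewrite q1; case: (j =P k) => [->|] //=; rewrite ltnn.
- heap; rewrite x1 eqz_nat q2; case: (j =P k) => [->|] //=.
by heap; rewrite q3; case: (j =P k) => [->|] //=; rewrite ltnn.
Qed.

Lemma run_undo log l s : Rows s -> Log log s -> Fam l s ->
  size l + size log <= B bP -> Fam (undo_all (B bP) l log) (run B undo_prog s).
Proof.
move=> hR hL hF hsz.
pose I k (s : memory) := [/\ Rows s, Log log s &
  Fam (undo_all (B bP) l (drop (size log - k) log)) s].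
suff [_ _] : I (B bP) (run B undo_prog s).
  suff -> : size log - B bP = 0 by rewrite drop0.
  by apply/eqP; rewrite subn_eq0; apply: leq_trans hsz; apply: leq_addl.
apply: run_for => //; first by split=> //; rewrite subn0 drop_size.
move=> k s1 hk [R1 L1 F1] x1; have [hK hE] := L1.
rewrite run_when holds_Lt /= hK x1 ltz_nat.
case: (ltnP k (size log)) => kK; last first.
  split=> //; move: F1.
  have -> : size log - k = 0 by apply/eqP; rewrite subn_eq0.
  by have -> : size log - k.+1 = 0 by apply/eqP; rewrite subn_eq0 ltnW.
set q := size log - k.+1; have qK : q < size log by rewrite /q ltn_subrL (leq_ltn_trans _ kK).
have dq : drop q log = nth None log q :: drop (size log - k) log.
  by rewrite (drop_nth None qK) -(subnSK kK).
have zs := undo_all_size (B bP) (drop (size log - k) log) l.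
rewrite size_drop subKn in zs; last exact: ltnW.
rewrite /I -/q dq /undo_all [foldr _ _ _]/= -/(undo_all _ _ _); set l1 := undo_all _ _ _ in F1 zs *.
have z1 : size l1 + 1 <= B bP.
  apply: leq_trans hsz; case/andP: zs => _ zs.
  by apply: leq_trans (leq_add zs (leqnn 1)) _; rewrite -addnA leq_add2l addn1.
have z2 : size l1 <= B bP by apply: leq_trans z1; apply: leq_addr.
rewrite run_seq; set s2 := run B (set 55 _) s1.
have q2 : s2 sQ 0%R = Posz q.
  by rewrite /s2 read_set /= hK x1; apply: sub_index.
have R2 : Rows s2 by apply: frame_Rows.
have L2 : Log log s2 by rewrite /Log /entry_at /s2 !run_frame.
have F2 : Fam l1 s2 by apply: frame_Pieces.
clearbody s2; rewrite run_if; have [_ /(_ q qK)] := L2.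
case: (nth None log q) => [[[[g e] f] c]|]; last first.
  move=> hc; rewrite (holds_pos (k := 1)) /= ?q2 ?hc //; split.
  - exact: frame_Rows.
  - by rewrite /Log /entry_at !run_frame.
  exact: run_clear.
move=> [hc [hg he hf hcc]]; rewrite (holds_pos (k := 0)) /= ?q2 ?hc //.
rewrite 6!run_seq; set s3 := run B (set 54 _) _.
have [R3 L3 F3 G3] : [/\ Rows s3, Log log s3, Fam l1 s3 & Regs g e f s3].
  split.
  - by do !apply: frame_Rows => //.
  - by rewrite /s3 /Log /entry_at !run_frame.
  - by do !apply: frame_Pieces => //.
  by split; rewrite /s3; heap; rewrite q2.
have r3 : s3 sRem 0%R = Posz c by rewrite /s3; heap; rewrite q2.
clearbody s3; set s4 := run B unmark_prog s3.
have F4 : Fam (map (unmark_without g) l1) s4 by apply: run_unmark R3 F3 G3 z2.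
have R4 : Rows s4 by apply: frame_Rows.
have G4 : Regs g e f s4 by apply: frame_Regs.
have r4 : s4 sRem 0%R = Posz c by rewrite /s4 run_frame.
have L4 : Log log s4 by rewrite /s4 /Log /entry_at !run_frame.
have z4 : size (map (unmark_without g) l1) + (0 < c) <= B bP.
  by rewrite size_map; apply: leq_trans z1; rewrite leq_add2l leq_b1.
clearbody s4; have [F5 r5] := run_transfer true R4 F4 G4 r4 z4.
set s5 := run B (transfer_prog true) s4 in F5 r5 *.
have R5 : Rows s5 by apply: frame_Rows.
have G5 : Regs g e f s5 by apply: frame_Regs.
have L5 : Log log s5 by rewrite /s5 /Log /entry_at !run_frame.
clearbody s5; have [z5 _] := transfer_size (selects true g) g e f (B bP)
  (c, map (unmark_without g) l1).
have [F6 r6] := run_transfer false R5 F5 G5 r5 (leq_trans z5 z4).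
split.
- exact: frame_Rows.
- by rewrite /Log /entry_at !run_frame.
by move: F6; rewrite -surjective_pairing.
Qed.

End Undo.

Definition compare_rows : prog :=
  PFor lz aM (When (Not (Eq (Read fJ (at2 tM (cell lx) (cell lz)))
                            (Read oJ (at2 tM (cell ly) (cell lz)))))
    (set sEq (Const 0))).

Definition find_row : prog :=
  PFor ly bP (When (Lt (cell ly) (cell oN)) (
    set sEq (Const 1) ;; compare_rows ;;
    When (And (posT (cell sEq)) (Eq (cell sPos) (cell oN))) (set sPos (cell ly)))).

Definition append_row : prog :=
  PFor lz aM (PWrite oJ (at2 tM (cell oN) (cell lz)) (Read fJ (at2 tM (cell lx) (cell lz)))) ;;
  PWrite oL (cell oN) (Read fL (cell lx)) ;; set oN (Plus (cell oN) (Const 1)).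

Definition output_prog : prog :=
  PFor lx bP (When (Lt (cell lx) (cell fN)) (
    set sPos (cell oN) ;; find_row ;;
    PIf (Lt (cell sPos) (cell oN))
      (PWrite oL (cell sPos) (Plus (Read oL (cell sPos)) (Read fL (cell lx))))
      append_row)).

Section Output.
Variable m : nat.
Variable B : nat -> nat.
Hypothesis Bm : B 1 = m.
Notation Rows := (Rows m B).
Notation no_mult := (no_mult 'I_m).

Definition Out (l : seq (mult 'I_m)) (s : memory) : Prop :=
  s oN 0%R = Posz (size l) /\ forall i, i < size l ->
    s oL (Posz i) = Posz (nth no_mult l i).2 /\
    forall e : 'I_m, s oJ (Posz (i * m + e)) = Posz (e \in (nth no_mult l i).1).

Lemma foldl_andb (T : Type) (P : pred T) b s :
  foldl (fun b x => b && P x) b s = b && all P s.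
Proof. by elim: s b => [|x s IH] b /=; rewrite ?andbT // IH andbA. Qed.

(* The invariant of the output loop: row [i] of the family is being read and
   the rows [l] have been written. *)
Definition Merging (u : piece 'I_m) i (l : seq (mult 'I_m)) (s : memory) : Prop :=
  [/\ Rows s, Out l s, s lx 0%R = Posz i & piece_at s i u].

Lemma frame_Merging u i l p s :
  all (fun a => a \notin writes p) [:: 1; 5; 6; 7; 15; 40; 51; 52; 53] ->
  Merging u i l s -> Merging u i l (run B p s).
Proof.
move=> h; have {}h a : a \in [:: 1; 5; 6; 7; 15; 40; 51; 52; 53] ->
    run B p s a = s a by move=> ha; apply/run_frame/(allP h).
by rewrite /Merging /Rows /Out /piece_at !h.
Qed.

Lemma run_compare_rows u i l j s : i <= B bP -> size l <= B bP -> j < size l ->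
  Merging u i l s -> s ly 0%R = Posz j -> s sEq 0%R = 1%R ->
  run B compare_rows s sEq 0%R = Posz ((nth no_mult l j).1 == u.1.1).
Proof.
move=> hi hl hj hM hy hE.
pose Rp (b : bool) (s : memory) :=
  [/\ Merging u i l s, s ly 0%R = Posz j & s sEq 0%R = Posz b].
pose P (e : 'I_m) := (e \in u.1.1) == (e \in (nth no_mult l j).1).
have : Rp (foldl (fun b e => b && P e) true (enum 'I_m)) (run B compare_rows s).
  apply: run_for_fold => // b s1 e [hM1 hy1 hE1] hz.
  have [[hm hr] [hN hO] hx [_ _ hJ]] := hM1.
  have [_ hOj] := hO j hj.
  rewrite run_when holds_NEq.
  have -> : eval s1 (Read 52 (at2 15 (cell 40) (cell 42))) = Posz (e \in u.1.1).
    by rewrite /= hx hz hr // -hJ.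
  have -> : eval s1 (Read 7 (at2 15 (cell 41) (cell 42))) =
      Posz (e \in (nth no_mult l j).1).
    by rewrite /= hy1 hz hr -?hOj //; apply: leq_trans hl; apply: ltnW.
  have -> : (Posz (e \in u.1.1) != Posz (e \in (nth no_mult l j).1)) = ~~ P e.
    by rewrite /P; do 2!case: (_ \in _).
  case: (P e); rewrite ?andbT ?andbF /=; first by split.
  split; [by apply: frame_Merging | by rewrite run_frame | by rewrite read_set].
rewrite foldl_andb /= => -[_ _ ->]; congr (Posz (nat_of_bool _)).
apply/allP/eqP => [h|E e _]; last by rewrite /P E eqxx.
by apply/setP => e; have /eqP -> := h e (mem_enum _ _).
Qed.

Lemma run_find_row u i l s : i <= B bP -> size l <= B bP ->
  Merging u i l s -> s sPos 0%R = Posz (size l) ->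
  Merging u i l (run B find_row s) /\
  run B find_row s sPos 0%R = Posz (find (fun y : mult 'I_m => y.1 == u.1.1) l).
Proof.
move=> hi hl hM hp; set P := (fun y : mult 'I_m => _).
pose I j (s : memory) := Merging u i l s /\
  s sPos 0%R = Posz (if has P (take j l) then find P l else size l).
suff [h1 h2] : I (B bP) (run B find_row s).
  split=> //; rewrite h2 take_oversize //; case: ifP => // /negbT h.
  by rewrite hasNfind.
apply: run_for => //; first by rewrite /I take0.
move=> j s1 hj [M1 p1] hy; have [_ [hN _] _ _] := M1.
rewrite run_when holds_Lt /= hN hy ltz_nat.
case: (ltnP j (size l)) => jl; last first.
  by split=> //; rewrite p1 !take_oversize //; apply: leqW.
rewrite 2!run_seq; set s2 := run B (set 57 _) s1.
have M2 : Merging u i l s2 by apply: frame_Merging.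
have [p2 y2] : s2 sPos 0%R = s1 sPos 0%R /\ s2 ly 0%R = Posz j.
  by rewrite /s2 !run_frame.
have e2 : s2 sEq 0%R = 1%R by rewrite /s2 read_set.
clearbody s2; have E3 := run_compare_rows hi hl jl M2 y2 e2.
set s3 := run B compare_rows s2 in E3 *.
have M3 : Merging u i l s3 by apply: frame_Merging.
have [p3 y3] : s3 sPos 0%R = s2 sPos 0%R /\ s3 ly 0%R = Posz j.
  by rewrite /s3 !run_frame.
clearbody s3; rewrite -/(P (nth no_mult l j)) in E3.
have [_ [N3 _] _ _] := M3.
rewrite run_when holds_And (holds_pos (s := s3) (e := cell 57) E3) lt0b holds_Eq /=.
rewrite p3 p2 p1 N3 eqz_nat /I (take_nth no_mult jl) has_rcons.
case: (boolP (has P (take j l))) => hh.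
  have : has P l by rewrite -(cat_take_drop j l) has_cat hh.
  rewrite has_find => lt; rewrite (ltn_eqF lt) andbF orbT; split=> //.
  by rewrite p3 p2 p1 hh.
rewrite eqxx andbT orbF; case: (boolP (P (nth no_mult l j))) => hP; last first.
  by split=> //; rewrite p3 p2 p1 (negbTE hh).
split; first exact: frame_Merging.
rewrite read_set /= y3 -{1}(cat_take_drop j l) find_cat (negbTE hh).
by rewrite (drop_nth no_mult jl) /= hP size_take jl addn0.
Qed.

Lemma run_append_row u i l s : i <= B bP -> size l <= B bP -> Merging u i l s ->
  Out (rcons l (u.1.1, u.2)) (run B append_row s).
Proof.
move=> hi hl hM; rewrite /append_row run_seq.
pose I k (s : memory) := Merging u i l s /\
  forall e : 'I_m, e < k -> s oJ (Posz (size l * m + e)) = Posz (e \in u.1.1).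
set s1 := run B (PFor _ _ _) s.
have [[R1 [N1 O1] x1 [u1 u2 u3]] c1] : I (B 1) s1.
  apply: run_for => // k s2 hk [[R2 [N2 O2] x2 [v1 v2 v3]] c2] hz.
  rewrite Bm in hk; pose e := Ordinal hk; have [_ hr] := R2.
  have ev : eval s2 (at2 15 (cell 5) (cell 42)) = Posz (size l * m + e).
    by rewrite /= N2 hz hr.
  have ev2 : eval s2 (Read 52 (at2 15 (cell 40) (cell 42))) = Posz (e \in u.1.1).
    by rewrite /= x2 hz hr // -v3.
  split.
    split; [exact: frame_Rows | | by rewrite run_frame | by split; rewrite ?run_frame //].
    split; first by rewrite run_frame.
    move=> j hj; have [o1 o2] := O2 j hj; split; first by rewrite run_frame.
    by move=> x; rewrite readW_eq ev eqz_nat idx_eq (ltn_eqF hj) o2.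
  move=> x hx'; rewrite readW_eq ev eqz_nat idx_eq eqxx andTb ev2.
  case: (x =P e) => [->|ne] //; apply: c2.
  rewrite ltn_neqAle -ltnS hx' andbT; apply/eqP => xk; apply: ne; exact: val_inj.
clearbody s1; rewrite run_seq; split.
  by heap; rewrite N1 size_rcons -PoszD addn1.
move=> j; rewrite size_rcons ltnS leq_eqVlt nth_rcons => /orP[/eqP ->|hj].
  rewrite ltnn eqxx; split=> [|e]; heap; first by rewrite N1 eqxx x1 u1.
  by rewrite c1 // Bm.
by rewrite hj; have [o1 o2] := O1 j hj; split=> [|e]; heap; rewrite // N1 eqz_nat (ltn_eqF hj).
Qed.

Lemma run_output fam s : Rows s -> Fam fam s -> Out [::] s -> size fam <= B bP ->
  Out (merge_pieces fam) (run B output_prog s).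
Proof.
move=> hR hF hO hsz.
pose I k (s : memory) := [/\ Rows s, Fam fam s & Out (merge_pieces (take k fam)) s].
suff [_ _] : I (B bP) (run B output_prog s) by rewrite take_oversize.
apply: run_for => //; first by rewrite /I take0.
move=> k s1 hk [R1 F1 O1] x1; have [hN hu] := F1.
rewrite run_when holds_Lt /= x1 hN ltz_nat.
case: (ltnP k (size fam)) => kf; last first.
  by split=> //; move: O1; rewrite !take_oversize //; apply: leqW.
set l := merge_pieces _ in O1; set u := nth (no_piece _) fam k.
have el : merge_pieces (take k.+1 fam) = insert l (u.1.1, u.2).
  by rewrite (take_nth (no_piece _) kf) /merge_pieces foldl_rcons.
have sl : size l <= B bP.
  have [_ _ h _] := merge_pieces_spec (take k fam) (fun=> 0).
  apply: leq_trans h _; rewrite size_take kf; exact: ltnW.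
rewrite /I el; rewrite 2!run_seq; set s2 := run B (set 56 _) s1.
have M2 : Merging u k l s2.
  apply: frame_Merging => //; split=> //; exact: hu.
have F2 : Fam fam s2 by apply: frame_Pieces.
have p2 : s2 sPos 0%R = Posz (size l) by rewrite /s2 read_set /=; case: O1.
clearbody s2; have [M3 p3] := run_find_row (ltnW hk) sl M2 p2.
set s3 := run B find_row s2 in M3 p3 *.
have F3 : Fam fam s3 by apply: frame_Pieces.
clearbody s3; have [R3 O3 x3 [u1 u2 u3]] := M3; have [N3 O3'] := O3.
rewrite run_if holds_Lt.
have -> : (eval s3 (cell 56) < eval s3 (cell 5))%R =
    (find (fun y : mult 'I_m => y.1 == u.1.1) l < size l).
  by rewrite /= p3 N3 ltz_nat.
rewrite /insert /=; case: ifP => hf; last first.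
  by split; [exact: frame_Rows | exact: frame_Pieces | exact: (run_append_row (ltnW hk))].
split; [exact: frame_Rows | exact: frame_Pieces |].
split=> [|j]; first by rewrite run_frame // N3 size_set_nth (maxn_idPr hf).
rewrite size_set_nth (maxn_idPr hf) nth_set_nth /= => hj.
have [o1 o2] := O3' j hj; split=> [|e].
  heap; rewrite p3 eqz_nat; case: (j =P _) => [jf|_] //=; rewrite ?jf.
  have [o3 _] := O3' _ hf; by rewrite o3 x3 u1.
rewrite run_frame // o2; case: (j =P _) => [jf|_] //=; rewrite jf.
have hP : has (fun y : mult 'I_m => y.1 == u.1.1) l by rewrite has_find.
by have /eqP := nth_find no_mult hP => ->.
Qed.

End Output.

Definition sum_sizes : prog :=
  set 10 (Plus (Plus (cell aN) (cell aM)) (Const 1)).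

Definition square (src dst : nat) : prog :=
  PFor lx src (set dst (Plus (cell dst) (cell src))).

Definition pack : prog :=
  forward ;; set fN (Const 1) ;; PWrite fL (Const 0) (cell sTau) ;;
  undo_prog ;; When (posT (cell sTau)) output_prog.

Definition bounds (n m a : nat) : nat :=
  match a with
  | 0 => n | 1 => m
  | 10 => n + m + 1 | 11 => (n + m + 1) ^ 2
  | 12 => (n + m + 1) ^ 4 | 13 => (n + m + 1) ^ 8
  | _ => 0
  end.

Lemma bounds_le n m a : bounds n m a <= (n + m).+1 ^ 8.
Proof.
have h1 : n + m < (n + m).+1 ^ 8 by rewrite -{1}(expn1 (n + m).+1) leq_pexp2l.
have h2 : 0 <= (n + m).+1 ^ 8 by [].
have hp d : d <= 8 -> (n + m).+1 ^ d <= (n + m).+1 ^ 8 by apply: leq_pexp2l.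
rewrite /bounds addn1.
have h3 := hp 2 isT; have h4 := hp 4 isT; have h8 := hp 8 isT.
move: h1 h2 h3 h4 h8; clear hp.
move: (_ ^ 2) (_ ^ 4) (_ ^ 8) => x2 x4 x8 *.
by do 14?[case: a => [|a]] => //=; lia.
Qed.

Lemma run_square B src dst s : dst != lx -> src != lx -> src != dst ->
  s src 0%R = Posz (B src) -> s dst 0%R = 0%R ->
  run B (square src dst) s dst 0%R = Posz (B src * B src).
Proof.
move=> h1 h2 h3 hs hd.
pose I k (s : memory) := s src 0%R = Posz (B src) /\ s dst 0%R = Posz (k * B src).
suff [] : I (B src) (run B (square src dst) s) by [].
apply: run_for => [k s1 z [i1 i2]|//|k s1 _ [i1 i2] _].
  by split; rewrite update_neq // eq_sym.
rewrite /I readW_ne // readW_eq /= i1 i2 -PoszD mulSn addnC; split=> //.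
Qed.

Lemma size_bound n m L : n + m + 1 = L -> L <> 1 ->
  1 + (2 * m + n * (4 * (n * n) + 2)) <= L ^ 8.
Proof.
move=> hL h1; have : 2 <= L by lia.
have hn : n <= L by lia. have hm : m <= L by lia.
move=> L2; have hnn : n * (n * n) <= L * (L * L) by rewrite !leq_mul.
have : 8 * (L * (L * L)) <= L ^ 8.
  have -> : L ^ 8 = L ^ 3 * L ^ 5 by rewrite -expnD.
  rewrite mulnC; apply: leq_mul; first by rewrite !expnS expn0 muln1.
  by apply: (@leq_trans (2 ^ 5)) => //; rewrite leq_exp2r.
have : L * 4 <= L * (L * L) by rewrite leq_mul2l (@leq_mul 2 2) ?orbT.
lia.
Qed.

Section Pack.
Variables (n m : nat) (D : digraph 'I_n 'I_m) (w : 'I_m -> nat).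
Variable B : nat -> nat.
Hypotheses (Bn : B 0 = n) (Bm : B 1 = m).
Hypothesis BP : 1 + (2 * m + n * (4 * (n * n) + 2)) <= B bP.

Lemma run_pack s : chordal (underlying D) -> dicuts D != set0 ->
  s aN 0%R = Posz n -> s aM 0%R = Posz m ->
  (forall e : 'I_m, s aT (Posz e) = Posz (arc_tail D e)) ->
  (forall e : 'I_m, s aH (Posz e) = Posz (arc_head D e)) ->
  (forall e : 'I_m, s aW (Posz e) = Posz (w e)) ->
  (forall i, s oN i = 0%R) ->
  (forall a, 14 <= a -> a != 40 -> forall i, s a i = 0%R) ->
  exists (tau N : nat) (J : 'I_N -> {set 'I_m}) (lambda : 'I_N -> nat),
    [/\ min_dicut_weight D w tau, output (run B pack s) J lambda
      & compact_packing D w tau J lambda].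
Proof.
move=> hch hd hN hM hT hH hW hO hz.
have {}hd : exists U, dicutin D setT U.
  by have [C /dicutsP[U hU _]] := set0Pn _ hd; exists U.
have := run_forward Bn Bm hch hd hN hM hT hH hW hz.
move=> [ar [W [l [acc [tau [T1 S1 t1 hF sl]]]]]].
rewrite /pack run_seq; set s1 := run B forward s in T1 S1 t1 *.
have Z1 a : a \in [:: 5; 50; 51; 52; 53] -> forall i, s1 a i = 0%R.
  move=> ha i; have hw : all (fun a => a \notin writes forward) [:: 5; 50; 51; 52; 53] by [].
  rewrite /s1 run_frame ?(allP hw a ha) //.
  by move: ha; rewrite !inE => /or4P[/eqP->|/eqP->|/eqP->|/orP[]/eqP->]; rewrite ?hO // hz.
have [[hB _] _ _] := T1; have [_ Hm _ _ [_ Hr]] := hB.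
clearbody s1. rewrite 2!run_seq.
set s2 := run B (PWrite 51 _ _) _; pose fam0 := [:: (@set0 'I_m, false, tau)].
have R2 : Rows m B s2 by split=> [|i hi]; rewrite /s2 !run_frame // Hr.
have [_ L2 _] : State W l acc s2 by do 2!apply: frame_State => //.
have F2 : Fam fam0 s2.
  split; first by rewrite /s2; heap.
  case=> // _; split=> [||e]; rewrite /s2; heap; rewrite ?t1 ?Z1 ?inE ?muln0 //.
have t2 : s2 sTau 0%R = Posz tau by rewrite /s2 !run_frame.
have O2 i : s2 oN i = 0%R by rewrite /s2 !run_frame // Z1.
clearbody s2. rewrite run_seq; set s3 := run B undo_prog s2.
have hsz : size fam0 + size l <= B bP.
  by apply: leq_trans BP; rewrite leq_add2l.
have F3 := run_undo Bm R2 L2 F2 hsz; rewrite -/s3 in F3.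
have R3 : Rows m B s3 by apply: frame_Rows.
have t3 : s3 sTau 0%R = Posz tau by rewrite /s3 run_frame.
have O3 i : s3 oN i = 0%R by rewrite /s3 run_frame.
clearbody s3; have [_ _ _ hU hV] := hF.
have valid_tau : 0 < tau -> valid D tau setT w (undo_all (B bP) fam0 l).
  move=> tau0; apply: hV => //; split.
  - by case.
  - by move=> x; rewrite /usage /wsum big_seq1 inE muln0.
  - by rewrite /amount /wsum big_seq1 muln1.
  case=> // _; split=> [e|U [sU U0 _ _]]; first by rewrite inE.
  by move: U0; rewrite -subset0 sU.
exists tau; rewrite run_when (holds_pos (s := s3) (e := cell 33) t3).
have hmin := min_weight_valid hU valid_tau.
case: (posnP tau) => tau0.
  exists 0, (fun=> set0), (fun=> 0); split=> //.
    by split; [rewrite O3 | case | case].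
  by split; [case | case | rewrite big_ord0 tau0 | move=> e; rewrite big_ord0].
have [o1 o2] : Out (merge_pieces (undo_all (B bP) fam0 l)) (run B output_prog s3).
  apply: run_output => //.
  by have /andP[_ h] := undo_all_size (B bP) l fam0; apply: leq_trans h hsz.
have hp := packing_merge (valid_tau tau0).
eexists _, _, _; split; [exact: hmin | | exact: hp].
by split=> // i; have [] := o2 i (ltn_ord i).
Qed.

End Pack.

Lemma exec_seq B bnd p c s t s' : bounded bnd p ->
  (forall a, a \in bnd -> s a 0%R = Posz (B a)) ->
  (forall s1, s1 = run B p s -> exists2 t1, exec c s1 t1 s' & t1 <= t) ->
  exists2 t1, exec (Seq (compile p) c) s t1 s' & t1 <= time B p + t.
Proof.
move=> hp hs hc; have [t1 e1 l1] := exec_run hp hs.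
have [t2 e2 l2] := hc _ (erefl _).
by exists (t1 + t2); [apply: ExecSeq e1 e2 | apply: leq_add].
Qed.

Lemma array_ord m (f : 'I_m -> nat) (e : 'I_m) : array f (Posz e) = Posz (f e).
Proof. by rewrite /array valK. Qed.

Theorem mainTheorem2 :
  exists (prog : cmd) (k : nat),
    forall (n m : nat) (D : digraph 'I_n 'I_m) (w : 'I_m -> nat),
      dicuts D != set0 ->
      chordal (underlying D) ->
      exists (t : nat) (s : memory),
        [/\ exec prog (input D w) t s,
            (t <= k * (n + m + 1) ^ k)%N
          & exists (tau N : nat) (J : 'I_N -> {set 'I_m})
                   (lambda : 'I_N -> nat),
              [/\ min_dicut_weight D w tau,
                  output s J lambda
                & compact_packing D w tau J lambda]].
Proof.
pose T p M := time (fun=> M.+1 ^ 8) p.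
have hT p : polynomially_bounded (T p) := poly_bound_comp 8 (poly_bound_time p).
have [k hk] : polynomially_bounded (fun M => T sum_sizes M + (T (square 10 11) M +
    (T (square 11 12) M + (T (square 12 13) M + T pack M)))).
  by do 4!apply: (poly_bound_add (hT _)) => //.
exists (Seq (compile sum_sizes) (Seq (compile (square 10 11))
  (Seq (compile (square 11 12)) (Seq (compile (square 12 13)) (compile pack))))), k.
move=> n m D w hd hch; set s0 := input D w; pose B := bounds n m.
have sizes_neq : n + m + 1 <> 1.
  have [C /dicutsP[U [_ U0 _ _] _]] := set0Pn _ hd.
  have [x _] := set0Pn _ U0; have := ltn_ord x; lia.
set s1 := run B sum_sizes s0; set s2 := run B (square 10 11) s1.
set s3 := run B (square 11 12) s2; set s4 := run B (square 12 13) s3.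
have r1 : s1 10 0%R = Posz (B 10) by rewrite /s1 /sum_sizes readW_eq.
have r2 : s2 11 0%R = Posz (B 11).
  by rewrite /s2 (run_square (B := B)) // /s1 run_frame.
have r3 : s3 12 0%R = Posz (B 12).
  rewrite /s3 (run_square (B := B)) // /s2 /s1 ?run_frame //.
  by rewrite /B /bounds -expnD.
have r4 : s4 13 0%R = Posz (B 13).
  rewrite /s4 (run_square (B := B)) // /s3 /s2 /s1 ?run_frame //.
  by rewrite /B /bounds -expnD.
have f4 a : a \notin [:: 10; 11; 12; 13; 40] -> s4 a = s0 a.
  by move=> ha; rewrite /s4 /s3 /s2 /s1 !run_frame //;
    move: ha; rewrite /= !inE; lia.
have i0 : s4 0 0%R = Posz n by rewrite f4.
have i1 : s4 1 0%R = Posz m by rewrite f4.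
have [t e ht] : exists2 t, exec (Seq (compile sum_sizes) (Seq (compile (square 10 11))
    (Seq (compile (square 11 12)) (Seq (compile (square 12 13)) (compile pack)))))
    s0 t (run B pack s4) &
    t <= time B sum_sizes + (time B (square 10 11) + (time B (square 11 12) +
    (time B (square 12 13) + time B pack))).
  apply: (@exec_seq B [::]) => // _ ->; apply: (@exec_seq B [:: 10]) => //.
    by move=> a; rewrite inE => /eqP ->.
  move=> _ ->; apply: (@exec_seq B [:: 11]) => //.
    by move=> a; rewrite inE => /eqP ->.
  move=> _ ->; apply: (@exec_seq B [:: 12]) => //.
    by move=> a; rewrite inE => /eqP ->.
  move=> _ ->; apply: (@exec_run B [:: 0; 1; 13]) => // a.
  by rewrite !inE => /or3P[]/eqP ->.
exists t, (run B pack s4); split=> //.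
  apply: leq_trans ht _; rewrite addn1; apply: leq_trans (hk _).
  have hB p : time B p <= T p (n + m) by apply: time_mono => a; apply: bounds_le.
  by do 4!apply: (leq_add (hB _)) => //.
apply: run_pack => //.
- exact: size_bound.
- by move=> e0; rewrite f4 //; apply: (array_ord (fun e => nat_of_ord (arc_tail D e))).
- by move=> e0; rewrite f4 //; apply: (array_ord (fun e => nat_of_ord (arc_head D e))).
- by move=> e0; rewrite f4 //; apply: (array_ord w).
- by move=> x; rewrite f4.
move=> a ha ne i; rewrite f4; last by rewrite !inE; lia.
by do 14?[case: a ha ne => // a ha ne].
Qed.
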